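(* The square torus and the hexagonal torus are each realized by an $8$-vertex paper torus. That is, there is an $8$-vertex paper torus whose intrinsic metric is a flat torus with reduced modulus exactly $\hat\tau = i$, and there is an $8$-vertex paper torus whose intrinsic metric is a flat torus with reduced modulus exactly $\hat\tau = \rho = e^{i\pi/3}$.
   Context: A flat torus is a torus with a locally Euclidean metric, i.e. isometric to $\mathbb{C}/\Lambda$ for a lattice $\Lambda$. A positively oriented basis $\Lambda = \mathbb{Z}v_1 \oplus \mathbb{Z}v_2$ gives $\tau = v_2/v_1 \in \mathbb{H}$ (upper half plane); changing basis acts by $\mathrm{PSL}(2,\mathbb{Z})$. The reduced modulus $\hat\tau$ is the representative of the orbit of $\tau$ in $\mathcal{D} = \{z \in \mathbb{H} : |z| \ge 1,\ |\operatorname{Re} z| \le \tfrac12\}$, taking $\operatorname{Re}\hat\tau \ge 0$ when the representative is not unique. The square torus has $\hat\tau = i$ and the hexagonal torus has $\hat\tau = \rho = e^{i\pi/3}$ (flat tori being considered up to scaling). A triangulation of the torus is a simplicial complex $T$ homeomorphic to the torus, with vertex set $V$. A map $q : V \to \mathbb{R}^3$ extends uniquely to a piecewise linear map $T \to \mathbb{R}^3$, affine on each face. An $8$-vertex paper torus is the image of such a map for a triangulation with $|V| = 8$, where all faces are nondegenerate triangles, the map is injective, and at every vertex the cone angle (the sum of the angles of the incident triangles, measured in $\mathbb{R}^3$) equals $2\pi$. Its intrinsic metric is then a flat torus, and that flat torus is said to be realized by it. *)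

(* Defs.v *)
From mathcomp Require Import all_boot all_order all_algebra.
From mathcomp Require Import complex.
From mathcomp Require Import all_classical all_reals all_analysis.

Set Implicit Arguments.
Unset Strict Implicit.
Unset Printing Implicit Defensive.

Import Order.TTheory GRing.Theory Num.Theory.
Import numFieldNormedType.Exports.

Local Open Scope classical_set_scope.
Local Open Scope complex_scope.
Local Open Scope ring_scope.

(* The library norm on row vectors is the sup norm (it induces the same
   topology), hence the explicit Euclidean structure. *)
Definition dotv (R : realType) (k : nat) (u v : 'rV[R]_k) : R :=
  (u *m v^T) 0 0.

Definition norm2 (R : realType) (k : nat) (u : 'rV[R]_k) : R :=
  Num.sqrt (dotv u u).

Definition angle (R : realType) (k : nat) (p a b : 'rV[R]_k) : R :=
  acos (dotv (a - p) (b - p) / (norm2 (a - p) * norm2 (b - p))).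

(* Length of c on [0, 1]. As for [itv_partition], a subdivision
   0 = t_0 < t_1 < ... < t_m = 1 is given by s = [:: t_1; ...; t_m]. *)
Definition curve_length (R : realType) (k : nat) (c : R -> 'rV[R]_k) : \bar R :=
  ereal_sup [set (\sum_(0 <= j < size s)
                   norm2 (c (nth 0 (0 :: s) j.+1) - c (nth 0 (0 :: s) j)))%:E
            | s in [set s : seq R | itv_partition 0 1 s]].

Definition curve_in (R : realType) (k : nat) (X : set 'rV[R]_k)
    (x y : 'rV[R]_k) (c : R -> 'rV[R]_k) : Prop :=
  [/\ {within `[0, 1], continuous c}, c 0 = x, c 1 = y
    & forall t : R, 0 <= t <= 1 -> X (c t)].

(* +oo when x and y are not joined by a rectifiable curve in X *)
Definition intrinsic_dist (R : realType) (k : nat) (X : set 'rV[R]_k)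
    (x y : 'rV[R]_k) : \bar R :=
  ereal_inf [set curve_length c | c in curve_in X x y].

Definition simplicial_complex (n : nat) (T : {set {set 'I_n}}) : Prop :=
  [/\ finset.set0 \notin T,
      forall v : 'I_n, [set v]%SET \in T
    & forall F G : {set 'I_n},
        F \in T -> G \subset F -> G != finset.set0 -> G \in T].

Definition is_triangle (n : nat) (T : {set {set 'I_n}}) (a b c : 'I_n) : bool :=
  ([set a; b; c]%SET \in T) && (#|[set a; b; c]%SET| == 3)%N.

(* geometric realization, in barycentric coordinates *)
Definition realization (R : realType) (n : nat) (T : {set {set 'I_n}}) :
    set 'rV[R]_n :=
  [set x : 'rV[R]_n | [/\ forall v, 0 <= x 0 v, \sum_v x 0 v = 1
             & [set v | x 0 v != 0]%SET \in T]].

Definition homeomorphic (X Y : topologicalType) (A : set X) (B : set Y) : Prop :=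
  exists (f : X -> Y) (g : Y -> X),
    [/\ {within A, continuous f}, {within B, continuous g},
        forall x, A x -> B (f x) /\ g (f x) = x
      & forall y, B y -> A (g y) /\ f (g y) = y].

Definition circle (R : realType) : set (R * R) :=
  [set z : R * R | z.1 ^+ 2 + z.2 ^+ 2 = 1].

Definition torus_triangulation (R : realType) (n : nat) (T : {set {set 'I_n}}) :
    Prop :=
  simplicial_complex T /\
  homeomorphic (@realization R n T) (@circle R `*` @circle R).

(* piecewise linear extension of q : V -> R^3 *)
Definition pl_map (R : realType) (n : nat) (q : 'I_n -> 'rV[R]_3)
    (x : 'rV[R]_n) : 'rV[R]_3 :=
  \sum_v x 0 v *: q v.

Definition pl_image (R : realType) (n : nat) (T : {set {set 'I_n}})
    (q : 'I_n -> 'rV[R]_3) : set 'rV[R]_3 :=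
  pl_map q @` realization T.

(* The condition a < b makes each triangle incident to v count once. *)
Definition cone_angle (R : realType) (n : nat) (T : {set {set 'I_n}})
    (q : 'I_n -> 'rV[R]_3) (v : 'I_n) : R :=
  \sum_(a < n) \sum_(b < n | (a < b)%N && is_triangle T v a b)
    angle (q v) (q a) (q b).

Definition paper_torus (R : realType) (n : nat) (T : {set {set 'I_n}})
    (q : 'I_n -> 'rV[R]_3) : Prop :=
  [/\ torus_triangulation R T,
      forall a b c, is_triangle T a b c ->
        row_free (col_mx (q b - q a) (q c - q a)),
      {in realization T &, injective (pl_map q)}
    & forall v, cone_angle T q v = 2 * pi].

Definition lattice (R : realType) (v1 v2 : R[i]) : set R[i] :=
  [set z : R[i] | exists m n : int, z = v1 *~ m + v2 *~ n].

(* quotient metric of C / (Z v1 + Z v2), on representatives *)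
Definition flat_dist (R : realType) (v1 v2 z w : R[i]) : R :=
  inf [set Normc.normc (z - w - l) | l in lattice v1 v2].

(* X with its intrinsic metric is isometric to C / (Z v1 + Z v2). The isometry
   is given as a map p on C; the second condition forces p to factor through
   the quotient, injectively, since both distances separate points. *)
Definition isometric_flat_torus (R : realType) (k : nat) (X : set 'rV[R]_k)
    (v1 v2 : R[i]) : Prop :=
  exists p : R[i] -> 'rV[R]_k,
    range p = X /\
    forall z w, intrinsic_dist X (p z) (p w) = (flat_dist v1 v2 z w)%:E.

Definition modular_domain (R : realType) : set R[i] :=
  [set z : R[i] | [/\ 0 < complex.Im z, 1 <= Normc.normc z
             & `|complex.Re z| <= 1 / 2]].

Definition modular_orbit (R : realType) (tau : R[i]) : set R[i] :=
  [set z : R[i] | exists a b c d : int, a * d - b * c = 1 /\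
             z = (a%:~R * tau + b%:~R) / (c%:~R * tau + d%:~R)].

Definition is_reduced_modulus (R : realType) (tau t : R[i]) : Prop :=
  let representatives := modular_orbit tau `&` @modular_domain R in
  representatives t /\
  ((exists2 t', representatives t' & t' <> t) -> 0 <= complex.Re t).

(* The basis (v1, v2) is positively oriented when v2 / v1 is in the upper
   half plane, which also makes it linearly independent over R. *)
Definition flat_torus_with_modulus (R : realType) (k : nat) (X : set 'rV[R]_k)
    (t : R[i]) : Prop :=
  exists v1 v2 : R[i],
    [/\ 0 < complex.Im (v2 / v1), isometric_flat_torus X v1 v2
      & is_reduced_modulus (v2 / v1) t].

Definition realized (R : realType) (n : nat) (t : R[i]) : Prop :=
  exists (T : {set {set 'I_n}}) (q : 'I_n -> 'rV[R]_3),
    paper_torus T q /\ flat_torus_with_modulus (pl_image T q) t.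

(* e^(i pi / 3) *)
Definition rho (R : realType) : R[i] := cos (pi / 3) +i* sin (pi / 3).

(* Main.v *)
(* Both tori are C / Lambda with Lambda = S (Z + Z tau), for tau = i or e^(i pi / 3). An
   8-vertex triangulation is given with lifts of its vertices to the plane. The 24 equations
   saying that each edge has the same length in space and in the plane are polynomial in the
   24 space and 16 plane coordinates. From an approximate integer solution, the simplified
   Newton iteration gives an exact one, each coordinate of which lies within 1 of its integer
   centre. The other conditions are open, and are verified on this box by integer arithmetic:
   - the lifted triangles are positively oriented, and their translates are pairwise separated
     by lines; as each vertex is surrounded by its star, continuity along segments shows
     that they cover the plane;
   - two triangles in space are separated by a plane, or share an edge and are not coplanar.
   Since edge lengths agree, the piecewise linear map is isometric on each triangle. Hence the
   cone angles are sums of plane angles around a point, and a curve on the surface and its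
   development in the plane have the same length. *)

Require Import Defs.
From Stdlib Require Import BinInt.
From HB Require Import structures.
From mathcomp Require Import all_boot all_order all_algebra.
From mathcomp Require Import complex.
From mathcomp Require Import all_classical all_reals all_analysis.
From mathcomp Require Import ssrZ zify ring lra.

Set Implicit Arguments.
Unset Strict Implicit.
Unset Printing Implicit Defensive.

Import Order.TTheory GRing.Theory Num.Theory.
Import numFieldNormedType.Exports.

Local Open Scope classical_set_scope.
Local Open Scope complex_scope.
Local Open Scope ring_scope.

(** The cone angle conditions are transcendental, and the modulus of a flat surface appears only
    after developing it. With the plane lifts as further unknowns over a fixed lattice, both become
    polynomial equations, and the modulus is exact although the coordinates are known only up to 1.
    In orthonormal coordinates the hexagonal lattice would bring in the square root of 3; along the
    lattice basis the squared length is [a^2 + t a b + b^2] with [t = 0] or [1], and all checks stay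
    in the integers.

    Solutions are not isolated: motions of space and translations of the plane already give 8
    parameters. So 24 coordinates are solved for and the other 16 are frozen. The equations being
    quadratic, their derivative varies over the box by an amount independent of the size of the
    coordinates; at the scale [S = 100000] a box of radius 1 is relatively small.

    A curve on the surface is merely continuous and may change faces infinitely often, so it cannot
    be developed face after face; the induction runs over the finite set of closed pieces
    instead. *)

(** * Closed covers of an interval *)

Lemma sup_itvcc_closed (R : realType) (A : set R) (a b : R) :
  closed A -> A a -> a <= b ->
  let m := sup (A `&` [set t | a <= t <= b]) in
  [/\ A m, a <= m, m <= b & forall t, A t -> m < t -> t <= b -> False].
Proof.
move=> cA Aa ab /=; set B := _ `&` _; set m := sup B.
have Ba : B a by split=> //=; rewrite lexx.
have ubB : ubound B b by move=> t [_ /= /andP[]].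
have hs : has_sup B by split; [exists a | exists b].
have am : a <= m by apply: ub_le_sup => //; exists b.
have mb : m <= b by apply: ge_sup => //; exists a.
have Am : A m.
  have cB : closure B m by apply: closure_sup; [exists a | exists b].
  rewrite ((closure_id A).1 cA); apply: closure_subset cB => t [].
  by [].
split=> // t At mt tb; have : t <= m.
  by apply: ub_le_sup; [exists b | split=> //=; rewrite tb andbT (le_trans am)// ltW].
by rewrite leNgt mt.
Qed.

(** Since a path may switch pieces infinitely often, [[a, b]] need not split into finitely many
    intervals each inside one [A i]. Instead one jumps from [x] to the last time [m] spent in a
    piece containing [x]: only the two ends of the jump have to lie in that piece. After [m] the
    piece does not occur any more, so the number of remaining pieces drops. *)
Lemma closed_chain (R : realType) (I : finType) (A : I -> set R)
    (P : R -> R -> Prop) (a b : R) :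
  a <= b -> (forall i, closed (A i)) ->
  (forall t, a <= t -> t <= b -> exists i, A i t) ->
  (forall i s t, a <= s -> s <= t -> t <= b -> A i s -> A i t -> P s t) ->
  (forall s t u, a <= s -> s <= t -> t <= u -> u <= b -> P s t -> P t u -> P s u) ->
  P a b.
Proof.
move=> ab cA covA Pstep Ptrans.
suff H : forall n (J : {set I}) x, (#|J| <= n)%N -> a <= x -> x <= b ->
    (forall t, x <= t -> t <= b -> exists2 i, i \in J & A i t) -> P x b.
  apply: (H #|I| [set: I]%SET a); rewrite ?max_card// => t at_ tb.
  by have [i Ait] := covA t at_ tb; exists i; rewrite ?inE.
elim=> [|n IH] J x Jn ax xb covJ.
  have [i iJ _] := covJ x (lexx x) xb.
  by move: Jn; rewrite leqn0 cards_eq0 => /eqP J0; rewrite J0 inE in iJ.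
have [i iJ Aix] := covJ x (lexx x) xb.
have := sup_itvcc_closed (cA i) Aix xb; set m := sup _ => -[Aim xm mb mmax].
have Pxm : P x m by apply: (Pstep i).
have [mb'|bm] := ltP m b; last first.
  by rewrite (_ : b = m)//; apply/eqP; rewrite eq_le bm mb.
have covm t : m < t -> t <= b -> exists2 j, j \in (J :\ i)%SET & A j t.
  move=> mt tb; have [|j jJ Ajt] := covJ t _ tb; first by rewrite (le_trans xm) ?ltW.
  exists j => //; rewrite !inE jJ andbT; apply/eqP => ji.
  by move: Ajt; rewrite ji => /mmax; apply.
apply: (Ptrans x m b) => //; apply: (IH (J :\ i)%SET) => //.
- by rewrite (cardsD1 i) iJ add1n ltnS in Jn.
- exact: le_trans ax xm.
move=> t mt tb; have [mt'|] := ltP m t; first exact: covm.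
move=> tm; have -> : t = m by apply/eqP; rewrite eq_le tm mt.
(* The time [m] itself also lies in a remaining piece: it is a limit of later times, all of which
   do, and a finite union of closed sets is closed. *)
have clU : closed (\bigcup_(j in [set` (J :\ i)%SET]) A j).
  by apply: closed_bigcup => [|j _]; [exact: finite_finset | exact: cA].
suff : (\bigcup_(j in [set` (J :\ i)%SET]) A j) m by move=> [j /= jJ Ajm]; exists j.
rewrite ((closure_id _).1 clU) => B /nbhs_ballP[e /= e0 eB].
have [s /and3P[ms sb se]] : exists s, [&& m < s, s <= b & s < m + e].
  exists (Num.min b (m + e / 2)); rewrite lt_min mb' ge_min lexx gt_min /=.
  by rewrite ltrDl divr_gt0//= ltrD2l ltr_pdivrMr// ltr_pMr// ltr1n orbT.
have [j jJ Ajs] := covm _ ms sb.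
exists s; split; first by exists j.
by apply: eB; rewrite /ball /= ltr_distlC se andbT (lt_trans _ ms)// ltrBlDr ltrDl.
Qed.

(** * Angles in the plane *)

Section Trig.
Variable R : realType.
Implicit Types (x y : R) (u w : R * R).

Lemma cosD2piz x (k : int) : cos (x + 2 * pi * k%:~R) = cos x.
Proof.
have H y (n : nat) : cos (y + 2 * pi * n%:R) = cos y.
  elim: n => [|n IH]; first by rewrite mulr0 addr0.
  rewrite -[RHS]IH -(cosD2pi (y + 2 * pi * n%:R)) -(natr1 n).
  by congr cos; rewrite -mulr_natr; ring.
case: k => n; first exact: H.
rewrite NegzE -(H (x + _) n.+1); congr cos.
by rewrite mulrNz; ring.
Qed.

Lemma sinD2piz x (k : int) : sin (x + 2 * pi * k%:~R) = sin x.
Proof.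
rewrite -[LHS]cosBpihalf -[RHS]cosBpihalf -[RHS](cosD2piz _ k).
by congr cos; ring.
Qed.

Lemma cos_eq1_int x : cos x = 1 -> exists k : int, x = 2 * pi * k%:~R.
Proof.
have pi0 : 0 < 2 * pi :> R by rewrite mulr_gt0// pi_gt0.
move=> cx; set k := Num.floor (x / (2 * pi)); exists k.
set y := x - 2 * pi * k%:~R.
have cy : cos y = 1.
  by rewrite -cx -(cosD2piz y k); congr cos; rewrite /y subrK.
have /andP[] := real_floor_itv (num_real (x / (2 * pi))); rewrite -/k => k1 k2.
have y0 : 0 <= y by rewrite subr_ge0 mulrC -ler_pdivlMr.
have y2 : y < 2 * pi.
  rewrite ltrBlDr (_ : _ + _ = (k%:~R + 1) * (2 * pi)); last by ring.
  by rewrite -ltr_pdivrMr// -intrD1.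
(* The half angle [y / 2] lies in [[0, pi)], where the sine vanishes only at 0. *)
have s0 : sin (y / 2) = 0.
  have := cosD (y / 2) (y / 2); rewrite -splitr cy => h.
  have h2 := cos2Dsin2 (y / 2).
  by apply/eqP; rewrite -sqrf_eq0; apply/eqP; lra.
apply/eqP; rewrite -subr_eq0 -/y; case: (ltP 0 y) => [y_gt0|]; last first.
  by move=> y0'; rewrite eq_le y0 y0'.
by have := @sin_gt0_pi R (y / 2); rewrite s0 ltxx => /(_ _)/implyP; lra.
Qed.

Lemma cos_sin_eq_int x y : cos x = cos y -> sin x = sin y ->
  exists k : int, x = y + 2 * pi * k%:~R.
Proof.
move=> cxy sxy; have [k kE] : exists k : int, x - y = 2 * pi * k%:~R.
  by apply: cos_eq1_int; rewrite cosB cxy sxy -!expr2 cos2Dsin2.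
by exists k; rewrite -kE addrC subrK.
Qed.

Definition dot2 u w := u.1 * w.1 + u.2 * w.2.
Definition det2 u w := u.1 * w.2 - u.2 * w.1.
Definition len2 u := Num.sqrt (dot2 u u).

(** The branch with values in [[0, 2 pi)] on nonzero vectors. Its jump is at the positive horizontal
    axis, so a counterclockwise turn by less than [pi] crosses the jump exactly when it goes from
    [u.2 < 0] to [0 <= w.2]. *)
Definition arg u : R :=
  if 0 <= u.2 then acos (u.1 / len2 u) else 2 * pi - acos (u.1 / len2 u).

Lemma len2_gt0 u : u != 0 -> 0 < len2 u.
Proof.
move=> u0; rewrite sqrtr_gt0 /dot2 -!expr2.
have := sqr_ge0 u.1; have := sqr_ge0 u.2; rewrite lt_neqAle => h1 h2.
rewrite addr_ge0// andbT eq_sym paddr_eq0// !sqrf_eq0.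
by apply: contra u0 => /andP[/eqP a /eqP b]; case: u a b {h1 h2} => /= a b -> ->.
Qed.

Lemma sqr_len2 u : len2 u ^+ 2 = dot2 u u.
Proof. by rewrite sqr_sqrtr// /dot2 -!expr2 addr_ge0// sqr_ge0. Qed.

Lemma unit_itv x y : x ^+ 2 + y ^+ 2 = 1 -> -1 <= x <= 1.
Proof. by move=> h; apply/andP; split; nra. Qed.

Lemma cos_sin_acos x y : x ^+ 2 + y ^+ 2 = 1 -> 0 <= y ->
  [/\ cos (acos x) = x, sin (acos x) = y & 0 <= acos x <= pi].
Proof.
move=> h y0; have xI := unit_itv h; split.
- by rewrite acosK// in_itv.
- rewrite sin_acos// (_ : 1 - x ^+ 2 = y ^+ 2); last by rewrite -h; ring.
  by rewrite sqrtr_sqr ger0_norm.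
- by rewrite acos_ge0// acos_lepi.
Qed.

Lemma normalized u : u != 0 -> (u.1 / len2 u) ^+ 2 + (u.2 / len2 u) ^+ 2 = 1.
Proof.
move=> u0; have l0 := len2_gt0 u0; rewrite !expr_div_n -mulrDl sqr_len2.
by rewrite [u.1 ^+ 2]expr2 [u.2 ^+ 2]expr2 divff// -/(dot2 u u) -sqr_len2 expf_neq0// gt_eqF.
Qed.

Lemma argP u : u != 0 ->
  [/\ cos (arg u) = u.1 / len2 u, sin (arg u) = u.2 / len2 u &
      if 0 <= u.2 then 0 <= arg u <= pi else pi < arg u < 2 * pi].
Proof.
move=> u0; have l0 := len2_gt0 u0; have h := normalized u0; rewrite /arg.
case: ifPn => [y0|]; first by apply: cos_sin_acos; rewrite ?divr_ge0// ltW.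
rewrite -ltNge => y0.
have [||c s /andP[a0 a1]] := @cos_sin_acos (u.1 / len2 u) (- (u.2 / len2 u)) _ _.
- by rewrite sqrrN.
- by rewrite -mulNr divr_ge0 ?oppr_ge0 ?ltW.
have cE : cos (2 * pi - acos (u.1 / len2 u)) = u.1 / len2 u.
  by rewrite -[RHS]c -[RHS]cosN -[RHS](cosD2piz _ 1); congr cos; ring.
have sE : sin (2 * pi - acos (u.1 / len2 u)) = u.2 / len2 u.
  by rewrite -[RHS]opprK -s -sinN -[RHS](sinD2piz _ 1); congr sin; ring.
have yl : u.2 / len2 u < 0 by rewrite pmulr_llt0// invr_gt0.
split=> //; have [a0' a1'] : acos (u.1 / len2 u) != 0 /\ acos (u.1 / len2 u) != pi.
  by split; apply/eqP => e; move: s; rewrite e ?sin0 ?sinpi; lra.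
have : 0 < acos (u.1 / len2 u) by rewrite lt_neqAle eq_sym a0'.
have : acos (u.1 / len2 u) < pi by rewrite lt_neqAle a1'.
by lra.
Qed.

Definition ang2 u w := acos (dot2 u w / (len2 u * len2 w)).

(** A positive determinant makes the turn from [u] to [w] counterclockwise, by an angle in
    [(0, pi)]. Then [arg u + ang2 u w] and [arg w] have the same cosine and sine, hence differ by
    [2 pi k]; the ranges of the three angles leave [k = 0] and [k = 1], the latter exactly at a
    crossing of the jump. *)
Lemma ang2_step u w : 0 < det2 u w ->
  ang2 u w = arg w - arg u + (if (u.2 < 0) && (0 <= w.2) then 2 * pi else 0).
Proof.
move=> d0.
have u0 : u != 0 by apply/eqP => u0; move: d0; rewrite u0 /det2/= !mul0r subrr ltxx.
have w0 : w != 0 by apply/eqP => w0; move: d0; rewrite w0 /det2/= !mulr0 subrr ltxx.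
have lu := len2_gt0 u0; have lw := len2_gt0 w0.
have [cu su Iu] := argP u0; have [cw sw Iw] := argP w0.
have lu0 : len2 u != 0 by rewrite gt_eqF.
have lw0 : len2 w != 0 by rewrite gt_eqF.
have luw : len2 u * len2 w != 0 by rewrite mulf_neq0.
have [||c s /andP[a0 a1]] := @cos_sin_acos (dot2 u w / (len2 u * len2 w))
    (det2 u w / (len2 u * len2 w)) _ _.
- rewrite !expr_div_n -mulrDl exprMn !sqr_len2.
  have -> : dot2 u w ^+ 2 + det2 u w ^+ 2 = dot2 u u * dot2 w w.
    by rewrite /dot2 /det2; ring.
  by rewrite divff// -!sqr_len2 -exprMn expf_neq0.
- by rewrite divr_ge0 ?mulr_ge0 ?ltW.
rewrite -/(ang2 u w) in c s a0 a1.
have s0 : 0 < det2 u w / (len2 u * len2 w) by rewrite divr_gt0// mulr_gt0.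
have t0 : 0 < ang2 u w.
  by rewrite lt_neqAle a0 andbT eq_sym; apply/eqP => e; move: s; rewrite e sin0; lra.
have t1 : ang2 u w < pi.
  by rewrite lt_neqAle a1 andbT; apply/eqP => e; move: s; rewrite e sinpi; lra.
have duE : dot2 u u != 0 by rewrite -sqr_len2 expf_neq0.
have cE : cos (arg u + ang2 u w) = cos (arg w).
  rewrite cosD c s cu su cw; apply: (@mulfI _ (len2 u ^+ 2 * len2 w)).
    by rewrite mulf_neq0// expf_neq0.
  transitivity (u.1 * dot2 u w - u.2 * det2 u w).
    by field; rewrite ?lu0 ?lw0.
  transitivity (w.1 * len2 u ^+ 2); last by field; rewrite ?lu0 ?lw0.
  by rewrite sqr_len2 /dot2 /det2; ring.
have sE : sin (arg u + ang2 u w) = sin (arg w).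
  rewrite sinD c s cu su sw; apply: (@mulfI _ (len2 u ^+ 2 * len2 w)).
    by rewrite mulf_neq0// expf_neq0.
  transitivity (u.2 * dot2 u w + u.1 * det2 u w).
    by field; rewrite ?lu0 ?lw0.
  transitivity (w.2 * len2 u ^+ 2); last by field; rewrite ?lu0 ?lw0.
  by rewrite sqr_len2 /dot2 /det2; ring.
have [k kE] := cos_sin_eq_int cE sE.
have pi0 := pi_gt0 R.
move: kE Iu Iw t0 t1 pi0; clear;
  move: (arg u) (arg w) (ang2 u w) (pi : R) => a b c p kE Iu Iw t0 t1 p0.
have kb : (-1 < k%:~R :> R) /\ (k%:~R < 2 :> R).
  by move: Iu Iw; do 2 case: ifP => _; move=> Iu Iw; split; nra.
have {kb} [k0|k1] : k = 0 \/ k = 1.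
  have [kb0 kb1] := kb; have {}kb0 : -1 < k by rewrite -(ltr_int R).
  have {}kb1 : k < 2 by rewrite -(ltr_int R).
  by clear -kb0 kb1; lia.
- case: ifPn => [/andP[h1 h2]|_]; last by move: kE; rewrite k0; lra.
  by move: kE Iu Iw; rewrite k0 (leNgt 0 u.2) h1 h2/=; lra.
- case: ifPn => [_|]; first by move: kE; rewrite k1; lra.
  rewrite negb_and -leNgt -ltNge => /orP[h|h].
    by move: kE Iu Iw; rewrite k1 h; case: ifP => _; lra.
  by move: kE Iu Iw; rewrite k1 (leNgt 0 w.2) h/=; case: ifP => _; lra.
Qed.

(** The differences of [arg] cancel around the cycle and each crossing of the jump contributes
    [2 pi]. The count is the winding number, and its being 1 excludes larger multiples of [2 pi]. *)
Lemma sum_ang2_cycle (s : seq (R * R)) :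
  all (fun p => 0 < det2 p.1 p.2) (zip s (rot 1 s)) ->
  count (fun p => (p.1.2 < 0) && (0 <= p.2.2)) (zip s (rot 1 s)) = 1%N ->
  \sum_(p <- zip s (rot 1 s)) ang2 p.1 p.2 = 2 * pi.
Proof.
move=> /allP dpos cnt.
have -> : \sum_(p <- zip s (rot 1 s)) ang2 p.1 p.2 =
    \sum_(p <- zip s (rot 1 s)) (arg p.2 - arg p.1 +
      (if (p.1.2 < 0) && (0 <= p.2.2) then 2 * pi else 0)).
  by apply: eq_big_seq => p /dpos /ang2_step.
rewrite big_split/= sumrB.
have -> : \sum_(p <- zip s (rot 1 s)) arg p.1 = \sum_(u <- s) arg u.
  by rewrite -[in RHS](@unzip1_zip _ _ s (rot 1 s)) ?size_rot// big_map.
have -> : \sum_(p <- zip s (rot 1 s)) arg p.2 = \sum_(u <- s) arg u.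
  transitivity (\sum_(u <- rot 1 s) arg u).
    by rewrite -[in RHS](@unzip2_zip _ _ s (rot 1 s)) ?size_rot// big_map.
  by apply: perm_big; rewrite perm_rot.
by rewrite subrr add0r -big_mkcond big_const_seq cnt /= addr0.
Qed.

End Trig.

(** * Simplified Newton iteration *)

(** The fixed point theorem used below asks for completeness and a norm on the same type; this joins
    the two structures on matrices. *)
HB.instance Definition _ (R : realType) m n := Complete.on 'M[R]_(m, n).

Section Newton.
Variable R : realType.

Lemma mx_norm_le m n (v : 'M[R]_(m, n)) (c : R) : 0 <= c ->
  (forall i j, `|v i j| <= c) -> `|v| <= c.
Proof.
move=> c0 vc; rewrite [leLHS]/Num.norm/= mx_normrE.
by apply/bigmax_leP; split => //= -[i j] _; exact: vc.
Qed.

Lemma le_mx_norm m n (v : 'M[R]_(m, n)) i j : `|v i j| <= `|v|.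
Proof.
rewrite [leRHS]/Num.norm/= mx_normrE.
by apply/bigmax_geP; right; exists (i, j).
Qed.

(** For the sup norm the operator norm is bounded by the largest absolute row sum, a quantity that
    integer arithmetic can check. *)
Lemma norm_mulmx_le n m (A : 'M[R]_(m, n)) (v : 'cV[R]_n) (c : R) : 0 <= c ->
  (forall i, \sum_j `|A i j| <= c) -> `|A *m v| <= c * `|v|.
Proof.
move=> c0 Ac; apply: mx_norm_le => [|i j]; first by rewrite mulr_ge0.
rewrite mxE (le_trans (ler_norm_sum _ _ _))//.
apply: (@le_trans _ _ (\sum_j `|A i j| * `|v|)); last first.
  by rewrite -mulr_suml ler_wpM2r.
by apply: ler_sum => k _; rewrite normrM ler_wpM2l// le_mx_norm.
Qed.

(* Simplified Newton iteration: u |-> u - N F(u) maps the unit ball into itself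
   and is a contraction; N is injective because N L is close to 1. *)
Lemma newton_zero n (F : 'cV[R]_n -> 'cV[R]_n) (N L : 'M[R]_n) (k : R) :
  k < 1 -> (forall v : 'cV[R]_n, `|v - N *m (L *m v)| <= k * `|v|) ->
  (forall u v : 'cV[R]_n, `|u| <= 1 -> `|v| <= 1 ->
    `|u - v - N *m (F u - F v)| <= k * `|u - v|) ->
  `|N *m F 0| <= 1 - k ->
  exists2 u, `|u| <= 1 & F u = 0.
Proof.
move=> k1 NL NF NF0.
have [k0|k0] := ltP k 0.
  (* A negative [k] forces every norm to be 0, so the space is trivial. *)
  have vz (v : 'cV[R]_n) : v = 0.
    apply/eqP; rewrite -normr_eq0 eq_le normr_ge0 andbT.
    by have := le_trans (normr_ge0 _) (NL v); nra.
  by exists 0; rewrite ?normr0// vz.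
pose U : set 'cV[R]_n := [set u | `|u| <= 1].
pose g (u : 'cV[R]_n) := u - N *m F u.
have gE u v : g u - g v = u - v - N *m (F u - F v).
  by rewrite /g mulmxBr !opprB addrACA [RHS]addrACA [in RHS](addrC (- v)).
have gU : set_fun U U g.
  move=> u /= Uu; have U0 : `|0 : 'cV[R]_n| <= 1 by rewrite normr0.
  have -> : g u = (g u - g 0) + g 0 by rewrite subrK.
  rewrite /U/= (le_trans (ler_normD _ _))//.
  rewrite (_ : 1 = k + (1 - k)); last by ring.
  rewrite lerD//; last by rewrite /g add0r normrN.
  by rewrite gE (le_trans (NF u 0 Uu U0))// subr0 ler_piMr.
pose G : {fun U >-> U} := HB.pack g (isFun.Build _ _ _ _ _ gU).
have cG : is_contraction G.
  exists (NngNum k0); split=> // -[u v] /= [Uu Uv]; rewrite gE; exact: NF.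
have clU : closed U.
  have -> : U = (fun u => `|u|) @^-1` [set x | x <= 1] by [].
  by apply: (closed_comp _ (@closed_le _ 1)) => u _; exact: norm_continuous.
have [|u Uu uE] := @banach_fixed_point R _ U G cG clU.
  by exists 0; rewrite /U/= normr0.
exists u => //.
have NFu : N *m F u = 0.
  by move: uE; rewrite /= /g => /eqP; rewrite -subr_eq0 opprB addrC subrK => /eqP.
have NLu : N *m L \in unitmx.
  rewrite -unitmx_tr -row_free_unit -kermx_eq0; apply/rowV0P => v.
  rewrite sub_kermx => /eqP vNL; apply/eqP; rewrite -trmx_eq0 -normr_eq0.
  have := NL v^T; rewrite mulmxA -[N *m L]trmxK -trmx_mul vNL trmx0 subr0.
  by rewrite eq_le normr_ge0 andbT; have := normr_ge0 v^T; nra.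
have Nu : N \in unitmx by move: NLu; rewrite unitmx_mul => /andP[].
by rewrite -[F u]mul1mx -(mulVmx Nu) -mulmxA NFu mulmx0.
Qed.
End Newton.

(** * Gluing on closed pieces and homeomorphisms of compact sets *)

Lemma within_bigcup_continuous (X Y : topologicalType) (I : finType)
    (A : I -> set X) (h : X -> Y) :
  (forall i, closed (A i)) -> (forall i, {within A i, continuous h}) ->
  {within \bigcup_i A i, continuous h}.
Proof.
move=> cA hA.
have -> : \bigcup_i A i = \big[setU/set0]_(i <- enum I) A i.
  by rewrite -bigcup_seq; apply: eq_bigcupl; split=> i //= _; rewrite mem_enum.
suff [] : closed (\big[setU/set0]_(i <- enum I) A i) /\
  {within \big[setU/set0]_(i <- enum I) A i, continuous h} by [].
elim: (enum I) => [|i s [cs IH]].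
  by rewrite big_nil; split; [exact: closed0 | exact: continuous_subspace0].
rewrite big_cons; split; first exact: closedU.
exact: withinU_continuous.
Qed.

Lemma within_continuous_closed_preimage (X Y : topologicalType) (A : set X)
    (B : set Y) (h : X -> Y) :
  closed A -> closed B -> {within A, continuous h} -> closed (A `&` h @^-1` B).
Proof.
move=> cA cB /continuous_closedP/(_ _ cB)/closed_subspaceP[V cV VA].
rewrite (_ : A `&` _ = V `&` A); first exact: closedI.
by rewrite VA setIC.
Qed.

(** A continuous bijection from a compact set to a Hausdorff space is closed: closed parts of [A]
    are compact, and so are their images. As [homeomorphic] asks for maps between the whole types,
    the inverse takes the default value [a0] off the image. *)
Lemma homeomorphic_compact (X Y : topologicalType) (A : set X) (B : set Y)
    (h : X -> Y) :
  hausdorff_space Y -> compact A -> A !=set0 -> {within A, continuous h} ->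
  set_fun A B h -> {in A &, injective h} ->
  (forall y, B y -> exists2 x, A x & h x = y) ->
  homeomorphic A B.
Proof.
move=> hY kA [a0 Aa0] ch hAB hinj hsurj.
pose g y := xget a0 [set x | A x /\ h x = y].
have gP y : B y -> A (g y) /\ h (g y) = y.
  move=> By; rewrite /g; case: xgetP => [x -> //|none].
  by have [x Ax hx] := hsurj y By; have := none x; case.
have gh x : A x -> g (h x) = x.
  move=> Ax; have [Ag hg] := gP _ (hAB _ Ax).
  by apply: hinj; rewrite ?inE.
exists h, g; split=> //; last by move=> x Ax; split; [exact: hAB | exact: gh].
apply/continuous_closedP => W cW; apply/closed_subspaceP.
exists (h @` (A `&` W)).
  apply: compact_closed => //; apply: continuous_compact.
    by apply: continuous_subspaceW ch => x [].
  exact: compact_closedI.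
apply/seteqP; split=> y [].
  by move=> [x [Ax Wx] <-] By; split=> //; suff : W (g (h x)) by []; rewrite gh.
by move=> /= Wg By; split=> //; exists (g y); [split=> //; case: (gP _ By) | case: (gP _ By)].
Qed.

(** * Triangulated flat tori *)

Section FaceComplex.
Variables (R : realType) (n : nat) (I : finType) (vt : I -> 'I_3 -> 'I_n).

Definition face_set (i : I) : {set 'I_n} := [set vt i k | k : 'I_3]%SET.

Definition face_complex : {set {set 'I_n}} :=
  [set F : {set 'I_n} | (F != finset.set0) && [exists i, F \subset face_set i]]%SET.

Lemma face_complex_simplicial :
  (forall v, exists i, v \in face_set i) -> simplicial_complex face_complex.
Proof.
move=> cov; split; first by rewrite inE eqxx.
- move=> v; have [i vi] := cov v; rewrite inE; apply/andP; split.
    by apply/set0Pn; exists v; rewrite !inE.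
  by apply/existsP; exists i; rewrite finset.sub1set.
- move=> F G; rewrite !inE => /andP[_ /existsP[i Fi]] GF ->/=.
  by apply/existsP; exists i; exact: fintype.subset_trans Fi.
Qed.

Definition face_points (i : I) : set 'rV[R]_n :=
  [set x | [/\ forall v, 0 <= x 0 v, \sum_v x 0 v = 1
             & forall v, v \notin face_set i -> x 0 v = 0]].

Lemma realizationE : @realization R n face_complex = \bigcup_i face_points i.
Proof.
apply/seteqP; split=> x /=.
  move=> [x0 x1]; rewrite inE => /andP[_ /existsP[i /fintype.subsetP xi]].
  exists i => //; split=> // v vi; apply/eqP; apply: contraNT vi => xv.
  by apply: xi; rewrite inE.
move=> [i _ [x0 x1 xi]]; split=> //; rewrite inE; apply/andP; split.
  apply/negP => /eqP S0; suff : (1 : R) = 0 by move/eqP; rewrite oner_eq0.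
  rewrite -x1 big1// => v _; apply/eqP/negPn/negP => xv.
  have : v \in [set v | x 0 v != 0]%SET by rewrite inE.
  by rewrite S0 inE.
apply/existsP; exists i; apply/fintype.subsetP => v; rewrite inE.
by apply: contraNT => /xi ->.
Qed.

Lemma coord_cont (v : 'I_n) : continuous (fun x : 'rV[R]_n => x 0 v).
Proof. exact: coord_continuous. Qed.

Lemma sum_continuous (V : normedModType R) (T : topologicalType) (J : Type)
    (r : seq J) (f : J -> T -> V) :
  (forall j, continuous (f j)) -> continuous (fun x => \sum_(j <- r) f j x).
Proof.
move=> fc x; elim: r => [|j r IH].
  by under eq_fun do rewrite big_nil; exact: cvg_cst.
by under eq_fun do rewrite big_cons; apply: continuousD; [exact: fc | exact: IH].
Qed.

Lemma face_points_closed i : closed (face_points i).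
Proof.
have -> : face_points i = (\bigcap_v [set x : 'rV[R]_n | 0 <= x 0 v]) `&`
    ([set x | \sum_v x 0 v = 1] `&`
     \bigcap_(v in [set v | v \notin face_set i]) [set x | x 0 v = 0]).
  apply/seteqP; split=> x /=; first by move=> [x0 x1 xi]; split; [move=> v _;
    exact: x0 | split=> // v; exact: xi].
  move=> [x0 [x1 xi]]; split; [by move=> v; exact: x0 | by [] | by move=> v; exact: xi].
apply: closedI.
  apply: closed_bigI => v _.
  exact: (closed_comp (fun x _ => @coord_cont v x) (@closed_ge R 0)).
apply: closedI.
  apply: (@closed_comp _ _ (fun x : 'rV[R]_n => \sum_v x 0 v) [set 1]).
    by move=> x _; exact: sum_continuous coord_cont x.
  exact: closed_eq.
apply: closed_bigI => v _.
exact: (closed_comp (fun x _ => @coord_cont v x) (@closed_eq R 0)).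
Qed.

Lemma face_points_compact i : compact (face_points i).
Proof.
apply: bounded_closed_compact; last exact: face_points_closed.
exists 1; split=> // M M1 x [x0 x1 xi].
apply: mx_norm_le => [|a v]; first by rewrite ltW// (lt_trans ltr01).
rewrite ord1 ger0_norm//; apply/ltW/(le_lt_trans _ M1).
by rewrite -x1 (bigD1 v)//= lerDl sumr_ge0.
Qed.

Lemma realization_compact : compact (@realization R n face_complex).
Proof.
rewrite realizationE; have -> : \bigcup_i face_points i =
    \big[setU/set0]_(i <- enum I) face_points i.
  by rewrite -bigcup_seq; apply: eq_bigcupl; split=> i //= _; rewrite mem_enum.
elim: (enum I) => [|i s IH]; first by rewrite big_nil; exact: compact0.
by rewrite big_cons; apply: compactU => //; exact: face_points_compact.
Qed.

(** The values [c k] belong to the corners of the face [i] and not to vertices, because one vertex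
    has different lifts in different faces. *)
Definition bary (i : I) (c : 'I_3 -> R) (x : 'rV[R]_n) : R :=
  \sum_k x 0 (vt i k) * c k.

Lemma bary_continuous i c : continuous (bary i c).
Proof.
apply: sum_continuous => k x; apply: continuousM; first exact: coord_cont.
exact: cst_continuous.
Qed.

End FaceComplex.

Section CircleMap.
Variable R : realType.

Definition circle_map (s : R) : R * R := (cos (2 * pi * s), sin (2 * pi * s)).

Lemma circle_map_int s (k : int) : circle_map (s + k%:~R) = circle_map s.
Proof. by rewrite /circle_map mulrDr cosD2piz sinD2piz. Qed.

Lemma circle_map_inj s t : circle_map s = circle_map t -> exists k : int, s = t + k%:~R.
Proof.
move=> [cE sE]; have [k kE] := cos_sin_eq_int cE sE; exists k.
have pi0 := pi_gt0 R; apply: (@mulfI _ (2 * pi)); first by rewrite gt_eqF// mulr_gt0.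
by rewrite (mulrDr (2 * pi)); exact: kE.
Qed.

Lemma circle_mapP s : circle (circle_map s).
Proof. by rewrite /circle/= cos2Dsin2. Qed.

Lemma circle_map_surj u : circle u -> exists s, circle_map s = u.
Proof.
case: u => x y; rewrite /circle/= => xy.
have u0 : (x, y) != 0.
  apply/eqP => -[x0 y0]; move: xy; rewrite x0 y0 expr0n/= addr0 => /eqP.
  by rewrite eq_sym oner_eq0.
have l1 : len2 (x, y) = 1 by rewrite /len2 /dot2/= -!expr2 xy sqrtr1.
have pi0 := pi_gt0 R; have [cE sE _] := argP u0.
exists (arg (x, y) / (2 * pi)); rewrite /circle_map mulrC divfK ?gt_eqF ?mulr_gt0//.
by rewrite cE sE l1 !divr1.
Qed.

Lemma circle_map_continuous : continuous circle_map.
Proof.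
have mc : continuous (fun s : R => 2 * pi * s) by exact: mulrl_continuous.
move=> s; apply: (@cvg_pair R R R (nbhs s) (nbhs (cos (2 * pi * s)))
  (nbhs (sin (2 * pi * s))) _ _ _ (fun s => cos (2 * pi * s)) (fun s => sin (2 * pi * s))).
  by exact: (cvg_comp _ _ (mc s) (@continuous_cos R _)).
by exact: (cvg_comp _ _ (mc s) (@continuous_sin R _)).
Qed.

End CircleMap.

Section FlatTriangulation.
Variables (R : realType) (n : nat) (I : finType) (vt : I -> 'I_3 -> 'I_n).
Variables (W1 W2 : I -> 'I_3 -> R).

Let fp (i : I) := @face_points R n I vt i.
Let F1 i := bary vt i (W1 i).
Let F2 i := bary vt i (W2 i).

Let hf i x := (circle_map (F1 i x), circle_map (F2 i x)).

Let hf_continuous i : continuous (hf i).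
Proof.
move=> x; apply: (@cvg_pair _ _ _ (nbhs x) (nbhs (circle_map (F1 i x))) (
  nbhs (circle_map (F2 i x))) _ _ _
  (fun x => circle_map (F1 i x)) (fun x => circle_map (F2 i x))).
  by exact: (cvg_comp _ _ (@bary_continuous _ _ _ vt i (W1 i) x) (@circle_map_continuous R _)).
by exact: (cvg_comp _ _ (@bary_continuous _ _ _ vt i (W2 i) x) (@circle_map_continuous R _)).
Qed.

Definition covered (s t : R) : Prop := exists i x (a b : int),
  [/\ fp i x, F1 i x = s + a%:~R & F2 i x = t + b%:~R].

(** There are infinitely many translated faces, but modulo [Z^2] they become finitely many compact
    sets in a product of two circles; the covered set is the preimage of their union. *)
Lemma covered_closed : closed [set p : R * R | covered p.1 p.2].
Proof.
have hf_closed i : closed (hf i @` fp i).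
  apply: compact_closed; first exact: norm_hausdorff.
  apply: continuous_compact; last exact: face_points_compact.
  exact: continuous_subspaceT.
have -> : [set p : R * R | covered p.1 p.2] =
    (fun p => (circle_map p.1, circle_map p.2)) @^-1` \bigcup_(i in [set: I]) (hf i @` fp i).
  apply/seteqP; split=> -[s t] /=.
    move=> [i [x [a [b [fx xa xb]]]]]; exists i => //; exists x => //.
    by rewrite /hf xa xb !circle_map_int.
  move=> [i _ [x fx [c1 s1 c2 s2]]].
  have [a aE] : exists k : int, F1 i x = s + k%:~R.
    by apply: circle_map_inj; rewrite /circle_map c1 s1.
  have [b bE] : exists k : int, F2 i x = t + k%:~R.
    by apply: circle_map_inj; rewrite /circle_map c2 s2.
  by exists i, x, a, b.
apply: closed_comp; last by apply: closed_bigcup => [|i _];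
  [exact: finite_finset | exact: hf_closed].
move=> [s t] _; apply: (@cvg_pair _ _ _ (nbhs (s, t)) (nbhs (circle_map s)) (nbhs (circle_map t))
  _ _ _ (fun p => circle_map p.1) (fun p => circle_map p.2)).
  apply: (@cvg_comp _ _ _ (fun p : R * R => p.1) (@circle_map R) _ (nbhs s)).
    exact: cvg_fst.
  exact: circle_map_continuous.
apply: (@cvg_comp _ _ _ (fun p : R * R => p.2) (@circle_map R) _ (nbhs t)).
  exact: cvg_snd.
exact: circle_map_continuous.
Qed.

(* Continuity method along the segment from a covered point to (s, t). *)
Lemma covered_all : (exists s t, covered s t) ->
  (forall i x u1 u2 d, fp i x -> 0 < d -> exists2 r, 0 < r <= d &
    covered (F1 i x + r * u1) (F2 i x + r * u2)) ->
  forall s t, covered s t.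
Proof.
move=> [s0 [t0 cov0]] ext s t.
pose A := [set r : R | covered (s0 + r * (s - s0)) (t0 + r * (t - t0))].
have cA : closed A.
  have lin_cont (a d : R) : continuous (fun r : R => a + r * d).
    by move=> r; apply: cvgD; [exact: cvg_cst | exact: mulrr_continuous].
  apply: (@closed_comp _ _ (fun r : R => (s0 + r * (s - s0), t0 + r * (t - t0)))
    [set p : R * R | covered p.1 p.2]); last exact: covered_closed.
  move=> r _; apply: (@cvg_pair R R R (nbhs r) (nbhs _) (nbhs _) _ _ _
    (fun r => s0 + r * (s - s0)) (fun r => t0 + r * (t - t0))); exact: lin_cont.
have A0 : A 0 by rewrite /A/= !mul0r !addr0.
have [] := sup_itvcc_closed cA A0 (@ler01 R).
set m := sup _ => Am m0 m1 mmax.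
have [m_lt|m_ge] := ltP m 1; last first.
  move: Am; rewrite (_ : m = 1); last by apply/eqP; rewrite eq_le m1 m_ge.
  by rewrite /A/= !mul1r !(addrC s0, addrC t0) !subrK.
have [i [x [a [b [fx xa xb]]]]] := Am.
have [r /andP[r0 r1]] := ext i x (s - s0) (t - t0) (1 - m) fx (etrans (subr_gt0 _ _) m_lt).
move=> [j [y [a' [b' [fy ya yb]]]]]; case: (mmax (m + r)).
- exists j, y, (a + a'), (b + b'); split=> //.
    by rewrite ya xa intrD; ring.
  by rewrite yb xb intrD; ring.
- by rewrite ltrDl.
- by lra.
Qed.

(* The faces with the lifts (W1, W2) of their vertices triangulate R^2 / Z^2. *)
Definition flat_triangulation : Prop :=
  [/\ forall i j x, fp i x -> fp j x ->
        exists a b : int, F1 i x = F1 j x + a%:~R /\ F2 i x = F2 j x + b%:~R,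
      forall i j x y (a b : int), fp i x -> fp j y ->
        F1 i x = F1 j y + a%:~R -> F2 i x = F2 j y + b%:~R -> x = y
    & forall s t, exists i x (a b : int),
        [/\ fp i x, F1 i x = s + a%:~R & F2 i x = t + b%:~R]].

Hypothesis flatT : flat_triangulation.

(** This glues the maps [hf i]. On a common point of two faces the lifts differ by integers, which
    [circle_map] forgets, so the choice of the face does not matter. *)
Let h x := xget (0 : (R * R) * (R * R)) [set y | exists2 i, fp i x & y = hf i x].

Let hE i x : fp i x -> h x = hf i x.
Proof.
move=> fix_; rewrite /h; case: xgetP => [y _ [j fjx ->]|none].
  have [lift _ _] := flatT; have [a [b [aE bE]]] := lift i j x fix_ fjx.
  by rewrite /hf aE bE !circle_map_int.
by have := none (hf i x); case; exists i.
Qed.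

Lemma torus_homeomorphic :
  homeomorphic (@realization R n (face_complex vt)) (@circle R `*` @circle R).
Proof.
have [lift inj surj] := flatT.
apply: (@homeomorphic_compact _ _ _ _ h).
- exact: norm_hausdorff.
- exact: realization_compact.
- have [i [x [_ [_ [fx _ _]]]]] := surj 0 0.
  by exists x; rewrite realizationE; exists i.
- rewrite realizationE; apply: within_bigcup_continuous => i.
    exact: face_points_closed.
  apply: (@subspace_eq_continuous _ _ _ (hf i)).
    by move=> x; rewrite inE => /hE.
  by apply: continuous_subspaceT; exact: hf_continuous.
- move=> x; rewrite realizationE => -[i _ fx].
  by rewrite (hE fx); split; exact: circle_mapP.
- move=> x y; rewrite !inE realizationE => -[i _ fx] [j _ fy].
  rewrite (hE fx) (hE fy) => -[/= c1 s1 c2 s2].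
  have [a aE] : exists k : int, F1 i x = F1 j y + k%:~R.
    by apply: circle_map_inj; rewrite /circle_map c1 s1.
  have [b bE] : exists k : int, F2 i x = F2 j y + k%:~R.
    by apply: circle_map_inj; rewrite /circle_map c2 s2.
  exact: (inj i j x y a b).
- move=> [u v] [/= /circle_map_surj[s <-] /circle_map_surj[t <-]].
  have [i [x [a [b [fx xa xb]]]]] := surj s t.
  exists x; first by rewrite realizationE; exists i.
  by rewrite (hE fx) /hf xa xb !circle_map_int.
Qed.
End FlatTriangulation.

(** * The Euclidean norm *)

Section Norm2.
Variables (R : realType) (k : nat).
Implicit Types u v : 'rV[R]_k.

Lemma dotvE u v : dotv u v = \sum_i u 0 i * v 0 i.
Proof. by rewrite /dotv mxE; apply: eq_bigr => i _; rewrite mxE. Qed.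

Lemma dotv_ge0 u : 0 <= dotv u u.
Proof. by rewrite dotvE sumr_ge0// => i _; rewrite -expr2 sqr_ge0. Qed.

Lemma dotvC u v : dotv u v = dotv v u.
Proof. by rewrite !dotvE; apply: eq_bigr => i _; rewrite mulrC. Qed.

Lemma dotvDl u v w : dotv (u + v) w = dotv u w + dotv v w.
Proof. by rewrite /dotv mulmxDl mxE. Qed.

Lemma dotvZl a u v : dotv (a *: u) v = a * dotv u v.
Proof. by rewrite /dotv -scalemxAl mxE. Qed.

Lemma dotvDr u v w : dotv u (v + w) = dotv u v + dotv u w.
Proof. by rewrite ![dotv u _]dotvC dotvDl. Qed.

Lemma dotvZr a u v : dotv u (a *: v) = a * dotv u v.
Proof. by rewrite dotvC dotvZl dotvC. Qed.

Lemma sqr_norm2 u : norm2 u ^+ 2 = dotv u u.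
Proof. by rewrite sqr_sqrtr// dotv_ge0. Qed.

Lemma norm2_ge0 u : 0 <= norm2 u. Proof. exact: sqrtr_ge0. Qed.

Lemma dotv_cauchy u v : dotv u v ^+ 2 <= dotv u u * dotv v v.
Proof.
have H a : 0 <= dotv u u + 2 * a * dotv u v + a ^+ 2 * dotv v v.
  have := dotv_ge0 (u + a *: v).
  by rewrite !(dotvDl, dotvDr, dotvZl, dotvZr) [dotv v u]dotvC; lra.
have v0 := dotv_ge0 v.
have [vz|vn] := eqVneq (dotv v v) 0.
  have [->|uv0] := eqVneq (dotv u v) 0; first by rewrite expr0n/= mulr_ge0// dotv_ge0.
  (* With [dotv v v = 0] the expression in [H] is affine in [a]; this value of [a] makes it equal to
     -1. *)
  have := H (- (dotv u u + 1) / (2 * dotv u v)).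
  rewrite vz mulr0 addr0 (_ : 2 * _ * _ = - (dotv u u + 1)); last by field.
  by lra.
have vp : 0 < dotv v v by rewrite lt_neqAle eq_sym vn.
have := H (- dotv u v / dotv v v).
have -> : dotv u u + 2 * (- dotv u v / dotv v v) * dotv u v +
    (- dotv u v / dotv v v) ^+ 2 * dotv v v =
    (dotv u u * dotv v v - dotv u v ^+ 2) / dotv v v by field.
by rewrite pmulr_lge0 ?invr_gt0// subr_ge0.
Qed.

Lemma norm2D u v : norm2 (u + v) <= norm2 u + norm2 v.
Proof.
rewrite -(ler_pXn2r (n := 2)) ?nnegrE ?addr_ge0 ?norm2_ge0//.
rewrite sqrrD !sqr_norm2 !(dotvDl, dotvDr) [dotv v u]dotvC.
suff : dotv u v <= norm2 u * norm2 v by lra.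
rewrite (le_trans (ler_norm _))//.
rewrite -(ler_pXn2r (n := 2)) ?nnegrE ?mulr_ge0 ?norm2_ge0//.
by rewrite real_normK ?num_real// exprMn !sqr_norm2 dotv_cauchy.
Qed.

Lemma norm2N u : norm2 (- u) = norm2 u.
Proof. by rewrite /norm2 /dotv linearN/= mulmxN mulNmx opprK. Qed.

Lemma coord_norm2 u i : `|u 0 i| <= norm2 u.
Proof.
rewrite -(ler_pXn2r (n := 2)) ?nnegrE ?norm2_ge0// sqr_norm2 dotvE.
rewrite real_normK ?num_real// (bigD1 i)//= -expr2 lerDl.
by rewrite sumr_ge0// => j _; rewrite -expr2 sqr_ge0.
Qed.

Lemma norm_le_norm2 u : `|u| <= norm2 u.
Proof. by apply: mx_norm_le => [|i j]; rewrite ?norm2_ge0// ord1 coord_norm2. Qed.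

Lemma norm2_lipschitz_continuous (c : R -> 'rV[R]_k) (M : R) :
  (forall t t', t <= t' -> norm2 (c t' - c t) <= M * (t' - t)) -> continuous c.
Proof.
move=> cM t; have M0 : 0 <= M.
  by have := le_trans (norm2_ge0 _) (cM 0 1 ler01); rewrite subr0 mulr1.
(* The constant [M] may be 0, so the divisor for the choice of the neighbourhood is [M + 1]. *)
have M1 : 0 < M + 1 by rewrite ltr_wpDl.
apply/cvgrPdist_le => e e0; near=> t'.
have dt : `|t - t'| <= e / (M + 1).
  near: t'; exists (e / (M + 1)) => /=; first by rewrite divr_gt0.
  by move=> y /= /ltW.
have : norm2 (c t - c t') <= M * `|t - t'|.
  have [tt|tt] := leP t' t; first by rewrite ger0_norm ?subr_ge0// cM.
  by rewrite -norm2N opprB distrC ger0_norm ?subr_ge0 ?cM// ltW.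
move=> /(le_trans (norm_le_norm2 _))/le_trans; apply.
apply: le_trans (_ : (M + 1) * `|t - t'| <= _); first by rewrite ler_wpM2r// lerDl.
by rewrite mulrC -ler_pdivlMr.
Unshelve. all: by end_near. Qed.

End Norm2.

(** * The intrinsic metric *)

Section Isometry.
Variables (R : realType) (n : nat) (I : finType) (vt : I -> 'I_3 -> 'I_n).
Variables (W1 W2 : I -> 'I_3 -> R) (q : 'I_n -> 'rV[R]_3) (v1 v2 : R[i]).
Variables (c1 c2 : R[i] -> R).

Let fp (i : I) := @face_points R n I vt i.
Let F1 i := bary vt i (W1 i).
Let F2 i := bary vt i (W2 i).
Let T := face_complex vt.
Let Z (a b : R) : R[i] := a%:C * v1 + b%:C * v2.

Hypothesis flatT : flat_triangulation vt W1 W2.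
Hypothesis Zc : forall z, Z (c1 z) (c2 z) = z.
Hypothesis plI : {in @realization R n T &, injective (pl_map q)}.
Hypothesis iso : forall i x y, fp i x -> fp i y ->
  norm2 (pl_map q x - pl_map q y) = Normc.normc (Z (F1 i x - F1 i y) (F2 i x - F2 i y)).

Let ZD a b a' b' : Z (a + a') (b + b') = Z a b + Z a' b'.
Proof. by rewrite /Z !rmorphD/= !mulrDl addrACA. Qed.

Let ZN a b : Z (- a) (- b) = - Z a b.
Proof. by rewrite /Z !rmorphN/= !mulNr opprD. Qed.

Let normcZ t a b : 0 <= t -> Normc.normc (Z (t * a) (t * b)) = t * Normc.normc (Z a b).
Proof.
move=> t0; have -> : Z (t * a) (t * b) = t%:C * Z a b.
  by rewrite /Z !rmorphM/= mulrDr !mulrA.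
by rewrite Normc.normcM /= expr0n addr0 sqrtr_sqr ger0_norm.
Qed.

Let fp_real i x : fp i x -> @realization R n T x.
Proof. by move=> fx; rewrite realizationE; exists i. Qed.

Let fp_inj i j x y : fp i x -> fp j y -> pl_map q x = pl_map q y -> x = y.
Proof. by move=> /fp_real xr /fp_real yr; apply: plI; rewrite inE. Qed.

(** The universal covering of the surface in lattice coordinates: [pt a b] is the point whose lift
    is [(a, b)] up to integers. It exists since the translated faces cover the plane, and is unique
    since they do not overlap. *)
Let pt a b : 'rV[R]_n := xget 0 [set x | exists i (m k : int),
  [/\ fp i x, F1 i x = a + m%:~R & F2 i x = b + k%:~R]].

Let ptP a b : exists i (m k : int),
  [/\ fp i (pt a b), F1 i (pt a b) = a + m%:~R & F2 i (pt a b) = b + k%:~R].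
Proof.
have [_ _ surj] := flatT; rewrite /pt; case: xgetP => [x -> //|none].
have [i [x [m [k xmk]]]] := surj a b.
by have := none x; case; exists i, m, k.
Qed.

Let ptE a b i x (m k : int) : fp i x -> F1 i x = a + m%:~R -> F2 i x = b + k%:~R ->
  pt a b = x.
Proof.
move=> fx xm xk; have [j [m' [k' [fy ym yk]]]] := ptP a b.
have [_ inj _] := flatT; apply: (inj j i _ _ (m' - m) (k' - k)) => //.
  by rewrite -/(F1 _ _) -/(F1 _ _) ym xm intrB; ring.
by rewrite -/(F2 _ _) -/(F2 _ _) yk xk intrB; ring.
Qed.

Let bary_le i c x : fp i x -> `|bary vt i c x| <= \sum_k `|c k|.
Proof.
move=> [x0 x1 xi]; rewrite (le_trans (ler_norm_sum _ _ _))// ler_sum// => k _.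
rewrite normrM ler_piMl// ger0_norm// -x1 (bigD1 (vt i k))//= lerDl.
by rewrite sumr_ge0.
Qed.

(** While the segment stays in one translate of one face, the map to space is an isometry. The times
    spent in a given translate form a closed set, and finitely many translates meet the segment, so
    [closed_chain] adds up the estimates by the triangle inequality. *)
Let segment_lipschitz a0 b0 da db t0 t1 : t0 <= t1 ->
  norm2 (pl_map q (pt (a0 + t1 * da) (b0 + t1 * db)) -
         pl_map q (pt (a0 + t0 * da) (b0 + t0 * db))) <=
  Normc.normc (Z da db) * (t1 - t0).
Proof.
move=> t01; pose c t := pl_map q (pt (a0 + t * da) (b0 + t * db)).
rewrite -/(c t0) -/(c t1).
pose B := \sum_i \sum_k (`|W1 i k| + `|W2 i k|).
(* [B] bounds the lifts of all faces and the other term the segment, so each translation that occurs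
   has entries between [-K] and [K]. The ordinals below encode these integers, shifted by [K]. *)
pose K := Num.bound (B + (`|a0| + `|b0| + (`|t0| + `|t1|) * (`|da| + `|db|))).
pose A (j : I * ('I_(K + K).+1 * 'I_(K + K).+1)) : set R :=
  [set t | exists x, [/\ fp j.1 x, F1 j.1 x = a0 + t * da + (j.2.1%:R - K%:R)
                       & F2 j.1 x = b0 + t * db + (j.2.2%:R - K%:R)]].
apply: (@closed_chain R _ A (fun s t => norm2 (c t - c s) <= Normc.normc (Z da db) * (t - s))) =>
  //.
- move=> [i [m k]].
  pose C : set (R * R) := (fun x => (F1 i x, F2 i x)) @` fp i.
  have cC : closed C.
    apply: compact_closed; first exact: norm_hausdorff.
    apply: continuous_compact; last exact: face_points_compact.
    apply: continuous_subspaceT => x.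
    apply: (@cvg_pair _ _ _ (nbhs x) (nbhs (F1 i x)) (nbhs (F2 i x)) _ _ _ (F1 i) (F2 i)).
      exact: bary_continuous.
    exact: bary_continuous.
  pose g (t : R) := (a0 + t * da + (m%:R - K%:R), b0 + t * db + (k%:R - K%:R)).
  have lin_cont (a d e : R) : continuous (fun t : R => a + t * d + e).
    move=> t; apply: cvgD; last exact: cvg_cst.
    by apply: cvgD; [exact: cvg_cst | exact: mulrr_continuous].
  have -> : A (i, (m, k)) = g @^-1` C.
    apply/seteqP; split=> t /= [x]; first by move=> [fx x1 x2]; exists x; rewrite // x1 x2.
    by move=> fx [x1 x2]; exists x.
  apply: closed_comp => // t _.
  by apply: (@cvg_pair R R R (nbhs t) (nbhs _) (nbhs _) _ _ _
    (fun t => a0 + t * da + (m%:R - K%:R)) (fun t => b0 + t * db + (k%:R - K%:R)));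
    exact: lin_cont.
- move=> t t0t tt1; have [i [m [k [fx xm xk]]]] := ptP (a0 + t * da) (b0 + t * db).
  have tT : `|t| <= `|t0| + `|t1|.
    by rewrite ler_norml; have := ler_norm t1; have := ler_norm (- t0);
       rewrite normrN; have := normr_ge0 t0; have := normr_ge0 t1; lra.
  have abs_ge0 : 0 <= `|a0| + `|b0| + (`|t0| + `|t1|) * (`|da| + `|db|).
    by rewrite addr_ge0 ?mulr_ge0 ?addr_ge0.
  have BK : B + (`|a0| + `|b0| + (`|t0| + `|t1|) * (`|da| + `|db|)) < K%:R.
    apply: archi_boundP; rewrite addr_ge0// sumr_ge0// => j _.
    by rewrite sumr_ge0// => l _; rewrite addr_ge0.
  have Bi : \sum_l `|W1 i l| + \sum_l `|W2 i l| <= B.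
    rewrite -big_split/= /B [leRHS](bigD1 i)//= lerDl sumr_ge0// => j _.
    by rewrite sumr_ge0// => l _; rewrite addr_ge0.
  have ordK (l : int) : `|l%:~R| <= K%:R :> R ->
      exists o : 'I_(K + K).+1, l%:~R = o%:R - K%:R :> R.
    rewrite -intr_norm -[K%:R]/((Posz K)%:~R) ler_int => lK.
    have oK : (`|(l + K%:Z)%R| < (K + K).+1)%N by lia.
    exists (Ordinal oK) => /=; rewrite natr_absz ger0_norm; last by lia.
    by rewrite intrD addrK.
  have tda e : `|t * e| <= (`|t0| + `|t1|) * `|e| by rewrite normrM ler_wpM2r.
  have [w1 wE1] : exists o : 'I_(K + K).+1, m%:~R = o%:R - K%:R :> R.
    apply: ordK; have -> : m%:~R = F1 i (pt (a0 + t * da) (b0 + t * db)) - (a0 + t * da).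
      by rewrite xm addrAC subrr add0r.
    have := bary_le (W1 i) fx; rewrite -/(F1 i _) => h1.
    have := tda da; have := tda db; have := normr_ge0 (t * db) => h2 h3 h4.
    have h5 : 0 <= \sum_l `|W2 i l| by rewrite sumr_ge0.
    have := normr_ge0 b0 => h6; apply: le_trans (ltW BK).
    rewrite (le_trans (ler_normB _ _))// (le_trans (lerD h1 (ler_normD _ _)))//.
    by lra.
  have [w2 wE2] : exists o : 'I_(K + K).+1, k%:~R = o%:R - K%:R :> R.
    apply: ordK; have -> : k%:~R = F2 i (pt (a0 + t * da) (b0 + t * db)) - (b0 + t * db).
      by rewrite xk addrAC subrr add0r.
    have := bary_le (W2 i) fx; rewrite -/(F2 i _) => h1.
    have := tda da; have := tda db; have := normr_ge0 (t * da) => h2 h3 h4.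
    have h5 : 0 <= \sum_l `|W1 i l| by rewrite sumr_ge0.
    have := normr_ge0 a0 => h6; apply: le_trans (ltW BK).
    rewrite (le_trans (ler_normB _ _))// (le_trans (lerD h1 (ler_normD _ _)))//.
    by lra.
  by exists (i, (w1, w2)), (pt (a0 + t * da) (b0 + t * db)) => /=; rewrite -wE1 -wE2.
- move=> [i [m k]] s t _ st _ /= [x [fx x1 x2]] [y [fy y1 y2]].
  have toint (o : nat) : o%:R - K%:R = (o%:Z - K%:Z)%:~R :> R by rewrite intrB.
  have ptx : pt (a0 + s * da) (b0 + s * db) = x.
    by apply: (ptE fx (m := m%:Z - K%:Z) (k := k%:Z - K%:Z)); rewrite -toint.
  have pty : pt (a0 + t * da) (b0 + t * db) = y.
    by apply: (ptE fy (m := m%:Z - K%:Z) (k := k%:Z - K%:Z)); rewrite -toint.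
  rewrite /c ptx pty.
  rewrite (iso fy fx) x1 x2 y1 y2 [leRHS]mulrC -normcZ ?subr_ge0//.
  rewrite le_eqVlt; apply/orP; left; apply/eqP; congr (Normc.normc (Z _ _)); ring.
- move=> s t u _ st tu _ h1 h2.
  have -> : c u - c s = (c u - c t) + (c t - c s) by rewrite addrA subrK.
  rewrite (le_trans (norm2D _ _))// (_ : u - s = (u - t) + (t - s)); last by ring.
  by rewrite mulrDr lerD.
Qed.

Hypothesis cZ : forall a b, c1 (Z a b) = a /\ c2 (Z a b) = b.

Let p (z : R[i]) := pl_map q (pt (c1 z) (c2 z)).

Let latticeP l : lattice v1 v2 l <-> exists m k : int, l = Z m%:~R k%:~R.
Proof.
have E (m k : int) : v1 *~ m + v2 *~ k = Z m%:~R k%:~R.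
  by rewrite /Z !rmorph_int !mulrzl.
by split=> -[m [k ->]]; exists m, k; rewrite E.
Qed.

Let range_p : range p = pl_image T q.
Proof.
apply/seteqP; split=> u [z].
  move=> _ <-; exists (pt (c1 z) (c2 z)) => //.
  by have [i [m [k [fx _ _]]]] := ptP (c1 z) (c2 z); exact: fp_real fx.
rewrite realizationE => -[i _ fz] <-; exists (Z (F1 i z) (F2 i z)) => //.
have [z1 z2] := cZ (F1 i z) (F2 i z); rewrite /p z1 z2.
by rewrite (ptE fz (m := 0) (k := 0)) ?addr0.
Qed.

(** The sum in [curve_length] in recursive form, with a free starting time, so that subdivisions can
    be concatenated. *)
Fixpoint polygon_length (c : R -> 'rV[R]_3) (t : R) (s : seq R) : R :=
  if s is t' :: s' then norm2 (c t' - c t) + polygon_length c t' s' else 0.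

Lemma polygon_lengthE c t s :
  \sum_(0 <= j < size s) norm2 (c (nth 0 (t :: s) j.+1) - c (nth 0 (t :: s) j)) =
  polygon_length c t s.
Proof.
elim: s t => [|t' s IH] t; first by rewrite big_geq.
by rewrite big_nat_recl//= IH.
Qed.

Lemma polygon_length_cat c t s1 s2 : polygon_length c t (s1 ++ s2) =
  polygon_length c t s1 + polygon_length c (last t s1) s2.
Proof. by elim: s1 t => [|t' s1 IH] t /=; rewrite ?add0r// IH addrA. Qed.

(** The straight segment from [z] to the translate [w + l] maps to a curve on the surface that is
    Lipschitz with constant [|z - w - l|], hence no longer than that. *)
Let intrinsic_le z w l : lattice v1 v2 l ->
  (intrinsic_dist (pl_image T q) (p z) (p w) <= (Normc.normc (z - w - l))%:E)%E.
Proof.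
move=> /latticeP[m [k lE]].
pose da := c1 w + m%:~R - c1 z; pose db := c2 w + k%:~R - c2 z.
pose c t := pl_map q (pt (c1 z + t * da) (c2 z + t * db)).
have -> : Normc.normc (z - w - l) = Normc.normc (Z da db).
  rewrite /da /db ZD ZN ZD !Zc -lE -[LHS]normcN; congr Normc.normc.
  by rewrite !opprB addrCA addrA.
set M := Normc.normc _.
have cM t t' : t <= t' -> norm2 (c t' - c t) <= M * (t' - t).
  exact: segment_lipschitz.
apply: (@le_trans _ _ (curve_length c)).
  apply: ereal_inf_lbound; exists c => //; split.
  - by apply: continuous_subspaceT; exact: norm2_lipschitz_continuous cM.
  - by rewrite /c !mul0r !addr0.
  - rewrite /c !mul1r /p; congr pl_map.
    have [i [m' [k' [fx xm xk]]]] := ptP (c1 w) (c2 w).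
    by apply: (ptE fx (m := m' - m) (k := k' - k)); rewrite ?xm ?xk /da /db intrB; ring.
  - move=> t _; exists (pt (c1 z + t * da) (c2 z + t * db)) => //.
    by have [i [_ [_ [fx _ _]]]] := ptP (c1 z + t * da) (c2 z + t * db); exact: fp_real fx.
apply: ub_ereal_sup => _ [s [/= ps /eqP ls] <-]; rewrite lee_fin polygon_lengthE.
(* Written with both ends of the subdivision, the bound can be carried through an induction that
   changes the starting time. *)
have -> : M = M * (last 0 s - 0) by rewrite ls subr0 mulr1.
elim: s (0 : R) ps {ls} => [|t' s IH] t /=; first by rewrite subrr mulr0.
move=> /andP[tt' /IH h]; rewrite (_ : _ - t = (t' - t) + (last t' s - t')); last by ring.
by rewrite mulrDr lerD// cM// ltW.
Qed.

Let normc_le a b a' b' : Normc.normc (Z (a + a') (b + b')) <=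
  Normc.normc (Z a b) + Normc.normc (Z a' b').
Proof. by rewrite ZD; exact: le_normcD. Qed.

(** Developing [c] in the plane gives a path from [z] to a translate of [w]. Only finitely many of
    its points are used: each jump of [closed_chain] joins two points of one face, whose distances
    in space and in the plane agree. The jumps form a polygon inscribed in [c], so its length is
    below the supremum that defines [curve_length]. *)
Let length_ge z w c : curve_in (pl_image T q) (p z) (p w) c ->
  exists2 l, lattice v1 v2 l & ((Normc.normc (z - w - l))%:E <= curve_length c)%E.
Proof.
move=> [cc c0 c1E cX].
pose A i : set R := `[0, 1]%classic `&` c @^-1` (pl_map q @` fp i).
have pl_cont : continuous (pl_map q).
  apply: sum_continuous => v x.
  exact: (cvgZ (@coord_cont R n v x) (cvg_cst (q v))).
(* Quantifying over all faces that contain the two ends lets two such estimates be composed,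
   whichever face is chosen for the point in the middle; the integer translations add up. *)
pose P s t := forall i x j y, fp i x -> fp j y -> pl_map q x = c s -> pl_map q y = c t ->
  exists (m k : int) r, [/\ path <%R s r, last s r = t &
    Normc.normc (Z (F1 i x - F1 j y - m%:~R) (F2 i x - F2 j y - k%:~R)) <=
    polygon_length c s r].
have P01 : P 0 1.
  apply: (@closed_chain R _ A P 0 1) => //.
  - move=> i; apply: within_continuous_closed_preimage => //.
      exact: itv_closed.
    apply: compact_closed; first exact: norm_hausdorff.
    apply: continuous_compact; last exact: face_points_compact.
    exact: continuous_subspaceT.
  - move=> t t0 t1; have [|x] := cX t; first by rewrite t0.
    by rewrite realizationE => -[i _ fx] xE; exists i; split; [rewrite /= in_itv/= t0 | exists x].
  - move=> i s t s0 st t1 [_ [x' fx' x'E]] [_ [y' fy' y'E]] j x k y fx fy xE yE.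
    have xx : x' = x by apply: fp_inj fx' fx _; rewrite xE.
    have yy : y' = y by apply: fp_inj fy' fy _; rewrite yE.
    have [lift _ _] := flatT.
    rewrite {}xx in fx' x'E; rewrite {}yy in fy' y'E.
    have [a [b [aE bE]]] := lift j i x fx fx'; have [a' [b' [aE' bE']]] := lift k i y fy fy'.
    (* Subdivisions are strictly increasing, so a jump of duration 0 contributes no point. *)
    exists (a - a'), (b - b'), (if s == t then [::] else [:: t]).
    have -> : F1 j x - F1 k y - (a - a')%:~R = F1 i x - F1 i y.
      by rewrite /F1 aE aE' intrB; ring.
    have -> : F2 j x - F2 k y - (b - b')%:~R = F2 i x - F2 i y.
      by rewrite /F2 bE bE' intrB; ring.
    rewrite -(iso fx' fy') x'E y'E.
    have [<-|nst] := eqVneq s t; first by rewrite subrr /norm2 dotvE big1 ?sqrtr0// => ? _;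
      rewrite mxE mul0r.
    by split=> //=; [rewrite andbT lt_neqAle nst | rewrite addr0 -norm2N opprB].
  - move=> s t u s0 st tu u1 Pst Ptu i x j y fx fy xE yE.
    have [|e] := cX t; first by rewrite (le_trans s0 st) (le_trans tu u1).
    rewrite realizationE => -[k _ fe] eE.
    have [a [b [r [pr lr hr]]]] := Pst i x k e fx fe xE eE.
    have [a' [b' [r' [pr' lr' hr']]]] := Ptu k e j y fe fy eE yE.
    exists (a + a'), (b + b'), (r ++ r'); split.
    + by rewrite cat_path pr lr.
    + by rewrite last_cat lr.
    + rewrite polygon_length_cat lr (le_trans _ (lerD hr hr'))//.
      by apply: le_trans (normc_le _ _ _ _); rewrite le_eqVlt; apply/orP; left; apply/eqP;
        congr (Normc.normc (Z _ _)); rewrite intrD; ring.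
have [i [m [k [fx xm xk]]]] := ptP (c1 z) (c2 z).
have [j [m' [k' [fy ym yk]]]] := ptP (c1 w) (c2 w).
have [a [b [r [pr lr hr]]]] := P01 i _ j _ fx fy (esym c0) (esym c1E).
exists (Z (a - m + m')%:~R (b - k + k')%:~R); first by apply/latticeP;
  exists (a - m + m'), (b - k + k').
apply: (@le_trans _ _ (polygon_length c 0 r)%:E); last first.
  apply: ereal_sup_ubound; exists r; first by split; rewrite ?lr.
  by rewrite polygon_lengthE.
rewrite lee_fin (le_trans _ hr)// le_eqVlt; apply/orP; left; apply/eqP.
rewrite xm ym xk yk -[in LHS](Zc z) -[in LHS](Zc w) -!ZN -!ZD; congr (Normc.normc (Z _ _));
  by rewrite !intrD !intrN; ring.
Qed.

Lemma isometric : isometric_flat_torus (pl_image T q) v1 v2.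
Proof.
exists p; split; first exact: range_p.
move=> z w; apply/eqP; rewrite eq_le; apply/andP; split.
  rewrite /flat_dist; set S := [set _ | _ in _].
  have S0 : S !=set0.
    by exists (Normc.normc (z - w - 0)), 0 => //; exists 0, 0; rewrite !mulr0z addr0.
  have HS r : S r -> (intrinsic_dist (pl_image T q) (p z) (p w) <= r%:E)%E.
    by move=> [l lL <-]; exact: intrinsic_le.
  case: (intrinsic_dist _ _ _) HS => [d HS| HS |_].
  - by rewrite lee_fin; apply: lb_le_inf => // r /HS; rewrite lee_fin.
  - by have [r /HS] := S0; rewrite leye_eq.
  - exact: leNye.
apply/ereal_infP => _ [c cin <-]; have [l lL /(le_trans _)] := length_ge cin; apply.
rewrite lee_fin; apply: ge_inf; last by exists l.
by exists 0 => _ [l' _ <-]; case: (z - w - l') => ? ?; exact: sqrtr_ge0.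
Qed.
End Isometry.

(** * Edge equations *)

Section IntegerCast.
Variable R : realType.

(** All checks are evaluated in the binary integers [Z], which compute fast; [zr] transports their
    results to the reals. *)
Definition zr (z : Z) : R := (int_of_Z z)%:~R.

Lemma zr0 : zr Z0 = 0. Proof. by []. Qed.
Lemma zr1 : zr (Zpos 1) = 1. Proof. by []. Qed.
Lemma zrD a b : zr (Z.add a b) = zr a + zr b.
Proof. by rewrite /zr -[Z.add a b]/(a + b) rmorphD/= intrD. Qed.
Lemma zrN a : zr (Z.opp a) = - zr a.
Proof. by rewrite /zr -[Z.opp a]/(- a) rmorphN/= intrN. Qed.
Lemma zrB a b : zr (Z.sub a b) = zr a - zr b.
Proof. by rewrite -zrN -zrD; congr zr; lia. Qed.
Lemma zrM a b : zr (Z.mul a b) = zr a * zr b.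
Proof. by rewrite /zr -[Z.mul a b]/(a * b) rmorphM/= intrM. Qed.
Lemma zr_le a b : Z.leb a b -> zr a <= zr b.
Proof. by move=> h; rewrite ler_int; lia. Qed.
Lemma zr_lt a b : Z.ltb a b -> zr a < zr b.
Proof. by move=> h; rewrite ltr_int; lia. Qed.
Lemma zr_abs a : zr (Z.abs a) = `|zr a|.
Proof. by rewrite /zr -intr_norm; congr (_%:~R); lia. Qed.
Lemma zr_int a : exists k : int, zr a = k%:~R.
Proof. by exists (int_of_Z a). Qed.
Lemma int_zr (k : int) : exists a, k%:~R = zr a.
Proof. by exists (Z_of_int k); rewrite /zr Z_of_intK. Qed.
Definition Zsum (n : nat) (f : nat -> Z) : Z :=
  foldr (fun k s => Z.add (f k) s) Z0 (iota 0 n).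

Lemma zr_sum n f : zr (Zsum n f) = \sum_(k < n) zr (f k).
Proof.
rewrite -(big_mkord xpredT (fun k => zr (f k))) /Zsum /index_iota subn0.
by elim: (iota 0 n) => [|k s IH]; rewrite ?big_nil// big_cons /= zrD IH.
Qed.

Definition zitv : Type := Z * Z.
Definition inzi (i : zitv) (x : R) : Prop := zr i.1 <= x /\ x <= zr i.2.
Definition zi_sub (i j : zitv) : zitv := (Z.sub i.1 j.2, Z.sub i.2 j.1).
Definition zi_add (i j : zitv) : zitv := (Z.add i.1 j.1, Z.add i.2 j.2).
Definition zi_mul (i j : zitv) : zitv :=
  (Z.min (Z.min (Z.mul i.1 j.1) (Z.mul i.1 j.2)) (Z.min (Z.mul i.2 j.1) (Z.mul i.2 j.2)),
   Z.max (Z.max (Z.mul i.1 j.1) (Z.mul i.1 j.2)) (Z.max (Z.mul i.2 j.1) (Z.mul i.2 j.2))).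

Lemma zi_subP i j x y : inzi i x -> inzi j y -> inzi (zi_sub i j) (x - y).
Proof. by rewrite /inzi /zi_sub/= !zrB; lra. Qed.

Lemma zi_addP i j x y : inzi i x -> inzi j y -> inzi (zi_add i j) (x + y).
Proof. by rewrite /inzi /zi_add/= !zrD; lra. Qed.

Lemma zr_min a b : zr (Z.min a b) = Num.min (zr a) (zr b).
Proof.
have [ab|ba] := boolP (Z.leb a b).
  by rewrite min_l ?zr_le//; congr zr; lia.
by rewrite min_r ?zr_le//; [congr zr | ]; lia.
Qed.

Lemma zr_max a b : zr (Z.max a b) = Num.max (zr a) (zr b).
Proof.
have [ab|ba] := boolP (Z.leb a b).
  by rewrite max_r ?zr_le//; congr zr; lia.
by rewrite max_l ?zr_le//; [congr zr | ]; lia.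
Qed.

Lemma mul_minmax (x c d y : R) : c <= y -> y <= d ->
  Num.min (x * c) (x * d) <= x * y /\ x * y <= Num.max (x * c) (x * d).
Proof.
move=> cy yd; rewrite ge_min le_max; have [x0|x0] := leP 0 x.
  by rewrite (ler_wpM2l x0 cy) (ler_wpM2l x0 yd) ?orbT.
by rewrite (ler_wnM2l (ltW x0) cy) (ler_wnM2l (ltW x0) yd) ?orbT.
Qed.

(** A product is monotone in each factor separately: its extremes over [j] are at the ends of [j],
    and for each of these ends the extremes over [i] are at the ends of [i]. *)
Lemma zi_mulP i j x y : inzi i x -> inzi j y -> inzi (zi_mul i j) (x * y).
Proof.
move=> [x1 x2] [y1 y2]; rewrite /inzi /zi_mul/= !(zr_min, zr_max) !zrM.
have [hy1 hy2] := mul_minmax x y1 y2.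
have [hc1 hc2] := mul_minmax (zr j.1) x1 x2.
have [hd1 hd2] := mul_minmax (zr j.2) x1 x2.
rewrite ![zr j.1 * _]mulrC in hc1 hc2; rewrite ![zr j.2 * _]mulrC in hd1 hd2.
split.
  apply: le_trans hy1; rewrite [leRHS]minEle; case: ifP => _.
    by apply: le_trans hc1; rewrite le_min !ge_min !lexx ?orbT.
  by apply: le_trans hd1; rewrite le_min !ge_min !lexx ?orbT.
apply: (le_trans hy2); rewrite [leLHS]maxEle; case: ifP => _.
  by apply: (le_trans hd2); rewrite ge_max !le_max !lexx ?orbT.
by apply: (le_trans hc2); rewrite ge_max !le_max !lexx ?orbT.
Qed.

End IntegerCast.

Section EdgeEquations.
Variables (R : realType) (t S : Z).

Definition edge : Type := nat * nat * (Z * Z).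

(* |q_j - q_i|^2 = |P_j + S o - P_i|^2 for the norm a^2 + t a b + b^2; the vertex v has
   the space coordinates x_(3v), x_(3v+1), x_(3v+2) and the lattice coordinates
   x_(24+2v), x_(25+2v). *)
Definition edge_eq (x : nat -> R) (e : edge) : R :=
  let i := e.1.1 in let j := e.1.2 in
  let a := x (24 + 2 * j)%N + zr R (Z.mul S e.2.1) - x (24 + 2 * i)%N in
  let b := x (25 + 2 * j)%N + zr R (Z.mul S e.2.2) - x (25 + 2 * i)%N in
  (x (3 * j)%N - x (3 * i)%N) ^+ 2 + (x (3 * j).+1 - x (3 * i).+1) ^+ 2
  + (x (3 * j).+2 - x (3 * i).+2) ^+ 2 - (a ^+ 2 + zr R t * (a * b) + b ^+ 2).

Definition edge_eqZ (c : nat -> Z) (e : edge) : Z :=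
  let i := e.1.1 in let j := e.1.2 in
  let sq z := Z.mul z z in
  let a := Z.sub (Z.add (c (24 + 2 * j)%N) (Z.mul S e.2.1)) (c (24 + 2 * i)%N) in
  let b := Z.sub (Z.add (c (25 + 2 * j)%N) (Z.mul S e.2.2)) (c (25 + 2 * i)%N) in
  Z.sub (Z.add (Z.add (sq (Z.sub (c (3 * j)%N) (c (3 * i)%N)))
      (sq (Z.sub (c (3 * j).+1) (c (3 * i).+1))))
      (sq (Z.sub (c (3 * j).+2) (c (3 * i).+2))))
    (Z.add (Z.add (sq a) (Z.mul t (Z.mul a b))) (sq b)).

Lemma zr_edge_eq c e : zr R (edge_eqZ c e) = edge_eq (fun k => zr R (c k)) e.
Proof. by rewrite /edge_eqZ /edge_eq !(zrB, zrD, zrM) !expr2. Qed.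

(* Pairs of a variable and the partial derivative of edge_eq at c. *)
Definition edge_grad (c : nat -> Z) (e : edge) : seq (nat * Z) :=
  let i := e.1.1 in let j := e.1.2 in
  let a := Z.sub (Z.add (c (24 + 2 * j)%N) (Z.mul S e.2.1)) (c (24 + 2 * i)%N) in
  let b := Z.sub (Z.add (c (25 + 2 * j)%N) (Z.mul S e.2.2)) (c (25 + 2 * i)%N) in
  let d k k' := Z.add (Z.sub (c k') (c k)) (Z.sub (c k') (c k)) in
  let ga := Z.add (Z.add a a) (Z.mul t b) in
  let gb := Z.add (Z.add b b) (Z.mul t a) in
  let d0 := d (3 * i)%N (3 * j)%N in
  let d1 := d (3 * i).+1 (3 * j).+1 in
  let d2 := d (3 * i).+2 (3 * j).+2 in
  [:: ((3 * j)%N, d0); ((3 * i)%N, Z.opp d0); ((3 * j).+1, d1); ((3 * i).+1, Z.opp d1);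
      ((3 * j).+2, d2); ((3 * i).+2, Z.opp d2);
      ((24 + 2 * j)%N, Z.opp ga); ((24 + 2 * i)%N, ga);
      ((25 + 2 * j)%N, Z.opp gb); ((25 + 2 * i)%N, gb)].

Let mul_bound (u v h : R) : `|u| <= 4 -> `|v| <= 2 * h -> `|u * v| <= 8 * h.
Proof.
move=> u4 v2; rewrite normrM (_ : 8 * h = 4 * (2 * h)); last by ring.
by rewrite ler_pM.
Qed.

(** For a square, [X^2 - Y^2 - 2 C (X - Y) = (X + Y - 2 C) (X - Y)]. Here [X], [Y], [C] are
    differences of two coordinates, so the factors are at most [4] and [2 h]. The equation has five
    squares and one mixed term, which polarizes in the same way with weight [t <= 1]: six terms of
    at most [8 h], whatever the size of the centre. *)
Lemma edge_eq_diff (c : nat -> Z) (x y : nat -> R) (h : R) (e : edge) :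
  Z.eqb t Z0 || Z.eqb t (Zpos 1) ->
  (forall k, `|x k - zr R (c k)| <= 1) -> (forall k, `|y k - zr R (c k)| <= 1) ->
  (forall k, `|x k - y k| <= h) ->
  `|edge_eq x e - edge_eq y e - \sum_(p <- edge_grad c e) zr R p.2 * (x p.1 - y p.1)| <=
  48 * h.
Proof.
move=> t01 xc yc xy; have h0 : 0 <= h := le_trans (normr_ge0 _) (xy 0%N).
case: e => -[i j] [w1 w2].
have dev4 p q : `|(x q - x p) + (y q - y p) - 2 * (zr R (c q) - zr R (c p))| <= 4.
  have := xc p; have := xc q; have := yc p; have := yc q.
  by rewrite !ler_norml => /andP[? ?] /andP[? ?] /andP[? ?] /andP[? ?]; apply/andP; split; lra.
have dev2 p q : `|(x q - x p) - (y q - y p)| <= 2 * h.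
  have := xy p; have := xy q.
  by rewrite !ler_norml => /andP[? ?] /andP[? ?]; apply/andP; split; lra.
pose r p q p' q' := ((x q - x p) + (y q - y p) - 2 * (zr R (c q) - zr R (c p))) *
  ((x q' - x p') - (y q' - y p')).
have rh p q p' q' : `|r p q p' q'| <= 8 * h := mul_bound (dev4 p q) (dev2 p' q').
have t1 : 0 <= zr R t /\ zr R t <= 1.
  by case/orP: t01 => /Z.eqb_spec ->; rewrite ?zr0 ?zr1; lra.
rewrite /edge_eq /edge_grad /= !big_cons big_nil /=.
rewrite !(zrN, zrD, zrB, zrM) /=.
pose ai := (24 + 2 * i)%N; pose aj := (24 + 2 * j)%N.
pose bi := (25 + 2 * i)%N; pose bj := (25 + 2 * j)%N.
pose u1 := r ai aj bi bj; pose u2 := r bi bj ai aj.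
pose u3 := r bi bj bi bj; pose u4 := r ai aj ai aj.
pose u5 := r (3 * i).+2 (3 * j).+2 (3 * i).+2 (3 * j).+2.
pose u6 := r (3 * i).+1 (3 * j).+1 (3 * i).+1 (3 * j).+1.
pose u7 := r (3 * i)%N (3 * j)%N (3 * i)%N (3 * j)%N.
have h1 : `|u1| <= 8 * h by exact: rh.
have h2 : `|u2| <= 8 * h by exact: rh.
have T : `|zr R t * (u1 + u2) / 2| <= 8 * h.
  have -> : zr R t * (u1 + u2) / 2 = zr R t / 2 * (u1 + u2) by ring.
  rewrite normrM (@ger0_norm _ (zr R t / 2)); last by case: t1; lra.
  rewrite (_ : 8 * h = 1 / 2 * (16 * h)); last by field.
  rewrite ler_pM//; [by case: t1; lra | by case: t1; lra|].
  by rewrite (le_trans (ler_normD _ _))//; lra.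
set z := (X in `|X|).
have -> : z = u7 + u6 + u5 - u4 - u3 - zr R t * (u1 + u2) / 2.
  rewrite /z /u1 /u2 /u3 /u4 /u5 /u6 /u7 /r /ai /aj /bi /bj.
  by clear; field.
rewrite (le_trans (ler_normB _ _))// (_ : 48 * h = 40 * h + 8 * h); last by ring.
rewrite lerD ?rh// (le_trans (ler_normB _ _))// (_ : 40 * h = 32 * h + 8 * h); last by ring.
rewrite lerD ?rh// (le_trans (ler_normB _ _))// (_ : 32 * h = 24 * h + 8 * h); last by ring.
rewrite lerD ?rh// (le_trans (ler_normD _ _))// (_ : 24 * h = 16 * h + 8 * h); last by ring.
rewrite lerD ?rh// (le_trans (ler_normD _ _))// (_ : 16 * h = 8 * h + 8 * h); last by ring.
by rewrite lerD// rh.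
Qed.

End EdgeEquations.

Section NewtonCheck.
Variables (R : realType) (t S : Z) (n : nat).
Variables (es : seq edge) (c : nat -> Z) (sel : seq nat) (Nm : seq (seq Z)) (D : Z).

Let e0 : edge := (0, 0, (Z0, Z0))%N.
Let Nz (i e : nat) : Z := nth Z0 (nth [::] Nm i) e.

Definition jacobian (e j : nat) : Z :=
  foldr (fun p s => Z.add (if p.1 == nth 0%N sel j then p.2 else Z0) s) Z0
    (edge_grad t S c (nth e0 es e)).

(** With [N = Nm / D] and [L] the Jacobian matrix at the centre, the last three clauses read
    [|1 - N L| <= 1/4], [|N| <= 1/192] and [|N F(0)| <= 1/2]. As [F] deviates from [L] by at most
    [48] times the distance, the iteration contracts by [1/4 + 48/192 = 1/2] and maps the unit ball
    into itself. Distinct entries in [sel] ensure that each coordinate moves by at most one entry of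
    the unknown vector, hence by at most 1. *)
Definition newton_check : bool :=
  [&& Z.eqb t Z0 || Z.eqb t (Zpos 1), Z.ltb Z0 D, uniq sel, size sel == n,
   all (fun i => Z.leb (Z.mul 4 (Zsum n (fun j => Z.abs (Z.sub
          (if i == j then D else Z0)
          (Zsum n (fun e => Z.mul (Nz i e) (jacobian e j))))))) D) (iota 0 n),
   all (fun i => Z.leb (Z.mul 192 (Zsum n (fun e => Z.abs (Nz i e)))) D) (iota 0 n)
   & all (fun i => Z.leb (Z.mul 2 (Z.abs (Zsum n (fun e =>
          Z.mul (Nz i e) (edge_eqZ t S c (nth e0 es e)))))) D) (iota 0 n)].

Hypothesis chk : newton_check.

(** The displacement of the coordinate [k]: the entry of [u] assigned to it, or 0 when [k] is
    frozen. *)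
Let sel_sum (u : 'cV[R]_n) (k : nat) : R := \sum_(j < n) (nth 0%N sel j == k)%:R * u j 0.

Let sel_sum_le u k : `|sel_sum u k| <= `|u|.
Proof.
have /and5P[_ _ uq /eqP sz _] := chk.
have [ks|ks] := boolP (k \in sel); last first.
  rewrite /sel_sum big1 ?normr0// => j _; case: eqP => [jk|]; last by rewrite mul0r.
  by move: ks; rewrite -jk mem_nth ?sz.
have kn : (index k sel < n)%N by rewrite -sz index_mem.
rewrite /sel_sum (bigD1 (Ordinal kn))//= nth_index// eqxx mul1r big1 ?addr0 ?le_mx_norm//.
move=> j /eqP jk; case: eqP => [kE|]; last by rewrite mul0r.
by case: jk; apply: val_inj => /=; rewrite -kE index_uniq ?sz.
Qed.

Let xof (u : 'cV[R]_n) (k : nat) : R := zr R (c k) + sel_sum u k.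
Let F (u : 'cV[R]_n) : 'cV[R]_n := \col_e edge_eq t S (xof u) (nth e0 es e).
Let L : 'M[R]_n := \matrix_(e, j) zr R (jacobian e j).
Let N : 'M[R]_n := \matrix_(i, e) (zr R (Nz i e) / zr R D).

Let sel_sumB u v k : sel_sum (u - v) k = sel_sum u k - sel_sum v k.
Proof. by rewrite /sel_sum -sumrB; apply: eq_bigr => j _; rewrite !mxE mulrBr. Qed.

Let xofB u v k : xof u k - xof v k = sel_sum (u - v) k.
Proof. by rewrite /xof opprD addrACA subrr add0r sel_sumB. Qed.

Let mulL (w : 'cV[R]_n) e : (L *m w) e 0 =
  \sum_(p <- edge_grad t S c (nth e0 es e)) zr R p.2 * sel_sum w p.1.
Proof.
rewrite mxE /sel_sum; under [RHS]eq_bigr do rewrite mulr_sumr.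
rewrite exchange_big/=; apply: eq_bigr => j _; rewrite mxE /jacobian.
elim: (edge_grad _ _ _ _) => [|p s IH]; first by rewrite big_nil mul0r.
rewrite big_cons /= zrD mulrDl IH; congr (_ + _).
by rewrite [p.1 == _]eq_sym; case: eqP => _; rewrite ?mul1r ?mul0r ?mulr0.
Qed.

Let D_gt0 : 0 < zr R D.
Proof. by have /and5P[_ /(@zr_lt R)] := chk. Qed.

Let F_diff u v : `|u| <= 1 -> `|v| <= 1 -> `|F u - F v - L *m (u - v)| <= 48 * `|u - v|.
Proof.
move=> u1 v1; have /and5P[t01 _ _ _ _] := chk.
apply: mx_norm_le => [|e j]; first by rewrite mulr_ge0.
rewrite ord1; have -> : (F u - F v - L *m (u - v)) e 0 =
    edge_eq t S (xof u) (nth e0 es e) - edge_eq t S (xof v) (nth e0 es e) -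
    \sum_(p <- edge_grad t S c (nth e0 es e)) zr R p.2 * (xof u p.1 - xof v p.1).
  have -> : (F u - F v - L *m (u - v)) e 0 = F u e 0 - F v e 0 - (L *m (u - v)) e 0.
    by rewrite !mxE.
  rewrite mulL [F u e 0]mxE [F v e 0]mxE; congr (_ - _); apply: eq_bigr => p _.
  by rewrite xofB.
apply: edge_eq_diff => // k; rewrite /xof.
- by rewrite addrC addKr (le_trans (sel_sum_le _ _)).
- by rewrite addrC addKr (le_trans (sel_sum_le _ _)).
- by rewrite xofB sel_sum_le.
Qed.

Let iotaP (i : 'I_n) : val i \in iota 0 n.
Proof. by rewrite mem_iota /= ltn_ord. Qed.

Let N_le (w : 'cV[R]_n) : `|N *m w| <= 1 / 192 * `|w|.
Proof.
apply: norm_mulmx_le => [|i]; first by rewrite divr_ge0.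
have /and5P[_ _ _ _ /and3P[_ /allP/(_ (val i)) h _]] := chk.
have /(@zr_le R) : Z.leb (Z.mul 192 (Zsum n (fun e => Z.abs (Nz i e)))) D.
  by apply: h; rewrite mem_iota /= ltn_ord.
rewrite zrM zr_sum => h'.
have -> : \sum_j `|N i j| = (\sum_(e < n) zr R (Z.abs (Nz i e))) / zr R D.
  rewrite mulr_suml; apply: eq_bigr => e _.
  by rewrite mxE normrM zr_abs normfV (gtr0_norm D_gt0).
rewrite ler_pdivrMr// [_ * zr R D]mulrC.
by move: h'; rewrite (_ : zr R 192 = 192)//; lra.
Qed.

Let NL_le (w : 'cV[R]_n) : `|w - N *m (L *m w)| <= 1 / 4 * `|w|.
Proof.
rewrite mulmxA -[X in X - _]mul1mx -mulmxBl.
apply: norm_mulmx_le => [|i]; first by rewrite divr_ge0.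
have /and5P[_ _ _ _ /and3P[/allP/(_ (val i)) h _ _]] := chk.
have /(@zr_le R) {}h := h (iotaP i); rewrite zrM zr_sum in h.
have -> : \sum_j `|(1%:M - N *m L) i j| = (\sum_(j < n) zr R (Z.abs (Z.sub
    (if val i == j then D else Z0)
    (Zsum n (fun e => Z.mul (Nz i e) (jacobian e j)))))) / zr R D.
  rewrite mulr_suml; apply: eq_bigr => j _.
  set z := Z.sub _ _; transitivity `|zr R z / zr R D|; last first.
    by rewrite normrM normfV (gtr0_norm D_gt0) zr_abs.
  congr `|_|; rewrite /z zrB zr_sum mulrBl !mxE mulr_suml; congr (_ - _).
    rewrite -val_eqE; case: eqP => _; first by rewrite divff// gt_eqF.
    by rewrite mul0r.
  apply: eq_bigr => e _; rewrite !mxE zrM; ring.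
rewrite ler_pdivrMr// [_ * zr R D]mulrC.
by move: h; rewrite (_ : zr R 4 = 4)//; lra.
Qed.

Let NF0_le : `|N *m F 0| <= 1 - 1 / 2.
Proof.
apply: mx_norm_le => [|i k]; first by lra.
have /and5P[_ _ _ _ /and3P[_ _ /allP/(_ (val i)) h]] := chk.
have /(@zr_le R) {}h := h (iotaP i); rewrite zrM zr_abs zr_sum in h.
have -> : (N *m F 0) i k =
    (\sum_(e < n) zr R (Z.mul (Nz i e) (edge_eqZ t S c (nth e0 es e)))) / zr R D.
  rewrite mxE mulr_suml; apply: eq_bigr => e _; rewrite !mxE zrM zr_edge_eq.
  rewrite mulrAC; congr (_ * _ / _); rewrite /edge_eq.
  have xc p : xof 0 p = zr R (c p).
    by rewrite /xof /sel_sum big1 ?addr0// => j _; rewrite mxE mulr0.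
  by rewrite !xc.
rewrite normrM normfV (gtr0_norm D_gt0) ler_pdivrMr//.
by move: h; rewrite (_ : zr R 2 = 2)//; lra.
Qed.

Lemma newton_solution : exists x : nat -> R,
  (forall k, `|x k - zr R (c k)| <= 1) /\
  (forall e, (e < n)%N -> edge_eq t S x (nth e0 es e) = 0).
Proof.
have [|v|u v u1 v1||u u1 Fu] := @newton_zero R n F N L (1 / 2).
- by lra.
- by rewrite (le_trans (NL_le v))// ler_wpM2r//; lra.
- have -> : u - v - N *m (F u - F v) =
      (u - v - N *m (L *m (u - v))) - N *m (F u - F v - L *m (u - v)).
    rewrite (mulmxBr N (F u - F v)); set a := N *m (F u - F v); set b := N *m (L *m _).
    by rewrite (opprB a b) (addrA _ b) subrK.
  rewrite (le_trans (ler_normB _ _))//.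
  have := NL_le (u - v); have := N_le (F u - F v - L *m (u - v)).
  by have := F_diff u1 v1; lra.
- exact: NF0_le.
- exists (xof u); split=> [k|e en]; first by rewrite addrC addKr (le_trans (sel_sum_le _ _)).
  by move/matrixP/(_ (Ordinal en) 0): Fu; rewrite !mxE.
Qed.

End NewtonCheck.

(** * Lifted triangulations *)

(* A corner (v, o) is the vertex v of the triangulation, translated by o in Z^2 in the
   universal cover. *)
Definition corner : Type := nat * (Z * Z).
Definition face : Type := corner * corner * corner.

Definition off_add (o p : Z * Z) : Z * Z := (Z.add o.1 p.1, Z.add o.2 p.2).
Definition off_opp (o : Z * Z) : Z * Z := (Z.opp o.1, Z.opp o.2).
Definition translate (a : corner) (o : Z * Z) : corner := (a.1, off_add a.2 o).
Definition base (v : nat) : corner := (v, (Z0, Z0)).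

Definition corners (f : face) : seq corner := [:: f.1.1; f.1.2; f.2].
Definition labels (f : face) : seq nat := [:: f.1.1.1; f.1.2.1; f.2.1].

Definition cyclic_pairs (T : Type) (s : seq T) : seq (T * T) := zip s (rot 1 s).

Section Combinatorics.
(* The link of v is the counterclockwise list of its neighbours, lifted next to the
   lift (v, 0). *)
Variable links : seq (seq corner).

Definition link (v : nat) : seq corner := nth [::] links v.
Definition rooted_faces (v : nat) : seq face :=
  [seq (base v, p.1, p.2) | p <- cyclic_pairs (link v)].
(** Each triangle occurs three times, once from each vertex, with that vertex lifted to offset 0.
    The list [min_rooted_faces] retains the copy rooted at the smallest label. *)
Definition faces : seq face := flatten [seq rooted_faces v | v <- iota 0 8].
Definition min_rooted_faces : seq face :=
  [seq f : face <- faces | (f.1.1.1 < f.1.2.1) && (f.1.1.1 < f.2.1)]%N.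
Definition edges : seq edge :=
  flatten [seq [seq (v, a.1, a.2) | a <- link v & (v < a.1)%N] | v <- iota 0 8].

Definition rotate_face (f : face) : face :=
  let o := off_opp f.1.2.2 in
  (base f.1.2.1, translate f.2 o, translate f.1.1 o).

(** The offset in [f] minus the offset in [g] is the same vector for all common vertices. This makes
    the lifts of a common edge agree up to a single lattice translation. *)
Definition same_translation (f g : face) : bool :=
  all (fun a => all (fun a' => all (fun b => all (fun b' =>
    [&& a.1 == b.1 & a'.1 == b'.1] ==> (off_add a.2 b'.2 == off_add a'.2 b.2))
  (corners g)) (corners g)) (corners f)) (corners f).

Definition combinatorial_check : bool :=
  [&& all (fun f => all (fun v => (v < 8)%N) (labels f) && uniq (labels f)) faces,
      all (fun v => ~~ nilp (link v)) (iota 0 8),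
      all (fun f => all (same_translation f) faces) faces,
      all (fun f => rotate_face f \in faces) faces
    & all (fun v => all (fun a => (v, off_opp a.2) \in link a.1) (link v)) (iota 0 8)].

Hypothesis chk : combinatorial_check.

Lemma labelsE f : labels f = [seq a.1 | a <- corners f]. Proof. by []. Qed.

Lemma mem_faces f : f \in faces -> exists v p, [/\ (v < 8)%N, p \in cyclic_pairs (link v) &
  f = (base v, p.1, p.2)].
Proof.
move=> /flattenP[_ /mapP[v v8 ->] /mapP[p pL ->]]; exists v, p; split=> //.
by rewrite mem_iota in v8.
Qed.

Lemma rooted_mem_faces v p : (v < 8)%N -> p \in cyclic_pairs (link v) ->
  (base v, p.1, p.2) \in faces.
Proof.
move=> v8 pL; apply/flattenP; exists (rooted_faces v).
  by apply/mapP; exists v; rewrite // mem_iota.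
by apply/mapP; exists p.
Qed.

Lemma label_lt8 f v : f \in faces -> v \in labels f -> (v < 8)%N.
Proof. by move=> ff; have /and5P[/allP/(_ f ff)/andP[/allP h _] _ _ _ _] := chk; exact: h. Qed.

Lemma label_uniq f : f \in faces -> uniq (labels f).
Proof. by move=> ff; have /and5P[/allP/(_ f ff)/andP[_ ->]] := chk. Qed.

Lemma rotate_faceP f : f \in faces -> rotate_face f \in faces.
Proof. by have /and5P[_ _ _ /allP h _] := chk; exact: h. Qed.

Lemma labels_rotate f : labels (rotate_face f) = rot 1 (labels f).
Proof. by []. Qed.

Lemma face_with_root f v : f \in faces -> v \in labels f -> exists g,
  [/\ g \in faces, g.1.1 = base v & labels g =i labels f].
Proof.
move=> ff; have f1 := rotate_faceP ff; have f2 := rotate_faceP f1.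
rewrite !inE => /or3P[] /eqP ->.
- have [w [p [_ _ fE]]] := mem_faces ff; exists f; split=> //; by rewrite fE.
- by exists (rotate_face f); split=> // u; rewrite labels_rotate mem_rot.
- by exists (rotate_face (rotate_face f)); split=> // u; rewrite !labels_rotate !mem_rot.
Qed.

Lemma min_rooted f : f \in faces -> exists2 g, g \in min_rooted_faces & labels g =i labels f.
Proof.
move=> ff; have f1 := rotate_faceP ff; have f2 := rotate_faceP f1.
have := label_uniq ff; rewrite /= !inE negb_or => /and3P[/andP[n1 n2] n3 _].
have [h|h] := boolP ((f.1.1.1 < f.1.2.1) && (f.1.1.1 < f.2.1))%N.
  by exists f; rewrite // mem_filter h.
have [h'|h'] := boolP ((f.1.2.1 < f.1.1.1) && (f.1.2.1 < f.2.1))%N.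
  exists (rotate_face f); last by move=> u; rewrite labels_rotate mem_rot.
  by rewrite mem_filter f1 andbT /= andbC.
exists (rotate_face (rotate_face f)); last by move=> u; rewrite !labels_rotate !mem_rot.
rewrite mem_filter f2 andbT /=; move: n1 n2 n3 h h'.
move: f.1.1.1 f.1.2.1 f.2.1 => i j k; clear; lia.
Qed.

Lemma min_rooted_faces_sub f : f \in min_rooted_faces -> f \in faces.
Proof. by rewrite mem_filter => /andP[]. Qed.

Lemma vertex_face v : (v < 8)%N -> exists2 f, f \in faces & v \in labels f.
Proof.
move=> v8; have /and5P[_ /allP/(_ v) h _ _ _] := chk.
have {h} := h ltac:(by rewrite mem_iota); case E : (link v) => [//|a s] _.
exists (base v, a, head a (rot 1 (a :: s))); last by rewrite inE eqxx.
have := @rooted_mem_faces v (a, head a (rot 1 (a :: s))) v8; apply.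
by rewrite E /cyclic_pairs rot1_cons; case: s {E} => [|b s] /=; rewrite inE eqxx.
Qed.

End Combinatorics.

(** * Points of a face and their lifts *)

Section Realization.
Variables (R : realType) (links : seq (seq corner)).
Hypothesis chk : combinatorial_check links.
Local Notation faces := (faces links).

Definition weight (y : 'rV[R]_8) (v : nat) : R := y 0 (inord v).

Definition face_pts (f : face) : set 'rV[R]_8 :=
  [set y | [/\ forall v, 0 <= y 0 v, \sum_v y 0 v = 1
             & forall v : 'I_8, (v : nat) \notin labels f -> y 0 v = 0]].

Lemma face_pts_sum (V : lmodType R) f y (G : 'I_8 -> V) : f \in faces -> face_pts f y ->
  \sum_v y 0 v *: G v = weight y f.1.1.1 *: G (inord f.1.1.1) +
    weight y f.1.2.1 *: G (inord f.1.2.1) + weight y f.2.1 *: G (inord f.2.1).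
Proof.
move=> ff [_ _ y0].
have l8 v : v \in labels f -> (v < 8)%N := label_lt8 chk ff.
have := label_uniq chk ff; rewrite /= !inE negb_or => /and3P[/andP[n1 n2] n3 _].
have inordE u v : u \in labels f -> v \in labels f ->
    (inord u == inord v :> 'I_8) = (u == v).
  by move=> ul vl; rewrite -val_eqE /= !inordK ?l8.
rewrite (bigD1 (inord f.1.1.1))//= (bigD1 (inord f.1.2.1))/=; last first.
  by rewrite inordE ?inE ?eqxx ?orbT// eq_sym.
rewrite (bigD1 (inord f.2.1))/=; last first.
  by rewrite !inordE ?inE ?eqxx ?orbT// !(eq_sym f.2.1) n2 n3.
rewrite big1 ?addr0 ?addrA// => v /andP[/andP[v1 v2] v3].
rewrite y0 ?scale0r// !inE !negb_or; apply/and3P; split.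
- by apply: contraNneq v1 => <-; rewrite inord_val.
- by apply: contraNneq v2 => <-; rewrite inord_val.
- by apply: contraNneq v3 => <-; rewrite inord_val.
Qed.

Definition face_comb (W : corner -> R) (f : face) (y : 'rV[R]_8) : R :=
  weight y f.1.1.1 * W f.1.1 + weight y f.1.2.1 * W f.1.2 + weight y f.2.1 * W f.2.

Lemma weight_sum f y : f \in faces -> face_pts f y ->
  weight y f.1.1.1 + weight y f.1.2.1 + weight y f.2.1 = 1.
Proof.
move=> ff fy; have [_ <- _] := fy.
have := @face_pts_sum R^o f y (fun=> 1) ff fy; rewrite /GRing.scale/= !mulr1 => <-.
by apply: eq_bigr => v _; rewrite mulr1.
Qed.

Lemma weight_ge0 f y v : face_pts f y -> 0 <= weight y v.
Proof. by move=> [y0 _ _]; exact: y0. Qed.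

Lemma eq_face_pts f g : labels f =i labels g -> face_pts f = face_pts g.
Proof.
move=> fg; apply/seteqP; split=> y [y0 y1 h]; split=> // v vl; apply: h.
  by rewrite fg.
by rewrite -fg.
Qed.

Definition corner_at (f : face) (v : nat) : corner :=
  nth (base 0) (corners f) (index v (labels f)).

Lemma corner_atP f v : v \in labels f -> corner_at f v \in corners f /\ (corner_at f v).1 = v.
Proof.
move=> vl; have i3 : (index v (labels f) < size (corners f))%N by rewrite index_mem.
split; first exact: mem_nth.
rewrite /corner_at -(nth_map _ 0%N)// -labelsE nth_index//.
Qed.

Lemma face_combE W f y : f \in faces -> face_pts f y ->
  face_comb W f y = \sum_v y 0 v * W (corner_at f v).
Proof.
move=> ff fy; have := @face_pts_sum R^o f y (fun v => W (corner_at f v)) ff fy.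
rewrite /GRing.scale/= => ->.
have := label_uniq chk ff; rewrite /= !inE negb_or => /and3P[/andP[n1 n2] n3 _].
rewrite !inordK; try by apply: (label_lt8 chk ff); rewrite !inE eqxx ?orbT.
by rewrite /corner_at /= eqxx (negPf n1) eqxx (negPf n2) (negPf n3) eqxx.
Qed.

Variables (t S : Z) (x : nat -> R).

Definition lat1 (a : corner) : R := x (24 + 2 * a.1)%N + zr R (Z.mul S a.2.1).
Definition lat2 (a : corner) : R := x (25 + 2 * a.1)%N + zr R (Z.mul S a.2.2).

Lemma lat1_translate a o : lat1 (translate a o) = lat1 a + zr R S * zr R o.1.
Proof. by rewrite /lat1 /= !(zrM, zrD); ring. Qed.

Lemma lat2_translate a o : lat2 (translate a o) = lat2 a + zr R S * zr R o.2.
Proof. by rewrite /lat2 /= !(zrM, zrD); ring. Qed.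

(** A common point has nonzero weight only at common vertices, and [same_translation] gives all of
    these the same offset difference [o]. As the weights sum to 1, the point itself moves by [o]. *)
Lemma face_comb_lift f g y : f \in faces -> g \in faces -> face_pts f y -> face_pts g y ->
  exists o : Z * Z, face_comb lat1 f y = face_comb lat1 g y + zr R S * zr R o.1 /\
                    face_comb lat2 f y = face_comb lat2 g y + zr R S * zr R o.2.
Proof.
move=> ff gg fy gy; have [y0 y1 yf] := fy; have [_ _ yg] := gy.
have [v yv] : exists v, y 0 v != 0.
  apply/existsP; apply: contraT; rewrite negb_exists => /forallP y00.
  suff : (1 : R) == 0 by rewrite oner_eq0.
  by rewrite -y1 big1// => v _; apply/eqP; rewrite -[_ == _]negbK.
have inl u : y 0 u != 0 -> ((u : nat) \in labels f) /\ ((u : nat) \in labels g).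
  by move=> yu; split; apply: contraNT yu => h; rewrite ?(yf _ h) ?(yg _ h).
have same a a' b b' : a \in corners f -> a' \in corners f -> b \in corners g ->
    b' \in corners g -> a.1 = b.1 -> a'.1 = b'.1 ->
    off_add a.2 b'.2 = off_add a'.2 b.2.
  move=> ac a'c bc b'c ab ab'.
  have /and5P[_ _ /allP/(_ f ff)/allP/(_ g gg)/allP/(_ a ac) h _ _] := chk.
  move: h => /allP/(_ a' a'c)/allP/(_ b bc)/allP/(_ b' b'c).
  by rewrite ab ab' !eqxx => /eqP.
have [vf vg] := inl v yv.
have [af aE] := corner_atP vf; have [bg bE] := corner_atP vg.
pose o := off_add (corner_at f v).2 (off_opp (corner_at g v).2).
exists o.
suff H (lat : corner -> R) (pr : Z * Z -> Z) :
    (forall a o, lat (translate a o) = lat a + zr R S * zr R (pr o)) ->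
    face_comb lat f y = face_comb lat g y + zr R S * zr R (pr o).
  by split; [exact: H lat1_translate | exact: H lat2_translate].
move=> latT; rewrite !face_combE// -[zr R S * _]mul1r -y1 mulr_suml -big_split/=.
apply: eq_bigr => u _; have [->|yu] := eqVneq (y 0 u) 0; first by rewrite !mul0r addr0.
have [uf ug] := inl u yu.
have [af' aE'] := corner_atP uf; have [bg' bE'] := corner_atP ug.
rewrite -mulrDr -latT; congr (_ * lat _).
have := same _ _ _ _ af' af bg' bg; rewrite aE aE' bE bE' => /(_ erefl erefl) e.
move: e aE' bE'; rewrite /o /translate /off_add /off_opp; clear.
case: (corner_at f u) => [i [a1 a2]]; case: (corner_at g u) => [j [b1 b2]].
case: (corner_at f v) => [k [d1 d2]]; case: (corner_at g v) => [l [p1 p2]] /= [e1 e2] -> ->.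
by congr (_, (_, _)); lia.
Qed.

End Realization.

(** * Each face is isometric to its lift *)

Section Metric.
Variables (R : realType) (links : seq (seq corner)) (t S : Z) (x : nat -> R).
Hypothesis chk : combinatorial_check links.
Hypothesis edge0 : forall v a, (v < 8)%N -> a \in link links v ->
  edge_eq t S x (v, a.1, a.2) = 0.
Local Notation faces := (faces links).
Local Notation lat1 := (lat1 S x).
Local Notation lat2 := (lat2 S x).

Definition position (v : 'I_8) : 'rV[R]_3 := \row_(k < 3) x (k + 3 * v)%N.

(** This is [|a + b tau|^2] when [|tau| = 1] and [2 Re tau = t]. *)
Definition qnorm (a b : R) : R := a ^+ 2 + zr R t * (a * b) + b ^+ 2.

Lemma dotv3 (u : 'rV[R]_3) : dotv u u =
  u 0 0 ^+ 2 + u 0 1 ^+ 2 + u 0 (inord 2) ^+ 2.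
Proof.
rewrite dotvE !big_ord_recl big_ord0 addr0 addrA !expr2.
by congr (_ * _ + _ * _ + _ * _); congr (u 0 _); apply: val_inj; rewrite /= ?inordK.
Qed.

Lemma mem_cyclic_pairs (T : eqType) (s : seq T) p :
  p \in cyclic_pairs s -> p.1 \in s /\ p.2 \in s.
Proof.
move=> ps; have sz : size s = size (rot 1 s) by rewrite size_rot.
split; first by rewrite -(unzip1_zip (eq_leq sz)); apply: map_f.
by rewrite -(mem_rot 1) -(unzip2_zip (eq_leq (esym sz))); apply: map_f.
Qed.

(** A link records only the edges at its centre. The edge opposite to the root is found in the link
    of the second corner, through the rotated face. *)
Lemma face_edges f : f \in faces ->
  [/\ (f.1.1.1 < 8)%N, f.1.1 = base f.1.1.1, f.1.2 \in link links f.1.1.1,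
      f.2 \in link links f.1.1.1
    & translate f.2 (off_opp f.1.2.2) \in link links f.1.2.1].
Proof.
move=> ff; have [v [p [v8 pL fE]]] := mem_faces ff.
have [p1 p2] := mem_cyclic_pairs pL; rewrite fE; split=> //.
have /mem_faces[w [r [_ rL rE]]] := rotate_faceP chk ff.
have [h _] := mem_cyclic_pairs rL;
  have wE : p.1.1 = w by have := congr1 (fun g : face => g.1.1.1) rE; rewrite fE.
have r1 : r.1 = translate p.2 (off_opp p.1.2) by have := congr1 (fun g : face => g.1.2) rE;
  rewrite fE => /= <-.
by rewrite -r1 /= wE.
Qed.

Lemma edge_eqE u v a b : edge_eq t S x (u, v, off_add b (off_opp a)) =
  (x (3 * v)%N - x (3 * u)%N) ^+ 2 + (x (3 * v).+1 - x (3 * u).+1) ^+ 2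
  + (x (3 * v).+2 - x (3 * u).+2) ^+ 2
  - qnorm (lat1 (v, b) - lat1 (u, a)) (lat2 (v, b) - lat2 (u, a)).
Proof. by rewrite /edge_eq /qnorm /lat1 /lat2 /= !(zrM, zrD, zrN); ring. Qed.

(** Two quadratic forms that agree on [u], [w] and [w - u] agree on the span of [u] and [w]. Their
    difference at [d1 u + d2 w] is the combination of the three edge equations displayed in the
    proof. *)
Lemma qnorm_comb p1 p2 q1 q2 r1 r2 a1 a2 b1 b2 d1 d2 :
  p1 ^+ 2 + q1 ^+ 2 + r1 ^+ 2 - qnorm a1 b1 = 0 ->
  p2 ^+ 2 + q2 ^+ 2 + r2 ^+ 2 - qnorm a2 b2 = 0 ->
  (p2 - p1) ^+ 2 + (q2 - q1) ^+ 2 + (r2 - r1) ^+ 2 - qnorm (a2 - a1) (b2 - b1) = 0 ->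
  (d1 * p1 + d2 * p2) ^+ 2 + (d1 * q1 + d2 * q2) ^+ 2 + (d1 * r1 + d2 * r2) ^+ 2 =
  qnorm (d1 * a1 + d2 * a2) (d1 * b1 + d2 * b2).
Proof.
rewrite /qnorm; move: (zr R t) => s E1 E2 E3; apply/subr0_eq.
transitivity ((d1 ^+ 2 + d1 * d2) * (p1 ^+ 2 + q1 ^+ 2 + r1 ^+ 2 -
    (a1 ^+ 2 + s * (a1 * b1) + b1 ^+ 2)) +
  (d2 ^+ 2 + d1 * d2) * (p2 ^+ 2 + q2 ^+ 2 + r2 ^+ 2 -
    (a2 ^+ 2 + s * (a2 * b2) + b2 ^+ 2)) -
  d1 * d2 * ((p2 - p1) ^+ 2 + (q2 - q1) ^+ 2 + (r2 - r1) ^+ 2 -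
    ((a2 - a1) ^+ 2 + s * ((a2 - a1) * (b2 - b1)) + (b2 - b1) ^+ 2))).
  by clear; ring.
by rewrite E1 E2 E3 !mulr0 addr0 subr0.
Qed.

Lemma face_linear_isometry f d1 d2 : f \in faces ->
  let u := d1 *: (position (inord f.1.2.1) - position (inord f.1.1.1)) +
           d2 *: (position (inord f.2.1) - position (inord f.1.1.1)) in
  dotv u u = qnorm (d1 * (lat1 f.1.2 - lat1 f.1.1) + d2 * (lat1 f.2 - lat1 f.1.1))
                   (d1 * (lat2 f.1.2 - lat2 f.1.1) + d2 * (lat2 f.2 - lat2 f.1.1)).
Proof.
move=> ff /=; have [v8 fE a_l b_l c_l] := face_edges ff.
have a8 : (f.1.2.1 < 8)%N by apply: (label_lt8 chk ff); rewrite !inE eqxx orbT.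
have b8 : (f.2.1 < 8)%N by apply: (label_lt8 chk ff); rewrite !inE eqxx !orbT.
have := edge0 a8 c_l.
rewrite -[edge_eq _ _ _ _]/(edge_eq t S x (f.1.2.1, f.2.1, off_add f.2.2 (off_opp f.1.2.2))).
rewrite edge_eqE.
have := edge0 v8 b_l; have := edge0 v8 a_l.
have addN0 o : o = off_add o (off_opp (Z0, Z0)).
  by case: o => a b; rewrite /off_add /=; congr (_, _); lia.
rewrite {1}[f.1.2.2]addN0 edge_eqE {1}[f.2.2]addN0 edge_eqE.
move=> E1 E2 E3; rewrite dotv3 !mxE !inordK// fE [in RHS](surjective_pairing f.1.2)
  [in RHS](surjective_pairing f.2).
apply: qnorm_comb.
- by rewrite -[RHS]E1.
- by rewrite -[RHS]E2.
- have subB (a b c : R) : a - c - (b - c) = a - b by rewrite opprB addrA subrK.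
  by rewrite !subB -[RHS]E3.
Qed.

Lemma barycentric_diff (w0 w1 w2 u0 u1 u2 a b c : R) :
  w0 + w1 + w2 = 1 -> u0 + u1 + u2 = 1 ->
  w0 * a + w1 * b + w2 * c - (u0 * a + u1 * b + u2 * c) =
  (w1 - u1) * (b - a) + (w2 - u2) * (c - a).
Proof.
move=> w u; have -> : w0 = 1 - w1 - w2 by rewrite -w; ring.
have -> : u0 = 1 - u1 - u2 by rewrite -u; ring.
ring.
Qed.

Lemma face_isometry f y z : f \in faces -> face_pts f y -> face_pts f z ->
  dotv (pl_map position y - pl_map position z) (pl_map position y - pl_map position z) =
  qnorm (face_comb lat1 f y - face_comb lat1 f z) (face_comb lat2 f y - face_comb lat2 f z).
Proof.
move=> ff fy fz; have ysum := weight_sum chk ff fy; have zsum := weight_sum chk ff fz.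
rewrite /face_comb !(barycentric_diff _ _ _ ysum zsum) -(face_linear_isometry _ _ ff).
congr (dotv _ _); apply/rowP => k; rewrite /pl_map !(face_pts_sum chk position ff)// !mxE;
  exact: barycentric_diff.
Qed.

End Metric.

(** * Tiling of the plane *)

Section Planar.
Variables (R : realType) (links : seq (seq corner)) (S : Z) (x : nat -> R).
Hypothesis chk : combinatorial_check links.
Local Notation faces := (faces links).
Local Notation lat1 := (lat1 S x).
Local Notation lat2 := (lat2 S x).

Definition ori (a b c : corner) : R :=
  (lat1 b - lat1 a) * (lat2 c - lat2 a) - (lat2 b - lat2 a) * (lat1 c - lat1 a).

Hypothesis ori_gt0 : forall f, f \in faces -> 0 < ori f.1.1 f.1.2 f.2.

Lemma eq_weights f (y z : 'rV[R]_8) : face_pts f y -> face_pts f z ->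
  (forall v, v \in labels f -> weight y v = weight z v) -> y = z.
Proof.
move=> [_ _ y0] [_ _ z0] yz; apply/rowP => v.
have [vf|vf] := boolP ((v : nat) \in labels f); last by rewrite y0 ?z0.
by have := yz _ vf; rewrite /weight inord_val.
Qed.

Lemma det_inj (a1 a2 b1 b2 d1 d2 : R) : a1 * b2 - b1 * a2 != 0 ->
  d1 * a1 + d2 * a2 = 0 -> d1 * b1 + d2 * b2 = 0 -> d1 = 0 /\ d2 = 0.
Proof.
move=> D0 ea eb; split; apply: (mulfI D0); rewrite mulr0.
  transitivity (b2 * (d1 * a1 + d2 * a2) - a2 * (d1 * b1 + d2 * b2)); first ring.
  by rewrite ea eb !mulr0 subrr.
transitivity (a1 * (d1 * b1 + d2 * b2) - b1 * (d1 * a1 + d2 * a2)); first ring.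
by rewrite ea eb !mulr0 subrr.
Qed.

Lemma face_comb_inj f y z : f \in faces -> face_pts f y -> face_pts f z ->
  face_comb lat1 f y = face_comb lat1 f z -> face_comb lat2 f y = face_comb lat2 f z -> y = z.
Proof.
move=> ff fy fz /eqP e1 /eqP e2; have ysum := weight_sum chk ff fy.
have zsum := weight_sum chk ff fz; move: e1 e2; rewrite -subr_eq0 -[_ == _ in X in _ -> X]subr_eq0.
rewrite /face_comb !(barycentric_diff _ _ _ ysum zsum) => /eqP e1 /eqP e2.
have [] := det_inj (lt0r_neq0 (ori_gt0 ff)) e1 e2.
move=> /subr0_eq h1 /subr0_eq h2; apply: (eq_weights fy fz) => v.
rewrite !inE => /or3P[] /eqP-> //.
by move: ysum; rewrite -zsum h1 h2 => /addIr/addIr.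
Qed.

Lemma corner_atE f d : f \in faces -> d \in corners f -> corner_at f d.1 = d.
Proof.
move=> ff dc; have [h1 h2] := corner_atP (map_f fst dc : d.1 \in labels f).
have uq : uniq [seq a.1 | a <- corners f] := label_uniq chk ff.
have /(nthP (base 0))[i i3 iE] := h1; have /(nthP (base 0))[j j3 jE] := dc.
rewrite -iE -jE; congr nth; apply/eqP; rewrite -(nth_uniq 0%N _ _ uq) ?size_map//.
by rewrite !(nth_map (base 0))// iE jE h2.
Qed.

(** The signed area [ori a b] is affine in its last argument, so at a point of a translated face it
    is the weighted mean of its values at the corners. *)
Lemma ori_comb a b f y : f \in faces -> face_pts f y -> forall o : Z * Z,
  (lat1 b - lat1 a) * (face_comb lat2 f y + zr R S * zr R o.2 - lat2 a) -
  (lat2 b - lat2 a) * (face_comb lat1 f y + zr R S * zr R o.1 - lat1 a) =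
  weight y f.1.1.1 * ori a b (translate f.1.1 o) +
  weight y f.1.2.1 * ori a b (translate f.1.2 o) + weight y f.2.1 * ori a b (translate f.2 o).
Proof.
move=> ff fy o; have := weight_sum chk ff fy;
  rewrite /face_comb /ori !lat1_translate !lat2_translate.
move: (weight y _) (weight y _) (weight y _) => w0 w1 w2.
move: (zr R S * _) (zr R S * _) (lat1 a) (lat1 b) (lat1 _) (lat1 _) (lat1 _).
move: (lat2 a) (lat2 b) (lat2 _) (lat2 _) (lat2 _) => *.
have -> : w0 = 1 - w1 - w2 by lra.
ring.
Qed.

(* The oriented line through a and b weakly separates f, on its left, from the translate
   of g, on its right, with no further corner of that translate on the line. *)
Definition separates (f g : face) (o : Z * Z) (a b : corner) : Prop :=
  [/\ a \in corners f, b \in corners f, (forall c, c \in corners f -> 0 <= ori a b c)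
    & forall d, d \in corners g ->
        translate d o \in corners f /\ ori a b (translate d o) <= 0 \/
        ori a b (translate d o) < 0].

Lemma translate0 a : translate a (Z0, Z0) = a.
Proof. by case: a => v [i j]; rewrite /translate /off_add /=; congr (_, (_, _)); lia. Qed.

(** A common point is on both closed sides, hence on the line, so its weights in [g] vanish at every
    corner strictly to the right. The other corners belong to [f] as well; thus [z] is a point of
    [f] with the same lift as [y], and barycentric coordinates in [f] are unique. *)
Lemma separates_inj f g o a b y z : f \in faces -> g \in faces -> separates f g o a b ->
  face_pts f y -> face_pts g z ->
  face_comb lat1 f y = face_comb lat1 g z + zr R S * zr R o.1 ->
  face_comb lat2 f y = face_comb lat2 g z + zr R S * zr R o.2 -> y = z.
Proof.
move=> ff gg [ac bc left right] fy gz e1 e2.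
have := ori_comb a b ff fy (Z0, Z0); have := ori_comb a b gg gz o.
rewrite -e1 -e2 !mulr0 !addr0 => ->; rewrite !translate0 => rl.
have rl0 : 0 <= weight z g.1.1.1 * ori a b (translate g.1.1 o) +
  weight z g.1.2.1 * ori a b (translate g.1.2 o) + weight z g.2.1 * ori a b (translate g.2 o).
  by rewrite rl !addr_ge0// mulr_ge0 ?(weight_ge0 _ fy)// left// !inE eqxx ?orbT.
have le0 d : d \in corners g -> weight z d.1 * ori a b (translate d o) <= 0.
  by move=> /right h; rewrite mulr_ge0_le0 ?(weight_ge0 _ gz)//; case: h => [[]|/ltW].
have eq0 d : d \in corners g -> weight z d.1 * ori a b (translate d o) = 0.
  have h0 := le0 g.1.1 ltac:(by rewrite !inE eqxx).
  have h1 := le0 g.1.2 ltac:(by rewrite !inE eqxx orbT).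
  have h2 := le0 g.2 ltac:(by rewrite !inE eqxx !orbT).
  by rewrite !inE => /or3P[] /eqP ->; lra.
have shared d : d \in corners g -> weight z d.1 != 0 -> translate d o \in corners f.
  move=> dg; have /eqP := eq0 d dg; rewrite mulf_eq0 => /orP[->//|/eqP h _].
  by case: (right d dg) => [[]//|]; rewrite h ltxx.
have sharedv (v : 'I_8) : z 0 v != 0 -> exists d,
    [/\ d \in corners g, d.1 = v & translate d o \in corners f].
  move=> zv; have vg : (v : nat) \in labels g.
    by apply: contraNT zv; have [_ _ h] := gz => /h ->.
  have [dg dE] := corner_atP vg; exists (corner_at g v); split=> //.
  by apply: shared; rewrite // dE /weight inord_val.
have fz : face_pts f z.
  have [z0 z1 _] := gz; split=> // v vf; apply/eqP; apply: contraNT vf.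
  by move=> /sharedv[d [_ <- dc]]; apply: (map_f fst dc).
have comb lat (l : R) : (forall d, lat (translate d o) = lat d + l) ->
    face_comb lat f z = face_comb lat g z + l.
  move=> latT; have [_ z1 _] := gz; rewrite !(face_combE chk)// -[l]mul1r -z1 mulr_suml -big_split.
  apply: eq_bigr => v _ /=; have [->|/sharedv[d [dg dE dc]]] := eqVneq (z 0 v) 0.
    by rewrite !mul0r addr0.
  by rewrite -dE (corner_atE gg dg) -[d.1]/(translate d o).1 (corner_atE ff dc) latT mulrDr.
apply: (face_comb_inj ff fy fz).
  by rewrite e1 -comb// => d; rewrite lat1_translate.
by rewrite e2 -comb// => d; rewrite lat2_translate.
Qed.
End Planar.

Section CyclicPairs.
Variable T : eqType.
Implicit Type s : seq T.

Lemma cyclic_pairs_fst s a : a \in s -> exists2 p, p \in cyclic_pairs s & p.1 = a.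
Proof.
have sz : size s = size (rot 1 s) by rewrite size_rot.
by rewrite -{1}(unzip1_zip (eq_leq sz)) => /mapP[p ps ->]; exists p.
Qed.

Lemma cyclic_pairs_snd s a : a \in s -> exists2 p, p \in cyclic_pairs s & p.2 = a.
Proof.
have sz : size s = size (rot 1 s) by rewrite size_rot.
by rewrite -(mem_rot 1) -{1}(unzip2_zip (eq_leq (esym sz))) => /mapP[p ps ->]; exists p.
Qed.

Lemma cycle_cyclic_pairs (e : rel T) s : cycle e s = all (fun p => e p.1 p.2) (cyclic_pairs s).
Proof.
case: s => //= a s; rewrite /cyclic_pairs rot1_cons.
by elim: s {1 3}a => [|b s IH] c //=; rewrite IH.
Qed.

(** Without such a pair, [0 <= g] at one entry forces [0 < g] at the next, and strict positivity
    spreads around the whole cycle. *)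
Lemma cyclic_sign_change (R : realDomainType) s (g : T -> R) :
  (exists2 a, a \in s & 0 <= g a) -> (exists2 b, b \in s & g b <= 0) ->
  exists p, [/\ p \in cyclic_pairs s, 0 <= g p.1 & g p.2 <= 0].
Proof.
move=> [a a_s ga] [b b_s gb].
suff /hasP[p ps /andP[p1 p2]] : has (fun p => (0 <= g p.1) && (g p.2 <= 0)) (cyclic_pairs s).
  by exists p.
apply: contraLR gb => no_p; rewrite -ltNge.
pose e a b := (0 <= g a) ==> (0 < g b).
have : cycle e s.
  rewrite cycle_cyclic_pairs; move: no_p; rewrite -all_predC; apply: sub_all => p /=.
  by rewrite /e implybE ltNge negb_and.
have [i s' sE] := rot_to a_s; rewrite -(rot_cycle i) sE /= => path_e.
suff /allP : all (fun b => 0 < g b) (rcons s' a).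
  by apply; rewrite mem_rcons -sE mem_rot.
move: path_e ga; elim: (rcons s' a) {1 3}a => [|c q IH] d //= /andP[/implyP dc cq] gd.
by have gc := dc gd; rewrite gc (IH c)// ltW.
Qed.
End CyclicPairs.

(** * The translated faces cover the plane *)

Section Covering.
Variables (R : realType) (links : seq (seq corner)) (S : Z) (x : nat -> R).
Hypothesis chk : combinatorial_check links.
Local Notation faces := (faces links).
Local Notation lat1 := (lat1 S x).
Local Notation lat2 := (lat2 S x).
Local Notation ori := (ori S x).
Hypothesis ori_gt0 : forall f, f \in faces -> 0 < ori f.1.1 f.1.2 f.2.
Hypothesis link_spans : forall v, (v < 8)%N -> exists a b c,
  [/\ a \in link links v, b \in link links v & c \in link links v] /\
  [/\ 0 < ori (base v) a b, 0 < ori (base v) b c & 0 < ori (base v) c a].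

Lemma face_point f (w0 w1 w2 : R) : f \in faces -> 0 <= w0 -> 0 <= w1 -> 0 <= w2 ->
  w0 + w1 + w2 = 1 -> exists z : 'rV[R]_8, face_pts f z /\
  [/\ weight z f.1.1.1 = w0, weight z f.1.2.1 = w1 & weight z f.2.1 = w2].
Proof.
move=> ff w0_ w1_ w2_ w1E.
have l8 v : v \in labels f -> (v < 8)%N := label_lt8 chk ff.
have := label_uniq chk ff; rewrite /= !inE negb_or => /and3P[/andP[n1 n2] n3 _].
pose z : 'rV[R]_8 := \row_v ((v == f.1.1.1 :> nat)%:R * w0 + (v == f.1.2.1 :> nat)%:R * w1 +
  (v == f.2.1 :> nat)%:R * w2).
have sum1 v w : v \in labels f -> \sum_(u < 8) (u == v :> nat)%:R * w = w :> R.
  move=> vf; rewrite (bigD1 (inord v))//= inordK ?l8// eqxx mul1r big1 ?addr0// => u.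
  by rewrite -val_eqE /= inordK ?l8// => /negPf ->; rewrite mul0r.
have lf0 : f.1.1.1 \in labels f by rewrite !inE eqxx.
have lf1 : f.1.2.1 \in labels f by rewrite !inE eqxx orbT.
have lf2 : f.2.1 \in labels f by rewrite !inE eqxx !orbT.
exists z; split; last first.
  rewrite /weight !mxE !inordK ?l8// !eqxx (negPf n1) (negPf n2) (negPf n3).
  rewrite ![_ == f.1.1.1]eq_sym [_ == f.1.2.1]eq_sym (negPf n1) (negPf n2) (negPf n3).
  by rewrite !mul1r !mul0r ?addr0 ?add0r.
split=> [v||v vf].
- by rewrite mxE !addr_ge0// mulr_ge0.
- by under eq_bigr do rewrite mxE; rewrite !big_split/= !sum1.
- move: vf; rewrite mxE !inE !negb_or => /and3P[/negPf -> /negPf -> /negPf ->].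
  by rewrite !mul0r !addr0.
Qed.

Lemma small_step (a e : R) : 0 <= a -> 0 < a \/ 0 <= e ->
  exists2 d, 0 < d & forall r, 0 < r <= d -> 0 <= a + r * e.
Proof.
move=> a0 [a_gt0|e0]; last first.
  by exists 1 => // r /andP[r0 _]; rewrite addr_ge0// mulr_ge0// ltW.
have e1 : 0 < 1 + `|e| by rewrite ltr_pwDl.
exists (a / (1 + `|e|)); first by rewrite divr_gt0.
move=> r /andP[r0]; rewrite ler_pdivlMr// mulrDr mulr1 => h.
have : - (r * e) <= r * `|e| by rewrite -mulrN ler_wpM2l ?(ltW r0)// -normrN ler_norm.
lra.
Qed.

(** By Cramer's rule [u = a1 (p.1 - v) + b1 (p.2 - v)], so moving along [u] changes the three
    weights at the rates [-(a1 + b1)], [a1] and [b1]. The root weight is positive at the start; each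
    other weight is positive or has a nonnegative rate. All three therefore stay nonnegative for
    small [r]. *)
Lemma cone_step v p (m1 m2 u1 u2 a0 b0 d : R) : (v < 8)%N -> p \in cyclic_pairs (link links v) ->
  m1 = a0 * (lat1 p.1 - lat1 (base v)) + b0 * (lat1 p.2 - lat1 (base v)) ->
  m2 = a0 * (lat2 p.1 - lat2 (base v)) + b0 * (lat2 p.2 - lat2 (base v)) ->
  0 <= a0 -> 0 <= b0 -> a0 + b0 < 1 ->
  0 < a0 \/ 0 <= u1 * (lat2 p.2 - lat2 (base v)) - u2 * (lat1 p.2 - lat1 (base v)) ->
  0 < b0 \/ 0 <= (lat1 p.1 - lat1 (base v)) * u2 - (lat2 p.1 - lat2 (base v)) * u1 ->
  0 < d -> exists2 r, 0 < r <= d & exists f y, [/\ f \in faces, face_pts f y,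
    face_comb lat1 f y = lat1 (base v) + m1 + r * u1
  & face_comb lat2 f y = lat2 (base v) + m2 + r * u2].
Proof.
move=> v8 pL; have ff := rooted_mem_faces v8 pL; have := ori_gt0 ff; rewrite /ori/=.
set A1 := lat1 p.1 - _; set A2 := lat2 p.1 - _; set B1 := lat1 p.2 - _; set B2 := lat2 p.2 - _.
move=> D0 -> -> a0_ge0 b0_ge0 ab1 ha hb d0; set D := A1 * B2 - A2 * B1 in D0.
pose a1 := (u1 * B2 - u2 * B1) / D; pose b1 := (A1 * u2 - A2 * u1) / D.
have [|da da0 hda] := @small_step a0 a1 a0_ge0.
  by case: ha => h; [left | right; rewrite divr_ge0// ltW].
have [|db db0 hdb] := @small_step b0 b1 b0_ge0.
  by case: hb => h; [left | right; rewrite divr_ge0// ltW].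
have [||dc dc0 hdc] := @small_step (1 - (a0 + b0)) (- (a1 + b1)).
- by rewrite subr_ge0 ltW.
- by left; rewrite subr_gt0.
pose r := Num.min d (Num.min da (Num.min db dc)).
have r0 : 0 < r by rewrite !lt_min d0 da0 db0.
have rd : r <= d by rewrite ge_min lexx.
have rda : r <= da by rewrite !ge_min lexx ?orbT.
have rdb : r <= db by rewrite !ge_min lexx ?orbT.
have rdc : r <= dc by rewrite !ge_min lexx ?orbT.
exists r; first by rewrite r0.
have [||||y [fy [y0 y1 y2]]] := @face_point _ (1 - (a0 + b0) + r * (- (a1 + b1)))
  (a0 + r * a1) (b0 + r * b1) ff.
- by rewrite hdc ?r0.
- by rewrite hda ?r0.
- by rewrite hdb ?r0.
- ring.
exists (base v, p.1, p.2), y; split=> //; rewrite /face_comb y0 y1 y2 /=.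
- have -> : u1 = a1 * A1 + b1 * B1 by rewrite /a1 /b1 /D; field; exact: lt0r_neq0.
  rewrite -[lat1 p.1](subrK (lat1 (base v))) -/A1 -[lat1 p.2](subrK (lat1 (base v))) -/B1.
  by move: (lat1 _) => l; ring.
- have -> : u2 = a1 * A2 + b1 * B2 by rewrite /a1 /b1 /D; field; exact: lt0r_neq0.
  rewrite -[lat2 p.1](subrK (lat2 (base v))) -/A2 -[lat2 p.2](subrK (lat2 (base v))) -/B2.
  by move: (lat2 _) => l; ring.
Qed.

(** Here [g] is the determinant of a link vector with [u]. The vectors to [a], [b], [c] have a
    vanishing combination with positive coefficients, so [g] takes values of both signs, possibly 0,
    on the link. A change from nonnegative to nonpositive marks the cone containing [u]; the order
    of the signs distinguishes it from the cone containing [-u]. *)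
Lemma link_cone v (u1 u2 : R) : (v < 8)%N -> exists p, [/\ p \in cyclic_pairs (link links v),
  0 <= (lat1 p.1 - lat1 (base v)) * u2 - (lat2 p.1 - lat2 (base v)) * u1 &
  0 <= u1 * (lat2 p.2 - lat2 (base v)) - u2 * (lat1 p.2 - lat1 (base v))].
Proof.
move=> v8; have [a [b [c [[al bl cl]]]]] := link_spans v8.
pose g (a : corner) := (lat1 a - lat1 (base v)) * u2 - (lat2 a - lat2 (base v)) * u1.
move=> [ab bc ca].
have comb : ori (base v) b c * g a + ori (base v) c a * g b + ori (base v) a b * g c = 0.
  by rewrite /ori /g; move: (lat1 _) (lat1 _) (lat1 _) (lat1 _) (lat2 _) (lat2 _) (lat2 _) (
    lat2 _) => *; ring.
have [||p [pL p1 p2]] := @cyclic_sign_change _ _ (link links v) g.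
- have [?|ga] := leP 0 (g a); first by exists a.
  have [?|gb] := leP 0 (g b); first by exists b.
  have [?|gc] := leP 0 (g c); first by exists c.
  have := mulr_gt0 bc (etrans (oppr_gt0 _) ga); have := mulr_gt0 ca (etrans (oppr_gt0 _) gb).
  by have := mulr_gt0 ab (etrans (oppr_gt0 _) gc); rewrite !mulrN; lra.
- have [?|ga] := leP (g a) 0; first by exists a.
  have [?|gb] := leP (g b) 0; first by exists b.
  have [?|gc] := leP (g c) 0; first by exists c.
  have := mulr_gt0 bc ga; have := mulr_gt0 ca gb.
  by have := mulr_gt0 ab gc; lra.
exists p; split=> //; rewrite -oppr_le0 (le_trans _ p2)// /g.
by rewrite le_eqVlt; apply/orP; left; apply/eqP; clear;
  move: (lat1 _) (lat2 _) (lat1 _) (lat2 _) => *; ring.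
Qed.

(** Rooting the face at a vertex of positive weight leaves three cases by the number of other
    positive weights: two in the interior, where the same face serves for all directions; one on an
    edge, where the face across the edge may be needed; none at a vertex, where the link is
    searched. *)
Lemma local_extension f y (u1 u2 d : R) : f \in faces -> face_pts f y -> 0 < d ->
  exists2 r, 0 < r <= d & exists g z (k : Z * Z), [/\ g \in faces, face_pts g z,
    face_comb lat1 g z = face_comb lat1 f y + r * u1 + zr R S * zr R k.1
  & face_comb lat2 g z = face_comb lat2 f y + r * u2 + zr R S * zr R k.2].
Proof.
move=> ff fy d0.
have [v vf yv] : exists2 v, v \in labels f & 0 < weight y v.
  have h v : v \in labels f -> weight y v <= 0 \/ exists2 v, v \in labels f & 0 < weight y v.
    by move=> vf; case: (leP (weight y v) 0) => ?; [left | right; exists v].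
  have := weight_sum chk ff fy.
  case: (h f.1.1.1) => [|h0|//]; first by rewrite !inE eqxx.
  case: (h f.1.2.1) => [|h1|//]; first by rewrite !inE eqxx orbT.
  case: (h f.2.1) => [|h2|//]; first by rewrite !inE eqxx !orbT.
  lra.
have [g [gf gv gl]] := face_with_root chk ff vf.
have gy : face_pts g y by rewrite (eq_face_pts R gl).
have [k [k1 k2]] := face_comb_lift chk S x gf ff gy fy.
suff [r rd [g' [z [gf' gz e1 e2]]]] : exists2 r, 0 < r <= d & exists g' z, [/\ g' \in faces,
    face_pts g' z, face_comb lat1 g' z = face_comb lat1 g y + r * u1
  & face_comb lat2 g' z = face_comb lat2 g y + r * u2].
  exists r => //; exists g', z, k; split=> //.
    by rewrite e1 k1 addrAC.
  by rewrite e2 k2 addrAC.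
have [w [p [w8 pL gE]]] := mem_faces gf.
have wv : w = v by move: gv; rewrite gE => -[].
subst w; have := weight_sum chk gf gy; rewrite gE /= => ysum.
have y1 := weight_ge0 p.1.1 gy; have y2 := weight_ge0 p.2.1 gy.
have yE lat : face_comb lat (base v, p.1, p.2) y = lat (base v) +
    (weight y p.1.1 * (lat p.1 - lat (base v)) + weight y p.2.1 * (lat p.2 - lat (base v))).
  rewrite /face_comb /=; have -> : weight y v = 1 - weight y p.1.1 - weight y p.2.1.
    by rewrite -ysum; ring.
  by move: (weight _ _) (weight _ _) (lat _) (lat _) (lat _) => *; ring.
rewrite !yE.
have lt1 : weight y p.1.1 + weight y p.2.1 < 1 by lra.
have [y1_gt0|] := ltP 0 (weight y p.1.1); last first.
  move=> y1_le0; have y1E : weight y p.1.1 = 0 by apply/eqP; rewrite eq_le y1_le0.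
  have [y2_gt0|] := ltP 0 (weight y p.2.1); last first.
    move=> y2_le0; have y2E : weight y p.2.1 = 0 by apply/eqP; rewrite eq_le y2_le0.
    (* The point is the vertex [v] itself. *)
    have [q [qL q1 q2]] := link_cone u1 u2 w8.
    by apply: (@cone_step v q _ _ u1 u2 0 0 d) => //; rewrite ?y1E ?y2E ?mul0r ?addr0//; right.
  have [h|h] := leP 0 (u1 * (lat2 p.2 - lat2 (base v)) - u2 * (lat1 p.2 - lat1 (base v))).
    by apply: (@cone_step v p _ _ u1 u2 (weight y p.1.1) (weight y p.2.1) d) => //;
      [right | left].
  (* The point is on the edge from [v] to [p.2] and [u] leaves the face across it: the following
     triangle of the link takes over. *)
  have [q qL qE] := cyclic_pairs_fst (mem_cyclic_pairs pL).2.
  apply: (@cone_step v q _ _ u1 u2 (weight y p.2.1) 0 d) => //;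
    rewrite ?y1E ?qE ?mul0r ?add0r ?addr0//.
  - by lra.
  - by left.
  - by right; move: h; move: (lat1 _) (lat2 _) (lat1 _) (lat2 _) => *; lra.
have [h|h] := leP 0 ((lat1 p.1 - lat1 (base v)) * u2 - (lat2 p.1 - lat2 (base v)) * u1).
  have [y2_gt0|] := ltP 0 (weight y p.2.1).
    by apply: (@cone_step v p _ _ u1 u2 (weight y p.1.1) (weight y p.2.1) d) => //; left.
  by move=> _; apply: (@cone_step v p _ _ u1 u2 (weight y p.1.1) (weight y p.2.1) d) => //;
    [left | right].
have [y2_gt0|y2_le0] := ltP 0 (weight y p.2.1).
  by apply: (@cone_step v p _ _ u1 u2 (weight y p.1.1) (weight y p.2.1) d) => //; left.
have y2E : weight y p.2.1 = 0 by apply/eqP; rewrite eq_le y2_le0.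
(* The mirror case: across the edge from [v] to [p.1] lies the preceding triangle of the link. *)
have [q qL qE] := cyclic_pairs_snd (mem_cyclic_pairs pL).1.
apply: (@cone_step v q _ _ u1 u2 0 (weight y p.1.1) d) => //;
  rewrite ?y2E ?qE ?mul0r ?add0r ?addr0//.
- by lra.
- by right; move: h; move: (lat1 _) (lat2 _) (lat1 _) (lat2 _) => *; lra.
- by left.
Qed.
End Covering.

Section Triangulation.
Variables (R : realType) (links : seq (seq corner)) (S : Z) (x : nat -> R).
Hypothesis chk : combinatorial_check links.
Local Notation faces := (faces links).
Local Notation min_faces := (min_rooted_faces links).
Local Notation lat1 := (lat1 S x).
Local Notation lat2 := (lat2 S x).
Local Notation ori := (ori S x).
Hypothesis ori_gt0 : forall f, f \in faces -> 0 < ori f.1.1 f.1.2 f.2.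
Hypothesis link_spans : forall v, (v < 8)%N -> exists a b c,
  [/\ a \in link links v, b \in link links v & c \in link links v] /\
  [/\ 0 < ori (base v) a b, 0 < ori (base v) b c & 0 < ori (base v) c a].
Hypothesis S_gt0 : 0 < zr R S.
Hypothesis lat_bound : forall f a, f \in min_faces -> a \in corners f ->
  2 * `|lat1 a| < 3 * zr R S /\ 2 * `|lat2 a| < 3 * zr R S.
Hypothesis separated : forall f g o, f \in min_faces -> g \in min_faces ->
  `|zr R o.1| <= 2 -> `|zr R o.2| <= 2 ->
  [\/ f = g /\ o = (Z0, Z0), exists a b, separates S x f g o a b
    | exists a b, separates S x g f (off_opp o) a b].

Lemma face_comb_bound lat f y : f \in min_faces -> face_pts f y ->
  (forall a, a \in corners f -> 2 * `|lat a| < 3 * zr R S) ->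
  2 * `|face_comb lat f y| < 3 * zr R S.
Proof.
move=> mf fy h; have ff := min_rooted_faces_sub mf.
have ysum := weight_sum chk ff fy.
have h0 := h f.1.1 ltac:(by rewrite !inE eqxx).
have h1 := h f.1.2 ltac:(by rewrite !inE eqxx orbT).
have h2 := h f.2 ltac:(by rewrite !inE eqxx !orbT).
pose M := Num.max `|lat f.1.1| (Num.max `|lat f.1.2| `|lat f.2|).
have HM : 2 * M < 3 * zr R S.
  have max_lt u v : 2 * u < 3 * zr R S -> 2 * v < 3 * zr R S -> 2 * Num.max u v < 3 * zr R S.
    by case: (leP u v).
  by rewrite /M !max_lt.
have M0 : `|lat f.1.1| <= M by rewrite le_max lexx.
have M1 : `|lat f.1.2| <= M by rewrite !le_max lexx orbT.
have M2 : `|lat f.2| <= M by rewrite !le_max lexx !orbT.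
apply: le_lt_trans HM; rewrite ler_wpM2l// -[leRHS]mul1r -ysum !mulrDl.
rewrite /face_comb (le_trans (ler_normD _ _))// lerD//; last first.
  by rewrite normrM ger0_norm ?(weight_ge0 _ fy)// ler_wpM2l ?(weight_ge0 _ fy).
rewrite (le_trans (ler_normD _ _))// lerD//.
  by rewrite normrM ger0_norm ?(weight_ge0 _ fy)// ler_wpM2l ?(weight_ge0 _ fy).
by rewrite normrM ger0_norm ?(weight_ge0 _ fy)// ler_wpM2l ?(weight_ge0 _ fy).
Qed.

(** Lifted coordinates are below [3 S / 2] in absolute value, so two faces can meet only after a
    translation by integers below 3 in absolute value. This leaves 25 translations for each pair of
    faces. *)
Lemma small_shift a (p q : R) : 2 * `|p| < 3 * zr R S -> 2 * `|q| < 3 * zr R S ->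
  p = q + zr R S * zr R a -> `|zr R a| <= 2.
Proof.
move=> hp hq pq; have h : zr R S * `|zr R a| < zr R S * 3.
  rewrite -{1}(gtr0_norm S_gt0) -normrM (_ : zr R S * zr R a = p - q);
    last by rewrite pq addrC addKr.
  by rewrite (le_lt_trans (ler_normB _ _))//; lra.
rewrite ltr_pM2l// in h; rewrite -zr_abs (_ : 2 = zr R (Zpos 2))//; apply: zr_le.
rewrite -zr_abs (_ : 3 = zr R (Zpos 3))// in h.
by clear -h; move: h; rewrite /zr ltr_int; lia.
Qed.

Lemma face_comb_inj_mod f g y z (o : Z * Z) : f \in faces -> g \in faces ->
  face_pts f y -> face_pts g z ->
  face_comb lat1 f y = face_comb lat1 g z + zr R S * zr R o.1 ->
  face_comb lat2 f y = face_comb lat2 g z + zr R S * zr R o.2 -> y = z.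
Proof.
move=> ff gg; have [f' mf' fl] := min_rooted chk ff; have [g' mg' gl] := min_rooted chk gg.
have ff' := min_rooted_faces_sub mf'; have gg' := min_rooted_faces_sub mg'.
move=> fy gz; have fy' : face_pts f' y by rewrite (eq_face_pts R fl).
have gz' : face_pts g' z by rewrite (eq_face_pts R gl).
have [k [k1 k2]] := face_comb_lift chk S x ff' ff fy' fy.
have [l [l1 l2]] := face_comb_lift chk S x gg' gg gz' gz.
move=> e1 e2; pose m := off_add (off_add o k) (off_opp l).
have {}e1 : face_comb lat1 f' y = face_comb lat1 g' z + zr R S * zr R m.1.
  by rewrite k1 l1 e1 !(zrD, zrN) /=; move: (face_comb _ _ _) => c; ring.
have {}e2 : face_comb lat2 f' y = face_comb lat2 g' z + zr R S * zr R m.2.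
  by rewrite k2 l2 e2 !(zrD, zrN) /=; move: (face_comb _ _ _) => c; ring.
have m1 : `|zr R m.1| <= 2.
  by apply: small_shift e1; apply: face_comb_bound => // a /lat_bound[].
have m2 : `|zr R m.2| <= 2.
  by apply: small_shift e2; apply: face_comb_bound => // a /lat_bound[].
case: (separated mf' mg' m1 m2) => [[fg m0]|[a [b sep]]|[a [b sep]]].
- move: e1 e2; rewrite m0 !mulr0 !addr0 -fg; apply: (face_comb_inj chk ori_gt0 ff' fy').
  by rewrite fg.
- exact: (separates_inj chk ori_gt0 ff' gg' sep).
- apply/esym; apply: (separates_inj chk ori_gt0 gg' ff' sep) => //.
    by rewrite e1 /= zrN; move: (face_comb _ _ _) => c; ring.
  by rewrite e2 /= zrN; move: (face_comb _ _ _) => c; ring.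
Qed.

Definition face_at (i : 'I_(size faces)) : face := nth (base 0, base 0, base 0) faces i.
Definition vertex_at i (k : 'I_3) : 'I_8 := inord (nth 0%N (labels (face_at i)) k).
(** Division by [S] turns the lattice [S Z^2] of the integer data into the lattice [Z^2] of
    [flat_triangulation]. *)
Definition lift_at (lat : corner -> R) i (k : 'I_3) : R :=
  lat (nth (base 0) (corners (face_at i)) k) / zr R S.

Lemma face_atP i : face_at i \in faces. Proof. exact: mem_nth. Qed.

Lemma face_at_index f : f \in faces -> exists i, face_at i = f.
Proof.
move=> ff; have sz : (index f faces < size faces)%N by rewrite index_mem.
by exists (Ordinal sz); rewrite /face_at nth_index.
Qed.

Lemma mem_face_set i (v : 'I_8) : (v \in face_set vertex_at i) = ((v : nat) \in labels (face_at i)).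
Proof.
have l8 u : u \in labels (face_at i) -> (u < 8)%N := label_lt8 chk (face_atP i).
apply/imsetP/idP => [[k _ ->]|/(nthP 0%N)[k k3 kE]].
  by rewrite inordK ?l8// mem_nth.
by exists (Ordinal k3); rewrite // /vertex_at /= kE inord_val.
Qed.

Lemma face_points_at i : face_points vertex_at i = face_pts (face_at i) :> set 'rV[R]_8.
Proof.
by apply/seteqP; split=> y [y0 y1 h]; split=> // v; move: (h v); rewrite mem_face_set.
Qed.

Lemma bary_at lat i y : bary vertex_at i (lift_at lat i) y = face_comb lat (face_at i) y / zr R S.
Proof.
by rewrite /bary !big_ord_recl big_ord0 /lift_at /face_comb /weight /= addr0 !mulrA !mulrDl addrA.
Qed.

Lemma vertex_at_cover v : exists i, v \in face_set vertex_at i.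
Proof.
have [f ff vf] := vertex_face chk (ltn_ord v); have [i iE] := face_at_index ff.
by exists i; rewrite mem_face_set iE.
Qed.

Lemma flat_triangulation_at :
  flat_triangulation vertex_at (lift_at lat1) (lift_at lat2).
Proof.
have S0 : zr R S != 0 by rewrite lt0r_neq0.
have shift (p q : R) (a : int) : p / zr R S = q / zr R S + a%:~R -> exists b, a%:~R = zr R b /\
    p = q + zr R S * zr R b.
  have [b bE] := int_zr R a; move=> e; exists b; split=> //.
  by rewrite -[p](divfK S0) e mulrDl divfK// bE [_ * zr R S]mulrC.
split.
- move=> i j y; rewrite !face_points_at !bary_at => iy jy.
  have [k [-> ->]] := face_comb_lift chk S x (face_atP i) (face_atP j) iy jy.
  have [a aE] := zr_int R k.1; have [b bE] := zr_int R k.2.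
  by exists a, b; rewrite -aE -bE !mulrDl ![zr R S * _ / _]mulrAC !divff// !mul1r.
- move=> i j y z a b; rewrite !face_points_at !bary_at => iy jz.
  move=> /shift[a' [_ e1]] /shift[b' [_ e2]].
  exact: (@face_comb_inj_mod _ _ _ _ (a', b') (face_atP i) (face_atP j) iy jz).
- apply: covered_all.
    have [f ff _] := vertex_face chk (isT : (0 < 8)%N).
    have [z [fz _]] := @face_point R links chk f 1 0 0 ff ler01 (lexx 0) (
      lexx 0) ltac:(by rewrite !addr0).
    have [i iE] := face_at_index ff.
    exists (bary vertex_at i (lift_at lat1 i) z), (bary vertex_at i (lift_at lat2 i) z).
    by exists i, z, 0, 0; split; rewrite ?addr0// face_points_at iE.
  move=> i y u1 u2 d; rewrite face_points_at !bary_at => iy d0.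
  have [r rd [g [z [k [gg gz e1 e2]]]]] := local_extension chk ori_gt0 link_spans
    (u1 * zr R S) (u2 * zr R S) (face_atP i) iy d0.
  exists r => //; have [j jE] := face_at_index gg.
  have [a aE] := zr_int R k.1; have [b bE] := zr_int R k.2.
  exists j, z, a, b; split; first by rewrite face_points_at jE.
    by rewrite bary_at jE e1 -aE !mulrDl [zr R S * _ / _]mulrAC divff// mul1r mulrA mulfK.
  by rewrite bary_at jE e2 -bE !mulrDl [zr R S * _ / _]mulrAC divff// mul1r mulrA mulfK.
Qed.

End Triangulation.

(** * Embedding in space *)

Section Embedding.
Variables (R : realType) (links : seq (seq corner)) (t S : Z) (x : nat -> R).
Hypothesis chk : combinatorial_check links.
Hypothesis edge0 : forall v a, (v < 8)%N -> a \in link links v ->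
  edge_eq t S x (v, a.1, a.2) = 0.
Local Notation faces := (faces links).
Local Notation min_faces := (min_rooted_faces links).
Local Notation lat1 := (lat1 S x).
Local Notation lat2 := (lat2 S x).
Local Notation ori := (ori S x).
Local Notation position := (position x).
Hypothesis ori_gt0 : forall f, f \in faces -> 0 < ori f.1.1 f.1.2 f.2.
Hypothesis t01 : t = Z0 \/ t = Zpos 1.

Lemma qnorm_eq0 (a b : R) : qnorm t a b = 0 -> a = 0 /\ b = 0.
Proof.
move=> q0; have a2 := sqr_ge0 a; have b2 := sqr_ge0 b; have ab2 := sqr_ge0 (a + b).
have [a20 b20] : a ^+ 2 = 0 /\ b ^+ 2 = 0.
  by move: q0 ab2; rewrite /qnorm !expr2 in a2 b2 *; case: t01 => ->; rewrite ?zr0 ?zr1; split; nra.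
by split; apply/eqP; rewrite -sqrf_eq0 ?a20 ?b20.
Qed.

Definition height (p : R * R * R) (v : nat) : R :=
  p.1.1 * x (3 * v)%N + p.1.2 * x (3 * v).+1 + p.2 * x (3 * v).+2.

Lemma height_pl p (y z : 'rV[R]_8) : pl_map position y = pl_map position z ->
  \sum_v y 0 v * height p v = \sum_v z 0 v * height p v.
Proof.
move=> yz; have E (u : 'rV[R]_8) : \sum_v u 0 v * height p v =
    p.1.1 * (pl_map position u) 0 0 + p.1.2 * (pl_map position u) 0 1 +
    p.2 * (pl_map position u) 0 (inord 2).
  have coord k : (pl_map position u) 0 k = \sum_v u 0 v * position v 0 k.
    by rewrite /pl_map summxE; apply: eq_bigr => v _; rewrite mxE.
  rewrite !coord !mulr_sumr -!big_split; apply: eq_bigr => v _ /=.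
  rewrite !mxE inordK// /height -[x (0 + _)%N]/(x (3 * v)%N) -[x (_ %% _ + _)%N]/(x (3 * v).+1)
    -[x (2 + _)%N]/(x (3 * v).+2).
  by move: (x _) (x _) (x _) => *; ring.
by rewrite !E yz.
Qed.

(** A criterion for faces with a common edge. There [strictly_apart] cannot hold: applied to two
    common vertices in both orders, it would make each strictly higher than the other. *)
Definition coplanar_apart (f g : face) : Prop := exists p d,
  [/\ forall c, c \in labels f -> height p c = height p f.1.1.1,
      height p d != height p f.1.1.1, (d < 8)%N &
      forall w, w \in labels g -> w = d \/ w \in labels f].

Definition strictly_apart (f g : face) : Prop := exists p,
  forall c d, c \in labels f -> d \in labels g -> c = d \/ height p d < height p c.

(** The form vanishes, up to its constant on [f], at all vertices of [g] other than [d]. A common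
    point thus has weight 0 at [d] and belongs to [f], where injectivity on a single face
    decides. *)
Lemma coplanar_apart_sub f g y z : f \in faces -> coplanar_apart f g ->
  face_pts f y -> face_pts g z -> pl_map position y = pl_map position z -> face_pts f z.
Proof.
move=> ff [p [d [hf hd d8 hg]]] [y0 y1 yf] [z0 z1 zg] /(height_pl p) yz.
have : \sum_v y 0 v * (height p v - height p f.1.1.1) =
    \sum_v z 0 v * (height p v - height p f.1.1.1).
  by under eq_bigr do rewrite mulrBr; under [RHS]eq_bigr do rewrite mulrBr;
     rewrite !sumrB -!mulr_suml y1 z1 yz.
rewrite big1 => [|v _]; last first.
  have [vf|vf] := boolP ((v : nat) \in labels f); first by rewrite hf// subrr mulr0.
  by rewrite yf// mul0r.
rewrite (bigD1 (inord d))//= big1 ?addr0 => [|v vd]; last first.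
  have [vg|vg] := boolP ((v : nat) \in labels g); last by rewrite zg// mul0r.
  case: (hg _ vg) => [vE|vf]; last by rewrite hf// subrr mulr0.
  by move: vd; rewrite -val_eqE /= inordK// vE eqxx.
move=> /esym/eqP; rewrite mulf_eq0 subr_eq0 inordK// (negPf hd) orbF => /eqP zd.
split=> // v vf; have [vg|vg] := boolP ((v : nat) \in labels g); last by rewrite zg.
case: (hg _ vg) => [vE|vf']; last by rewrite vf' in vf.
by rewrite -zd; congr (z 0 _); apply: val_inj; rewrite /= inordK.
Qed.

(** The equal heights of the two images make the sum of [y_v z_w (height v - height w)] over all
    pairs vanish, while each term is nonnegative. So [y_v z_w = 0] whenever [v] and [w] differ, and
    both points are the same vertex. *)
Lemma strictly_apart_eq f g y z : strictly_apart f g ->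
  face_pts f y -> face_pts g z -> pl_map position y = pl_map position z -> y = z.
Proof.
move=> [p sep] [y0 y1 yf] [z0 z1 zg] /(height_pl p) yz.
have term_ge0 v w : 0 <= y 0 v * z 0 w * (height p v - height p w).
  have [vf|vf] := boolP ((v : nat) \in labels f); last by rewrite yf// !mul0r.
  have [wg|wg] := boolP ((w : nat) \in labels g); last by rewrite zg// mulr0 mul0r.
  by rewrite !mulr_ge0// subr_ge0; case: (sep _ _ vf wg) => [->|/ltW].
have sum0 : \sum_v \sum_w y 0 v * z 0 w * (height p v - height p w) = 0.
  have -> : \sum_v \sum_w y 0 v * z 0 w * (height p v - height p w) =
      \sum_v (y 0 v * height p v - y 0 v * \sum_w z 0 w * height p w).
    apply: eq_bigr => v _; rewrite -[y 0 v * height p v]mulr1 -z1 !mulr_sumr -sumrB.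
    by apply: eq_bigr => w _; move: (height _ _) (height _ _) => *; ring.
  by rewrite sumrB -mulr_suml y1 mul1r yz subrr.
have term0 v w : y 0 v * z 0 w * (height p v - height p w) = 0.
  move/eqP: sum0; rewrite psumr_eq0 => [/allP/(_ v)|u _]; last exact: sumr_ge0.
  rewrite mem_index_enum => /(_ isT)/implyP/(_ isT); rewrite psumr_eq0// => /allP/(_ w).
  by rewrite mem_index_enum => /(_ isT)/implyP/(_ isT)/eqP.
have yz0 v w : v != w -> y 0 v * z 0 w = 0.
  move=> vw; have [vf|vf] := boolP ((v : nat) \in labels f); last by rewrite yf// mul0r.
  have [wg|wg] := boolP ((w : nat) \in labels g); last by rewrite zg// mulr0.
  have := term0 v w; case: (sep _ _ vf wg) => [/val_inj/eqP|h]; first by rewrite (negPf vw).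
  by move=> /eqP; rewrite mulf_eq0 subr_eq0 (gt_eqF h) orbF => /eqP.
have [v yv] : exists v, y 0 v != 0.
  apply/existsP; apply: contraT; rewrite negb_exists => /forallP y00.
  suff : (1 : R) == 0 by rewrite oner_eq0.
  by rewrite -y1 big1// => v _; apply/eqP; rewrite -[_ == _]negbK.
have zw w : w != v -> z 0 w = 0.
  by rewrite eq_sym => /yz0/eqP; rewrite mulf_eq0 (negPf yv) => /eqP.
have zv : z 0 v = 1 by rewrite -z1 (bigD1 v)//= big1 ?addr0// => w /zw.
have yw w : w != v -> y 0 w = 0 by move=> /yz0; rewrite zv mulr1.
have yv1 : y 0 v = 1 by rewrite -y1 (bigD1 v)//= big1 ?addr0// => w /yw.
by apply/rowP => w; have [->|wv] := eqVneq w v; rewrite ?yv1 ?zv// yw ?zw.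
Qed.

Lemma face_pl_inj f y z : f \in faces -> face_pts f y -> face_pts f z ->
  pl_map position y = pl_map position z -> y = z.
Proof.
move=> ff fy fz yz; have := face_isometry chk edge0 ff fy fz.
rewrite yz subrr dotvE big1 => [/esym/qnorm_eq0[]|k _]; last by rewrite mxE mul0r.
by move=> /subr0_eq e1 /subr0_eq e2; exact: (face_comb_inj chk ori_gt0 ff fy fz e1 e2).
Qed.

Hypothesis apart : forall f g, f \in min_faces -> g \in min_faces -> f != g ->
  [\/ coplanar_apart f g, strictly_apart f g, coplanar_apart g f | strictly_apart g f].

Lemma pl_map_inj :
  {in realization (face_complex (@vertex_at links)) &, injective (pl_map position)}.
Proof.
move=> y z; rewrite !inE !realizationE => -[i _] + [j _] +; rewrite !face_points_at// => iy jz yz.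
have [f mf fl] := min_rooted chk (face_atP i); have [g mg gl] := min_rooted chk (face_atP j).
have ff := min_rooted_faces_sub mf; have gg := min_rooted_faces_sub mg.
have fy : face_pts f y by rewrite (eq_face_pts R fl).
have gz : face_pts g z by rewrite (eq_face_pts R gl).
have [fg|fg] := eqVneq f g; first by apply: (face_pl_inj ff fy) yz; rewrite fg.
case: (apart mf mg fg) => [h|h|h|h].
- exact: (face_pl_inj ff fy (coplanar_apart_sub ff h fy gz yz) yz).
- exact: strictly_apart_eq h fy gz yz.
- apply/esym; exact: (face_pl_inj gg gz (coplanar_apart_sub gg h gz fy (esym yz)) (esym yz)).
- by apply/esym; exact: strictly_apart_eq h gz fy (esym yz).
Qed.

Lemma row_free_col2 (u w : 'rV[R]_3) :
  (forall a b, a *: u + b *: w = 0 -> a = 0 /\ b = 0) -> row_free (col_mx u w).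
Proof.
move=> indep; rewrite -kermx_eq0; apply/eqP/row_matrixP => i; rewrite row0.
have : row i (kermx (col_mx u w)) *m col_mx u w = 0 by rewrite -row_mul mulmx_ker row0.
move: (row i _) => k; rewrite -[k]hsubmxK mul_row_col.
rewrite [lsubmx k]mx11_scalar [rsubmx k]mx11_scalar !mul_scalar_mx => /indep[-> ->].
by rewrite !raddf0 row_mx0.
Qed.

Lemma face_independent f a b : f \in faces ->
  a *: (position (inord f.1.2.1) - position (inord f.1.1.1)) +
  b *: (position (inord f.2.1) - position (inord f.1.1.1)) = 0 -> a = 0 /\ b = 0.
Proof.
move=> ff ab0; have := face_linear_isometry chk edge0 a b ff.
rewrite /= ab0 dotvE big1 => [/esym/qnorm_eq0[e1 e2]|k _]; last by rewrite mxE mul0r.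
exact: det_inj (lt0r_neq0 (ori_gt0 ff)) e1 e2.
Qed.

End Embedding.

(** * Cone angles *)

Section ConeAngle.
Variables (R : realType) (links : seq (seq corner)) (t S : Z) (x : nat -> R).
Hypothesis chk : combinatorial_check links.
Hypothesis edge0 : forall v a, (v < 8)%N -> a \in link links v ->
  edge_eq t S x (v, a.1, a.2) = 0.
Local Notation faces := (faces links).
Local Notation lat1 := (lat1 S x).
Local Notation lat2 := (lat2 S x).
Local Notation ori := (ori S x).
Local Notation position := (position x).
Local Notation complex := (face_complex (@vertex_at links)).
Hypothesis ori_gt0 : forall f, f \in faces -> 0 < ori f.1.1 f.1.2 f.2.
Hypothesis t01 : t = Z0 \/ t = Zpos 1.

Lemma set3_neq (T : finType) (a b c : T) : #|[set a; b; c]%SET| == 3%N ->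
  [/\ a != b, a != c & b != c].
Proof.
move=> card3; split; apply: contraTneq card3 => ->.
- by rewrite finset.setUid cards2; case: (b != c).
- by rewrite finset.setUAC finset.setUid cards2; case: (c != b).
- by rewrite -finset.setUA finset.setUid cards2; case: (a != c).
Qed.

Lemma set3_card (T : finType) (a b c : T) : a != b -> a != c -> b != c ->
  #|[set a; b; c]%SET| = 3%N.
Proof.
move=> ab ac bc; rewrite finset.setUC cardsU1 cards2 ab !inE.
by rewrite ![c == _]eq_sym (negPf ac) (negPf bc).
Qed.

(** Three distinct vertices contained in a face are all of its vertices; rerooting the face at [a]
    exhibits the other two as neighbours in the link, in one of the two orders. *)
Lemma is_triangleP (a b c : 'I_8) : is_triangle complex a b c ->
  exists2 p, p \in cyclic_pairs (link links a) &
    (p.1.1, p.2.1) = (b : nat, c : nat) \/ (p.1.1, p.2.1) = (c : nat, b : nat).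
Proof.
move=> /andP[]; rewrite inE => /andP[_ /existsP[i /fintype.subsetP sub]] card3.
have inf (v : 'I_8) : v \in [set a; b; c]%SET -> (v : nat) \in labels (face_at i).
  by move=> /sub; rewrite mem_face_set.
have [f [ff fa fl]] : exists f, [/\ f \in faces, f.1.1 = base a & labels f =i labels (face_at i)].
  by apply: (face_with_root chk (face_atP i)); apply: inf; rewrite !inE eqxx.
have [v [p [_ pL fE]]] := mem_faces ff.
have va : v = a by move: fa; rewrite fE => -[].
exists p; first by rewrite -va.
have [ab ac bc] := set3_neq card3.
have : (b : nat) \in labels f by rewrite fl inf// !inE eqxx orbT.
have : (c : nat) \in labels f by rewrite fl inf// !inE eqxx !orbT.
rewrite fE va /= !inE ![_ == a :> nat]eq_sym ![(a : nat) == _]val_eqE (negPf ab) (negPf ac) /=.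
move=> /orP hc /orP hb.
case: hb => /eqP hb; case: hc => /eqP hc; rewrite ?hb ?hc; [|by left|by right|];
  by case/eqP: bc; apply: val_inj; rewrite /= hb hc.
Qed.

Lemma is_triangle_link (v : 'I_8) p : p \in cyclic_pairs (link links v) ->
  is_triangle complex v (inord p.1.1) (inord p.2.1).
Proof.
move=> pL; have ff := rooted_mem_faces (ltn_ord v) pL; have [i iE] := face_at_index ff.
have l8 u : u \in labels (face_at i) -> (u < 8)%N := label_lt8 chk (face_atP i).
have lf0 : (v : nat) \in labels (face_at i) by rewrite iE !inE eqxx.
have lf1 : p.1.1 \in labels (face_at i) by rewrite iE !inE eqxx orbT.
have lf2 : p.2.1 \in labels (face_at i) by rewrite iE !inE eqxx !orbT.
have := label_uniq chk (face_atP i); rewrite iE /= !inE negb_or => /and3P[/andP[n1 n2] n3 _].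
rewrite /is_triangle; apply/andP; split.
  rewrite inE; apply/andP; split; first by apply/set0Pn; exists v; rewrite !inE eqxx.
  apply/existsP; exists i; apply/fintype.subsetP => u; rewrite mem_face_set//.
  by rewrite 2!finset.in_setU !finset.in_set1 => /orP[/orP[]|] /eqP -> //; rewrite inordK ?l8.
by apply/eqP/set3_card; rewrite -val_eqE /= ?inordK ?l8.
Qed.

Lemma position_row_free (a b c : 'I_8) : is_triangle complex a b c ->
  row_free (col_mx (position b - position a) (position c - position a)).
Proof.
move=> /is_triangleP[p pL bc]; have ff := rooted_mem_faces (ltn_ord a) pL.
have indep r s := @face_independent _ _ _ _ _ chk edge0 ori_gt0 t01 _ r s ff.
apply: row_free_col2 => r s; case: bc => -[h1 h2].
  by move=> rs; apply: indep; rewrite /= h1 h2 !inord_val.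
by move=> rs; have [] := indep s r; rewrite //= h1 h2 !inord_val addrC.
Qed.

(** The index pair under which [cone_angle] counts the triangle. That these are distinct along a
    link means that no triangle is repeated there. *)
Definition sorted_labels (p : corner * corner) : nat * nat :=
  (minn p.1.1 p.2.1, maxn p.1.1 p.2.1).

Lemma angleC (k : nat) (p a b : 'rV[R]_k) : angle p a b = angle p b a.
Proof. by rewrite /angle dotvC mulrC [X in _ / X]mulrC mulrC. Qed.

Lemma cone_angleE (v : 'I_8) : uniq [seq sorted_labels p | p <- cyclic_pairs (link links v)] ->
  cone_angle complex position v = \sum_(p <- cyclic_pairs (link links v))
    angle (position v) (position (inord p.1.1)) (position (inord p.2.1)).
Proof.
move=> uq; rewrite /cone_angle pair_big_dep /=.
pose g (p : corner * corner) : 'I_8 * 'I_8 :=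
  (inord (sorted_labels p).1, inord (sorted_labels p).2).
have lt8 p : p \in cyclic_pairs (link links v) -> [/\ p.1.1 != p.2.1, p.1.1 < 8 & p.2.1 < 8]%N.
  move=> pL; have ff := rooted_mem_faces (ltn_ord v) pL.
  have := label_uniq chk ff; rewrite /= !inE negb_or => /and3P[_ n3 _]; split=> //;
  by apply: (label_lt8 chk ff); rewrite !inE eqxx ?orbT.
have guq : uniq [seq g p | p <- cyclic_pairs (link links v)].
  have -> : [seq g p | p <- cyclic_pairs (link links v)] = [seq (inord q.1, inord q.2) |
      q <- [seq sorted_labels p | p <- cyclic_pairs (link links v)]] by rewrite -map_comp.
  rewrite map_inj_in_uniq// => _ _ /mapP[p pL ->] /mapP[r rL ->] [].
  have [_ p1 p2] := lt8 p pL; have [_ r1 r2] := lt8 r rL.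
  move=> /(congr1 val) + /(congr1 val); rewrite /= !inordK ?gtn_max ?gtn_min ?p1 ?p2 ?r1 ?r2//.
  by rewrite /sorted_labels => -> ->.
transitivity (\sum_(i in [seq g p | p <- cyclic_pairs (link links v)])
    angle (position v) (position i.1) (position i.2)).
  apply: eq_bigl => -[a b] /=; apply/andP/mapP => [[ab /is_triangleP[p pL h]]|[p pL [-> ->]]].
    exists p => //; rewrite /g /sorted_labels; case: h => -[-> ->].
      by rewrite (minn_idPl (ltnW ab)) (maxn_idPr (ltnW ab)) !inord_val.
    by rewrite (minn_idPr (ltnW ab)) (maxn_idPl (ltnW ab)) !inord_val.
  have [n12 p1 p2] := lt8 p pL; have tri := is_triangle_link pL.
  have m8 : (minn p.1.1 p.2.1 < 8)%N by rewrite gtn_min p1.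
  have M8 : (maxn p.1.1 p.2.1 < 8)%N by rewrite gtn_max p1.
  rewrite !inordK//; split; first by move: n12; clear; move: p.1.1 p.2.1 => i j; lia.
  case: (leqP p.1.1 p.2.1) => // _; move: tri.
  by rewrite /is_triangle finset.setUAC.
rewrite -big_uniq//= big_map; apply: eq_big_seq => p pL; rewrite /g /sorted_labels /=.
by case: (leqP p.1.1 p.2.1) => // _; rewrite angleC.
Qed.

Variables (cs sn : R).
Hypothesis cs_t : 2 * cs = zr R t.
Hypothesis cs_sn : cs ^+ 2 + sn ^+ 2 = 1.
Hypothesis sn_gt0 : 0 < sn.

(* Lattice coordinates refer to the basis 1, cs + i sn of the plane. *)
Definition planar (v : nat) (a : corner) : R * R :=
  (lat1 a - lat1 (base v) + cs * (lat2 a - lat2 (base v)), sn * (lat2 a - lat2 (base v))).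

Lemma dot2_planar v a b : dot2 (planar v a) (planar v b) =
  (lat1 a - lat1 (base v)) * (lat1 b - lat1 (base v)) +
  cs * ((lat1 a - lat1 (base v)) * (lat2 b - lat2 (base v)) +
        (lat2 a - lat2 (base v)) * (lat1 b - lat1 (base v))) +
  (lat2 a - lat2 (base v)) * (lat2 b - lat2 (base v)).
Proof.
rewrite /dot2 /planar /=.
move: (lat1 a - _) (lat2 a - _) (lat1 b - _) (lat2 b - _) => A1 A2 B1 B2.
have -> : A2 * B2 = (cs ^+ 2 + sn ^+ 2) * (A2 * B2) by rewrite cs_sn mul1r.
ring.
Qed.

Lemma det2_planar (v : 'I_8) a b : det2 (planar v a) (planar v b) = sn * ori (base v) a b.
Proof.
rewrite /det2 /planar /ori /=.
move: (lat1 a - _) (lat2 a - _) (lat1 b - _) (lat2 b - _) => A1 A2 B1 B2; ring.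
Qed.

Lemma angle_planar (v : 'I_8) p : p \in cyclic_pairs (link links v) ->
  angle (position v) (position (inord p.1.1)) (position (inord p.2.1)) =
  ang2 (planar v p.1) (planar v p.2).
Proof.
move=> pL; have ff := rooted_mem_faces (ltn_ord v) pL.
have iso d1 d2 := face_linear_isometry chk edge0 d1 d2 ff; rewrite /= inord_val in iso.
move: iso; rewrite /angle /ang2 /norm2 /len2 !dot2_planar.
set u := position (inord p.1.1) - _; set w := position (inord p.2.1) - _.
set A1 := lat1 p.1 - _; set A2 := lat2 p.1 - _; set B1 := lat1 p.2 - _; set B2 := lat2 p.2 - _.
clearbody u w A1 A2 B1 B2 => iso.
have uu : dotv u u = A1 * A1 + cs * (A1 * A2 + A2 * A1) + A2 * A2.
  have := iso 1 0; rewrite !scale1r !scale0r !addr0 !mul1r !mul0r !addr0 => ->.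
  by rewrite /qnorm -cs_t; ring.
have ww : dotv w w = B1 * B1 + cs * (B1 * B2 + B2 * B1) + B2 * B2.
  have := iso 0 1; rewrite !scale1r !scale0r !add0r !mul1r !mul0r !add0r => ->.
  by rewrite /qnorm -cs_t; ring.
(* Polarization: the inner product is recovered from the squared lengths of [u], [w] and [u + w]. *)
have uw : dotv u w = A1 * B1 + cs * (A1 * B2 + A2 * B1) + A2 * B2.
  have := iso 1 1; rewrite !scale1r !mul1r dotvDl !dotvDr uu ww (dotvC w u) /qnorm -cs_t => h.
  apply: (@mulfI _ 2); first by rewrite pnatr_eq0.
  rewrite -[LHS](_ : A1 * A1 + cs * (A1 * A2 + A2 * A1) + A2 * A2 + dotv u w +
    (dotv u w + (B1 * B1 + cs * (B1 * B2 + B2 * B1) + B2 * B2)) -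
    (A1 * A1 + cs * (A1 * A2 + A2 * A1) + A2 * A2) -
    (B1 * B1 + cs * (B1 * B2 + B2 * B1) + B2 * B2) = _); last by move: (dotv u w) => d; ring.
  by rewrite h; ring.
by rewrite uu ww uw.
Qed.

Hypothesis crossing : forall v, (v < 8)%N ->
  count (fun p => (lat2 p.1 - lat2 (base v) < 0) && (0 <= lat2 p.2 - lat2 (base v)))
    (cyclic_pairs (link links v)) = 1%N.

Lemma cone_angle_2pi (v : 'I_8) :
  uniq [seq sorted_labels p | p <- cyclic_pairs (link links v)] ->
  cone_angle complex position v = 2 * pi.
Proof.
move=> /cone_angleE ->; rewrite (eq_big_seq _ (@angle_planar v)).
have pairsE : zip (map (planar v) (link links v)) (rot 1 (map (planar v) (link links v))) =
    [seq (planar v p.1, planar v p.2) | p <- cyclic_pairs (link links v)].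
  rewrite -map_rot /cyclic_pairs; move: (link links v) (rot 1 _).
  by elim=> [|a r IH] [|b r'] //=; rewrite IH.
rewrite -(@sum_ang2_cycle R (map (planar v) (link links v))) pairsE.
- by rewrite big_map.
- rewrite all_map; apply/allP => p pL /=; rewrite det2_planar mulr_gt0//.
  exact: ori_gt0 (rooted_mem_faces (ltn_ord v) pL).
- rewrite count_map -[RHS](crossing (ltn_ord v)); apply: eq_count => p /=.
  by rewrite pmulr_rlt0// pmulr_rge0.
Qed.

End ConeAngle.

(** * Verification by interval arithmetic *)

Fixpoint upper_pairs (T : Type) (s : seq T) : seq (T * T) :=
  if s is a :: s' then [seq (a, b) | b <- s'] ++ upper_pairs s' else [::].

Lemma mem_upper_pairs (T : eqType) (s : seq T) a b : a \in s -> b \in s -> a != b ->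
  (a, b) \in upper_pairs s \/ (b, a) \in upper_pairs s.
Proof.
elim: s => //= c s IH; rewrite !inE !mem_cat => /predU1P[->|a_s] /predU1P[->|b_s].
- by rewrite eqxx.
- by left; rewrite map_f.
- by right; rewrite map_f.
- by move=> /(IH a_s b_s)[->|->]; rewrite orbT; [left | right].
Qed.

(* Integer interval arithmetic on the box of radius 1 around c. *)
Section Checks.
Variables (links : seq (seq corner)) (S : Z) (c : nat -> Z).
Local Notation faces := (faces links).
Local Notation min_faces := (min_rooted_faces links).

Definition box (z : Z) : zitv := (Z.sub z (Zpos 1), Z.add z (Zpos 1)).
Definition lat1Z (a : corner) : zitv := box (Z.add (c (24 + 2 * a.1)%N) (Z.mul S a.2.1)).
Definition lat2Z (a : corner) : zitv := box (Z.add (c (25 + 2 * a.1)%N) (Z.mul S a.2.2)).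

(* The determinant of the centres, with an error bound for differences off by at most 2. *)
Definition oriZ (a b d : corner) : zitv :=
  let u k := Z.sub (c (k + 2 * b.1)%N) (c (k + 2 * a.1)%N) in
  let w k := Z.sub (c (k + 2 * d.1)%N) (c (k + 2 * a.1)%N) in
  let u1 := Z.add (u 24%N) (Z.mul S (Z.sub b.2.1 a.2.1)) in
  let u2 := Z.add (u 25%N) (Z.mul S (Z.sub b.2.2 a.2.2)) in
  let w1 := Z.add (w 24%N) (Z.mul S (Z.sub d.2.1 a.2.1)) in
  let w2 := Z.add (w 25%N) (Z.mul S (Z.sub d.2.2 a.2.2)) in
  let m := Z.sub (Z.mul u1 w2) (Z.mul u2 w1) in
  let e := Z.mul (Zpos 2) (Z.add (Z.add (Z.add (Z.abs u1) (Z.abs u2))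
    (Z.add (Z.abs w1) (Z.abs w2))) (Zpos 4)) in
  (Z.sub m e, Z.add m e).

Definition zi_pos (i : zitv) : bool := Z.ltb Z0 i.1.
Definition zi_neg (i : zitv) : bool := Z.ltb i.2 Z0.

Definition orientation_check : bool := all (fun f => zi_pos (oriZ f.1.1 f.1.2 f.2)) faces.

Definition link_check : bool := all (fun v =>
  has (fun a => has (fun b => zi_pos (oriZ (base v) a b) &&
    has (fun d => zi_pos (oriZ (base v) b d) && zi_pos (oriZ (base v) d a)) (link links v))
  (link links v)) (link links v)) (iota 0 8).

Definition crossing_check : bool := all (fun v =>
  let h a := zi_sub (lat2Z a) (lat2Z (base v)) in
  [&& all (fun a => zi_pos (h a) || zi_neg (h a)) (link links v),
      count (fun p => zi_neg (h p.1) && zi_pos (h p.2)) (cyclic_pairs (link links v)) == 1%N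
    & uniq [seq sorted_labels p | p <- cyclic_pairs (link links v)]]) (iota 0 8).

Definition small (i : zitv) : bool :=
  Z.ltb (Z.mul 2 i.2) (Z.mul 3 S) && Z.ltb (Z.opp (Z.mul 3 S)) (Z.mul 2 i.1).

Definition bound_check : bool := all (fun f => all (fun a =>
  small (lat1Z a) && small (lat2Z a)) (corners f)) min_faces.

(** Only the lines along the edges of [f] are tried. A corner shared with such an edge has
    determinant exactly 0, which no interval can certify; it is recognized as the same corner
    instead. *)
Definition separates_check (f g : face) (o : Z * Z) : bool :=
  has (fun p => all (fun d => (translate d o \in [:: p.1; p.2]) ||
      zi_neg (oriZ p.1 p.2 (translate d o))) (corners g)) (cyclic_pairs (corners f)).

Definition separation_check : bool :=
  let r := [:: Zneg 2; Zneg 1; Z0; Zpos 1; Zpos 2] in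
  all (fun f => all (fun g => all (fun i => all (fun j =>
    [|| (f == g) && ((i, j) == (Z0, Z0)), separates_check f g (i, j)
      | separates_check g f (off_opp (i, j))]) r) r) min_faces) min_faces.

Definition spaceZ (u v k : nat) : zitv := zi_sub (box (c (k + 3 * u)%N)) (box (c (k + 3 * v)%N)).

(** Encloses six times the signed volume of the tetrahedron [u v w z]. *)
Definition det3Z (u v w z : nat) : zitv :=
  let m i j k := zi_mul (spaceZ z u i) (zi_sub (zi_mul (spaceZ v u j) (spaceZ w u k))
                                               (zi_mul (spaceZ v u k) (spaceZ w u j))) in
  zi_add (zi_add (m 0 1 2) (m 1 2 0)) (m 2 0 1)%N.

Definition coplanar_check (f g : face) : bool :=
  has (fun d => all (fun w => (w == d) || (w \in labels f)) (labels g) &&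
    (zi_pos (det3Z f.1.1.1 f.1.2.1 f.2.1 d) || zi_neg (det3Z f.1.1.1 f.1.2.1 f.2.1 d)))
  (labels g).

Definition strict_check (p : Z * Z * Z) (f g : face) : bool :=
  all (fun u => all (fun v => (u == v) || zi_pos (zi_add (zi_add
    (zi_mul (p.1.1, p.1.1) (spaceZ u v 0)) (zi_mul (p.1.2, p.1.2) (spaceZ u v 1)))
    (zi_mul (p.2, p.2) (spaceZ u v 2)))) (labels g)) (labels f).

Definition apart_check (certs : seq (Z * Z * Z)) : bool :=
  let ps := upper_pairs min_faces in
  (size certs == size ps) && all (fun q =>
    coplanar_check q.1.1 q.1.2 || strict_check q.2 q.1.1 q.1.2)
    (zip ps certs).

Definition embedding_check (certs : seq (Z * Z * Z)) : bool :=
  [&& Z.ltb Z0 S, orientation_check, link_check, crossing_check & [&& bound_check,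
    separation_check & apart_check certs]].

Variables (R : realType) (x : nat -> R).
Hypothesis chk : combinatorial_check links.
Hypothesis x_box : forall k, `|x k - zr R (c k)| <= 1.

Lemma inzi_box k : inzi (box (c k)) (x k).
Proof. by have := x_box k; rewrite ler_distl /inzi /= zrB zrD zr1 => /andP[]; split. Qed.

Lemma inzi_shift i z (w : R) : inzi (box i) w -> inzi (box (Z.add i z)) (w + zr R z).
Proof. by rewrite /inzi /= !(zrB, zrD); lra. Qed.

Lemma inzi_lat1 a : inzi (lat1Z a) (lat1 S x a).
Proof. by apply: inzi_shift; exact: inzi_box. Qed.

Lemma inzi_lat2 a : inzi (lat2Z a) (lat2 S x a).
Proof. by apply: inzi_shift; exact: inzi_box. Qed.

(** A difference of two coordinates of the box is off by at most 2. The two products of a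
    determinant then give the error bound [e] of [oriZ], namely twice the sum of the four absolute
    values, plus 8. *)
Lemma mul_perturb (u w U W : R) : `|u - U| <= 2 -> `|w - W| <= 2 ->
  `|u * w - U * W| <= 2 * (`|U| + `|W|) + 4.
Proof.
move=> hu hw; have -> : u * w - U * W = (u - U) * (w - W) + U * (w - W) + (u - U) * W by ring.
have h1 : `|(u - U) * (w - W)| <= 4 by rewrite normrM (_ : 4 = 2 * 2) ?ler_pM//; ring.
have h2 : `|U * (w - W)| <= `|U| * 2 by rewrite normrM ler_wpM2l.
have h3 : `|(u - U) * W| <= 2 * `|W| by rewrite normrM ler_wpM2r.
have := ler_normD ((u - U) * (w - W) + U * (w - W)) ((u - U) * W).
have := ler_normD ((u - U) * (w - W)) (U * (w - W)); lra.
Qed.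

Lemma diff_box i j z z' : `|x i + zr R (Z.mul S z) - (x j + zr R (Z.mul S z')) -
  zr R (Z.add (Z.sub (c i) (c j)) (Z.mul S (Z.sub z z')))| <= 2.
Proof.
have -> : x i + zr R (Z.mul S z) - (x j + zr R (Z.mul S z')) -
    zr R (Z.add (Z.sub (c i) (c j)) (Z.mul S (Z.sub z z'))) =
    (x i - zr R (c i)) - (x j - zr R (c j)) by rewrite !(zrD, zrB, zrM); ring.
by have := ler_normB (x i - zr R (c i)) (x j - zr R (c j)); have := x_box i; have := x_box j; lra.
Qed.

Lemma inzi_ball m e (w : R) : `|w - zr R m| <= zr R e -> inzi (Z.sub m e, Z.add m e) w.
Proof. by rewrite ler_distl /inzi /= zrB zrD => /andP[]; split. Qed.

Lemma inzi_ori a b d : inzi (oriZ a b d) (ori S x a b d).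
Proof.
rewrite /oriZ.
set u1 := Z.add _ (Z.mul S (Z.sub b.2.1 _)); set u2 := Z.add _ (Z.mul S (Z.sub b.2.2 _)).
set w1 := Z.add _ (Z.mul S (Z.sub d.2.1 _)); set w2 := Z.add _ (Z.mul S (Z.sub d.2.2 _)).
have h1 : `|lat1 S x b - lat1 S x a - zr R u1| <= 2 by exact: diff_box.
have h2 : `|lat2 S x b - lat2 S x a - zr R u2| <= 2 by exact: diff_box.
have h3 : `|lat1 S x d - lat1 S x a - zr R w1| <= 2 by exact: diff_box.
have h4 : `|lat2 S x d - lat2 S x a - zr R w2| <= 2 by exact: diff_box.
clearbody u1 u2 w1 w2.
apply: inzi_ball; rewrite !(zrB, zrD, zrM, zr_abs) (_ : zr R (Zpos 2) = 2)// (_ : zr R (Zpos 4) =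
  4)//.
have subACA (p q P Q : R) : p - q - (P - Q) = (p - P) - (q - Q) by ring.
have e1 := mul_perturb h1 h4; have e2 := mul_perturb h2 h3; rewrite /ori subACA.
by rewrite (le_trans (ler_normB _ _))//; lra.
Qed.

Lemma zi_posP i (w : R) : inzi i w -> zi_pos i -> 0 < w.
Proof. by move=> [h _] /(@zr_lt R)/lt_le_trans; apply. Qed.

Lemma zi_negP i (w : R) : inzi i w -> zi_neg i -> w < 0.
Proof. by move=> [_ h] /(@zr_lt R); apply: le_lt_trans. Qed.

Lemma orientation_checkP : orientation_check -> forall f, f \in faces ->
  0 < ori S x f.1.1 f.1.2 f.2.
Proof. by move=> /allP h f /h; apply: zi_posP; exact: inzi_ori. Qed.

Lemma link_checkP : link_check -> forall v, (v < 8)%N -> exists a b d,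
  [/\ a \in link links v, b \in link links v & d \in link links v] /\
  [/\ 0 < ori S x (base v) a b, 0 < ori S x (base v) b d & 0 < ori S x (base v) d a].
Proof.
move=> /allP h v v8; have /hasP[a al /hasP[b bl /andP[ab /hasP[d dl /andP[bd da]]]]] :=
  h v ltac:(by rewrite mem_iota).
by exists a, b, d; split=> //; split; apply: (zi_posP (inzi_ori _ _ _)).
Qed.

(** No link vector has second coordinate 0 anywhere in the box, so the signs, and with them the
    number of crossings, can be read off the intervals. *)
Lemma crossing_checkP : crossing_check -> forall v, (v < 8)%N ->
  count (fun p => (lat2 S x p.1 - lat2 S x (base v) < 0) && (0 <= lat2 S x p.2 - lat2 S x (base v)))
    (cyclic_pairs (link links v)) = 1%N /\
  uniq [seq sorted_labels p | p <- cyclic_pairs (link links v)].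
Proof.
move=> /allP h v v8; have /and3P[/allP sg /eqP cnt uq] := h v ltac:(by rewrite mem_iota).
split=> //; rewrite -[RHS]cnt; apply: eq_in_count => p /mem_cyclic_pairs[p1 p2].
have hP a : inzi (zi_sub (lat2Z a) (lat2Z (base v))) (lat2 S x a - lat2 S x (base v)).
  by apply: zi_subP; exact: inzi_lat2.
have pos := zi_posP (hP _); have neg := zi_negP (hP _).
have E1 : (lat2 S x p.1 - lat2 S x (base v) < 0) = zi_neg (zi_sub (lat2Z p.1) (lat2Z (base v))).
  apply/idP/idP => [lt0|/neg//]; case/orP: (sg _ p1) => // /pos.
  by move=> /(lt_trans lt0); rewrite ltxx.
have E2 : (0 <= lat2 S x p.2 - lat2 S x (base v)) = zi_pos (zi_sub (lat2Z p.2) (lat2Z (base v))).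
  apply/idP/idP => [ge0|/pos/ltW//]; case/orP: (sg _ p2) => // /neg.
  by move=> /(le_lt_trans ge0); rewrite ltxx.
by rewrite E1 E2.
Qed.

Lemma smallP i (w : R) : inzi i w -> small i -> 2 * `|w| < 3 * zr R S.
Proof.
move=> [h1 h2] /andP[/(@zr_lt R) + /(@zr_lt R)]; rewrite !(zrN, zrM).
rewrite (_ : zr R 2 = 2)// (_ : zr R 3 = 3)// => l1 l2.
by case: (ler0P w); lra.
Qed.

Lemma bound_checkP : bound_check -> forall f a, f \in min_faces -> a \in corners f ->
  2 * `|lat1 S x a| < 3 * zr R S /\ 2 * `|lat2 S x a| < 3 * zr R S.
Proof.
move=> /allP h f a /h/allP{}h /h/andP[h1 h2].
by split; [exact: smallP (inzi_lat1 a) h1 | exact: smallP (inzi_lat2 a) h2].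
Qed.

Lemma ori_same a b : ori S x a b a = 0 /\ ori S x a b b = 0.
Proof. by rewrite /ori; move: (lat1 _ _ _) (lat2 _ _ _) (lat1 _ _ _) (lat2 _ _ _) => *; split;
  ring. Qed.

Lemma ori_rot a b d : ori S x b d a = ori S x a b d.
Proof.
rewrite /ori; move: (lat1 _ _ _) (lat2 _ _ _) (lat1 _ _ _) (lat2 _ _ _).
by move: (lat1 _ _ _) (lat2 _ _ _) => *; ring.
Qed.

Lemma separates_checkP f g o : orientation_check -> f \in faces -> separates_check f g o ->
  exists a b, separates S x f g o a b.
Proof.
move=> /orientation_checkP/[apply] f0 /hasP[p pf /allP h]; exists p.1, p.2.
have [pc1 pc2] := mem_cyclic_pairs pf; have [e1 e2] := ori_same p.1 p.2.
split=> // [d|d /h/orP[]].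
- move: pf; rewrite /cyclic_pairs !inE /= => /or3P[] /eqP -> /or3P[] /eqP -> /=;
    rewrite ?(ori_same _ _).1 ?(ori_same _ _).2 ?(ltW f0)//.
    by rewrite ori_rot ltW.
  by rewrite ori_rot ori_rot ltW.
- by rewrite mem_seq2 => /orP[] /eqP ->; left; rewrite ?e1 ?e2.
- by move=> /(zi_negP (inzi_ori _ _ _)); right.
Qed.

Lemma separation_checkP : orientation_check -> separation_check ->
  forall f g o, f \in min_faces -> g \in min_faces ->
  `|zr R o.1| <= 2 -> `|zr R o.2| <= 2 ->
  [\/ f = g /\ o = (Z0, Z0), exists a b, separates S x f g o a b
    | exists a b, separates S x g f (off_opp o) a b].
Proof.
move=> oc /allP h f g [i j] mf mg /= i2 j2.
have r z : `|zr R z| <= 2 -> z \in [:: Zneg 2; Zneg 1; Z0; Zpos 1; Zpos 2].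
  rewrite -zr_abs (_ : 2 = zr R 2)// /zr ler_int => z2.
  have [->|[->|[->|[->|->]]]] // : z = Zneg 2 \/ z = Zneg 1 \/ z = Z0 \/ z = Zpos 1 \/ z = Zpos 2.
  by clear -z2; lia.
have /or3P[/andP[/eqP -> /eqP ->]|s|s] := allP (allP (allP (h f mf) g mg) i (r i i2)) j (r j j2).
- by constructor 1.
- by constructor 2; apply: separates_checkP s => //; exact: min_rooted_faces_sub.
- by constructor 3; apply: separates_checkP s => //; exact: min_rooted_faces_sub.
Qed.

Lemma inzi_space u v k : inzi (spaceZ u v k) (x (k + 3 * u)%N - x (k + 3 * v)%N).
Proof. by apply: zi_subP; exact: inzi_box. Qed.

Lemma coplanar_checkP f g : (forall d, d \in labels g -> (d < 8)%N) ->
  coplanar_check f g -> coplanar_apart x f g.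
Proof.
move=> l8 /hasP[d dg /andP[/allP sub dv]].
pose u k := x (k + 3 * f.1.2.1)%N - x (k + 3 * f.1.1.1)%N.
pose w k := x (k + 3 * f.2.1)%N - x (k + 3 * f.1.1.1)%N.
(* The form is the cross product of two edges of [f] at the exact solution: only an exact normal is
   constant on [f]. *)
exists (u 1%N * w 2%N - u 2%N * w 1%N, u 2%N * w 0%N - u 0%N * w 2%N,
  u 0%N * w 1%N - u 1%N * w 0%N), d.
split.
- move=> v; rewrite !inE /height /u /w !add0n !add1n !add2n /= => /or3P[] /eqP -> //;
    move: (x _) (x _) (x _) (x _) (x _) (x _) (x _) (x _) (x _) => *; ring.
- rewrite -subr_eq0; set h := _ - _.
  have hI : inzi (det3Z f.1.1.1 f.1.2.1 f.2.1 d) h.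
    have -> : h = (x (0 + 3 * d)%N - x (0 + 3 * f.1.1.1)%N) * (u 1%N * w 2%N - u 2%N * w 1%N) +
      (x (1 + 3 * d)%N - x (1 + 3 * f.1.1.1)%N) * (u 2%N * w 0%N - u 0%N * w 2%N) +
      (x (2 + 3 * d)%N - x (2 + 3 * f.1.1.1)%N) * (u 0%N * w 1%N - u 1%N * w 0%N).
      rewrite /h /height /= !add0n !add1n !add2n.
      by move: (u 1%N * w 2%N - _) (u 2%N * w 0%N - _) (u 0%N * w 1%N - _) => *; ring.
    by apply: zi_addP; [apply: zi_addP|]; apply: zi_mulP; (exact: inzi_space ||
      (apply: zi_subP; apply: zi_mulP; exact: inzi_space)).
  by case/orP: dv => [/(zi_posP hI)/lt0r_neq0|/(zi_negP hI)/ltr0_neq0].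
- exact: l8.
- by move=> v /sub/orP[/eqP|]; [left | right].
Qed.

Lemma strict_checkP p f g : strict_check p f g -> strictly_apart x f g.
Proof.
move=> /allP h; exists (zr R p.1.1, zr R p.1.2, zr R p.2) => u v uf vg.
have /orP[/eqP|pos] := allP (h u uf) v vg; [by left | right].
rewrite -subr_gt0.
have const z : inzi (z, z) (zr R z) by split.
have := zi_addP (zi_addP (zi_mulP (const p.1.1) (inzi_space u v 0))
  (zi_mulP (const p.1.2) (inzi_space u v 1))) (zi_mulP (const p.2) (inzi_space u v 2)).
move=> /zi_posP/(_ pos); congr (_ < _); rewrite /height /= !add0n !add1n !add2n.
by move: (x _) (x _) (x _) (x _) (x _) (x _) => *; ring.
Qed.

Lemma apart_checkP certs : apart_check certs -> forall f g, f \in min_faces -> g \in min_faces ->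
  f != g -> [\/ coplanar_apart x f g, strictly_apart x f g, coplanar_apart x g f
              | strictly_apart x g f].
Proof.
move=> /andP[/eqP sz /allP h] f g mf mg fg.
have l8 e : e \in min_faces -> forall d, d \in labels e -> (d < 8)%N.
  by move=> /min_rooted_faces_sub ee d; exact: (label_lt8 chk ee).
have pairP q : q \in upper_pairs min_faces ->
  exists p, coplanar_check q.1 q.2 || strict_check p q.1 q.2.
  rewrite -{1}(unzip1_zip (eq_leq (esym sz))) => /mapP[r /h + ->]; by exists r.2.
case: (mem_upper_pairs mf mg fg) => /pairP[p /orP[]].
- by move=> /(coplanar_checkP (l8 g mg)); constructor 1.
- by move=> /strict_checkP; constructor 2.
- by move=> /(coplanar_checkP (l8 f mf)); constructor 3.
- by move=> /strict_checkP; constructor 4.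
Qed.
End Checks.

(** * From verified data to a realized torus *)

Section Realized.
Variables (R : realType) (links : seq (seq corner)) (t S : Z) (c : nat -> Z).
Variables (sel : seq nat) (Nm : seq (seq Z)) (D : Z) (certs : seq (Z * Z * Z)).

Definition valid : bool :=
  [&& combinatorial_check links,
      newton_check t S (size (edges links)) (edges links) c sel Nm D
    & embedding_check links S c certs].

Lemma mem_edges v a : combinatorial_check links -> (v < 8)%N -> a \in link links v ->
  (v, a.1, a.2) \in edges links \/ (a.1, v, off_opp a.2) \in edges links.
Proof.
move=> chk v8 al; have [p pL pa] := cyclic_pairs_fst al.
have ff := rooted_mem_faces v8 pL.
have a8 : (a.1 < 8)%N by rewrite -pa; apply: (label_lt8 chk ff); rewrite !inE eqxx orbT.
have := label_uniq chk ff; rewrite /= !inE negb_or pa => /andP[/andP[va _] _].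
have edgeP u b : (u < 8)%N -> b \in link links u -> (u < b.1)%N -> (u, b.1, b.2) \in edges links.
  move=> u8 bl ub; apply/flattenP; exists [seq (u, b.1, b.2) | b <- link links u & (u < b.1)%N].
    by apply/mapP; exists u; rewrite // mem_iota.
  by apply/mapP; exists b; rewrite // mem_filter ub.
case: (ltngtP v a.1) va => // [va|av] _; first by left; exact: edgeP.
right; have /and5P[_ _ _ _ /allP/(_ v)] := chk; rewrite mem_iota v8 => /(_ isT)/allP/(_ a al).
by move=> /(edgeP _ _ a8)/=; apply.
Qed.

Lemma valid_realized (cs sn : R) : valid -> 2 * cs = zr R t -> cs ^+ 2 + sn ^+ 2 = 1 ->
  0 < sn -> realized 8 (cs +i* sn).
Proof.
move=> /and3P[chk nw emb] cs_t cs_sn sn_gt0.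
have [x [x_box xeq]] := newton_solution R nw.
have t01 : t = Z0 \/ t = Zpos 1.
  by have /and5P[/orP[]/Z.eqb_spec h _ _ _ _] := nw; [left | right].
have /and5P[S0 oc lc cc /and3P[bc sc ac]] := emb.
have {S0}S_gt0 : 0 < zr R S := zr_lt R S0.
have edge0 v a : (v < 8)%N -> a \in link links v -> edge_eq t S x (v, a.1, a.2) = 0.
  move=> v8 al; have edgeE e : e \in edges links -> edge_eq t S x e = 0.
    by move=> /(nthP (0, 0, (Z0, Z0))%N)[k k24 <-]; exact: xeq.
  case: (mem_edges chk v8 al) => /edgeE// <-.
  (* Seen from its other end, an edge has all its differences negated, which quadratic forms
     ignore. *)
  by rewrite /edge_eq /= !(zrM, zrN);
    move: (x _) (x _) (x _) (x _) (x _) (x _) (x _) (x _) (x _) (x _) => *; ring.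
have ori_gt0 := orientation_checkP x_box oc.
have spans := link_checkP x_box lc.
have cross := crossing_checkP x_box cc.
have bound := bound_checkP x_box bc.
have sep := separation_checkP x_box oc sc.
have apart := apart_checkP chk x_box ac.
have flatT := flat_triangulation_at chk ori_gt0 spans S_gt0 bound sep.
have plI := pl_map_inj chk edge0 ori_gt0 t01 apart.
have S0 : zr R S != 0 := lt0r_neq0 S_gt0; have sn0 : sn != 0 := lt0r_neq0 sn_gt0.
(* The lattice is fixed in advance, so [v2 / v1] is exactly [tau], although [x] is only known to
   exist in the box. *)
pose tau : R[i] := cs +i* sn; pose v1 : R[i] := (zr R S)%:C; pose v2 : R[i] := v1 * tau.
have v21 : v2 / v1 = tau.
  by rewrite /v2 mulrAC divff ?mul1r// /v1; apply: contra_neq S0 => /(congr1 (@complex.Re R)).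
have ZE a b : a%:C * v1 + b%:C * v2 = (zr R S * (a + b * cs)) +i* (zr R S * (b * sn)).
  by apply/eqP; rewrite eq_complex /=; apply/andP; split; apply/eqP; ring.
exists (face_complex (@vertex_at links)), (position x); split.
- split.
  + split; last exact: (torus_homeomorphic flatT).
    by apply: face_complex_simplicial; exact: (vertex_at_cover chk).
  + by move=> a b d; exact: (position_row_free chk edge0 ori_gt0 t01).
  + exact: plI.
  + move=> v; have [_ uq] := cross v (ltn_ord v).
    by apply: (cone_angle_2pi chk edge0 ori_gt0 cs_t cs_sn sn_gt0) uq => u /cross[].
- exists v1, v2; rewrite v21; split=> //.
    pose c2 (z : R[i]) := complex.Im z / (zr R S * sn).
    pose c1 (z : R[i]) := complex.Re z / zr R S - cs * c2 z.
    apply: (@isometric _ _ _ _ _ _ _ v1 v2 c1 c2 flatT _ plI).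
    + move=> [a b]; rewrite ZE /c1 /c2 /=; congr (_ +i* _); field; rewrite ?S0 ?sn0//.
    + move=> i y z; rewrite !face_points_at// => iy iz.
      rewrite !bary_at ZE /norm2 (face_isometry chk edge0 (face_atP i) iy iz) /=.
      congr (Num.sqrt _); rewrite -!mulrBl /qnorm -cs_t.
      move: (_ - _) (_ - _) => L2 L1.
      have -> : zr R S * (L1 / zr R S + L2 / zr R S * cs) = L1 + L2 * cs by field.
      have -> : zr R S * (L2 / zr R S * sn) = L2 * sn by field.
      have -> : L2 ^+ 2 = L2 ^+ 2 * (cs ^+ 2 + sn ^+ 2) by rewrite cs_sn mulr1.
      ring.
    + move=> a b; rewrite ZE /c1 /c2 /=; split; field; rewrite ?S0 ?sn0//.
  (* As [|tau| = 1], this puts [tau] itself in the modular domain, reached by the identity matrix;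
     the nonnegative real part settles the choice between several representatives. *)
  have csI : 0 <= cs <= 1 / 2.
    by move: cs_t; case: t01 => ->; rewrite ?zr0 ?zr1 => h; apply/andP; split; lra.
  split; last by case/andP: csI.
  split; first by exists 1, 0, 0, 1; rewrite mulr1 mul0r subr0 !(mul1r, mul0r, addr0, add0r) divr1.
  split=> //=; first by rewrite cs_sn sqrtr1.
  by rewrite ger0_norm; case/andP: csI.
Qed.
End Realized.

(** * The angle pi / 3 *)

Section Cos.
Variable R : realType.
(** Since [2 pi / 3 = pi - pi / 3], doubling the angle changes the sign of the cosine [z]. Hence
    [2 z^2 + z - 1 = (2 z - 1) (z + 1) = 0], and [z] is positive. *)
Lemma cos_pi_third : cos (pi / 3 : R) = 1 / 2.
Proof.
have pi0 := pi_gt0 R.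
have c0 : 0 < cos (pi / 3 : R) by apply: cos_gt0_pihalf; apply/andP; split; lra.
have : cos ((pi / 3) *+ 2 : R) = - cos (pi / 3).
  by rewrite -[in RHS]cosN -cosDpi; congr cos; rewrite mulr2n; move: pi0; move: (pi : R) => p _;
    field.
rewrite cos_mulr2n -mulr_natr; move: c0; set z := cos _ => z0 zE.
have : (2 * z - 1) * (z + 1) = 0.
  by rewrite (_ : _ * _ = (z ^+ 2 * 2 - 1) + z); [rewrite zE addNr | ring].
by move=> /eqP; rewrite mulf_eq0 => /orP[] /eqP; lra.
Qed.

Lemma sin_pi_third_gt0 : 0 < sin (pi / 3 : R).
Proof. by have pi0 := pi_gt0 R; apply: sin_gt0_pi; apply/andP; split; lra. Qed.
End Cos.

(** * The two tori *)

Section Data.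
Local Open Scope Z_scope.

(** The vertex degrees are 6, 5, 7, 7, 5, 6, 6, 6, which makes 24 edges and 16 triangles. *)
Definition square_links : seq (seq corner) := [::
   [:: (1%N, (-1, 0)); (6%N, (-1, -1)); (5%N, (-1, -1)); (7%N, (0, -1)); (2%N, (0, 0)); (3%N, (-1,
      0))];
   [:: (0%N, (1, 0)); (3%N, (0, 0)); (4%N, (0, 0)); (2%N, (0, 0)); (6%N, (0, -1))];
   [:: (0%N, (0, 0)); (7%N, (0, -1)); (6%N, (0, -1)); (1%N, (0, 0)); (4%N, (0, 0)); (5%N, (-1, 0));
      (3%N, (-1, 0))];
   [:: (0%N, (1, 0)); (2%N, (1, 0)); (5%N, (0, 0)); (6%N, (0, 0)); (7%N, (0, 0)); (4%N, (0, 0));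
      (1%N, (0, 0))];
   [:: (1%N, (0, 0)); (3%N, (0, 0)); (7%N, (0, 0)); (5%N, (-1, 0)); (2%N, (0, 0))];
   [:: (0%N, (1, 1)); (6%N, (0, 0)); (3%N, (0, 0)); (2%N, (1, 0)); (4%N, (1, 0)); (7%N, (1, 0))];
   [:: (0%N, (1, 1)); (1%N, (0, 1)); (2%N, (0, 1)); (7%N, (0, 0)); (3%N, (0, 0)); (5%N, (0, 0))];
   [:: (0%N, (0, 1)); (5%N, (-1, 0)); (4%N, (0, 0)); (3%N, (0, 0)); (6%N, (0, 0)); (2%N, (0, 1))]].

(** Up to a few units, the space coordinates are invariant under the half turn about the third axis,
    which exchanges the vertices 0 and 5, 1 and 4, 2 and 3, 6 and 7. *)
Definition square_centre : seq Z :=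
  [:: 11688; -16769; 23576; -8958; 18971; -5467; 13711; -28705; 2083; -13711; 28705; 2085; 8958;
   -18973; -5468; -11688; 16769; 23576; 19698; -6445; -20708; -19699; 6444; -20708; -1; 0;
   67425; 38550; 22870; 9244; 74011; 49995; 29455; 20688; 96880; 59239; 53828; 99632; 43051;
   59607].

(* The variables solved for; the others keep their value at the centre. *)
Definition square_unknowns : seq nat :=
  ([:: 2; 4; 7; 8; 10; 11; 13; 14; 16; 17; 18; 21; 24; 25; 26; 28; 29; 30; 34; 35; 36; 37; 38;
    39])%N.

(* Approximately 10^8 times the inverse of the Jacobian matrix of the edge equations. *)
Definition square_newton : seq (seq Z) := [::
   [:: 4; 461; -144; 433; 302; 177; -906; 100; -148; -224; -315; 703; -184; -8; 18; -208; -71; 366;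
      -72; -103; 13; 100; -4; -58];
   [:: 624; -350; 253; 100; -161; -168; -1524; 100; 87; 193; 144; -331; -2; -8; 8; 361; 412; 300;
      -73; -23; 7; -175; -2; -230];
   [:: 20; -216; 22; 310; -580; 358; 499; 431; -309; 97; -236; -249; 59; -22; -245; 30; 63; 243;
      -316; -71; 30; -15; -9; -30];
   [:: -278; 62; -1087; 773; -1593; 248; -7642; -511; -834; -208; -35; 1253; -692; 22; 659; -1556;
      -22; 1195; 378; -188; -17; 752; 4; -632];
   [:: -12; -206; 325; 100; -145; 380; 339; -86; 70; 143; 102; -230; -100; 0; 16; 465; 401; 263;
      63; -25; -3; -225; 1; -189];
   [:: 356; -86; 141; -116; 233; -298; 7910; 1692; -31; 60; 62; -217; 959; -72; -82; 197; 49; -159;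
      -1243; 40; 95; -95; -27; 41];
   [:: 48; -182; 603; -155; 371; 259; 1241; 759; -484; 182; 322; -333; 2763; 419; -543; 893; 591;
      298; -644; -35; -569; -430; 166; -203];
   [:: -280; 80; -1131; 777; -1605; 219; -6448; -1816; 457; -222; -330; 1008; -6448; 219; 685;
      -1605; -330; 1008; 458; -222; -280; 776; 80; -347];
   [:: 23; -360; 543; 172; -253; 608; 534; 530; -391; 114; 247; 41; 533; 608; -362; -253; 247; 41;
      -391; 114; 23; 172; -360; -363];
   [:: 30; 94; -211; -13; -4; -204; 226; 99; 7; -118; -124; 264; -496; -19; 68; 506; -368; 601;
      -69; -239; 22; 320; 559; 84];
   [:: -106; 135; -14; -154; 289; -107; 69; -142; -151; 670; -255; 582; 9; 8; -12; -20; 319; -495;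
      104; 36; -11; 10; 3; 388];
   [:: -69; 124; -342; 74; -183; -131; -1858; -413; 60; -111; -344; 772; -1919; -16; 238; -491;
      230; -306; 315; -745; 26; 237; -8; -446];
   [:: -272; -427; -923; 750; -440; 141; -5266; -1778; 529; 28; -302; 271; -2928; -435; 573; -1353;
      -194; 655; 427; -105; 595; 652; -174; -329];
   [:: -1; -242; -610; -1; -1; 502; -20; -1; -4; 3; 0; 5; 1; 5; -3; -873; -342; -2; 1; 0; 0; 422;
      -1; 0];
   [:: 576; -168; -350; 255; -531; -426; -2763; -1976; 571; 11; -178; 2; -2763; -426; 551; -531;
      -178; 2; 571; 11; 576; 255; -168; -26];
   [:: -11; -38; -110; 140; -277; 83; 955; -1262; 1210; -5; -223; -101; -2322; -457; -16; -190;
      -193; -240; 46; 44; 615; 90; -179; 119];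
   [:: -19; 5; -459; 317; -657; 18; -392; -414; 305; -78; -542; -32; -392; 18; 279; -657; -542;
      -32; 305; -78; -19; 317; 5; 267];
   [:: 43; -54; -82; 122; -240; 42; 1469; -310; 511; 6; -169; -97; -1808; -498; 468; -153; -139;
      -235; -653; 55; 669; 72; -195; 82];
   [:: -273; 192; -584; 223; -493; 7; -5680; -1957; 663; -113; -338; 224; -3342; -570; 690; -1406;
      -231; 607; 561; -246; 594; 125; 444; 105];
   [:: -20; 7; 144; -102; 211; 11; -427; -423; 308; -80; -200; -25; -407; -485; 286; -661; -543;
      -32; 312; -83; -19; 321; 248; 266];
   [:: -257; 189; -787; 361; -780; -6; -4421; -1849; 697; 121; 45; -504; -2753; -429; 557; -1158;
      -180; 390; 478; -13; 585; 558; -171; -341];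
   [:: -39; 4; -2; 11; -21; 41; 1524; -5; 10; 627; 16; -36; -9; 0; 1; -2; -503; 34; 4; -3; 0; 1; 0;
      -26];
   [:: -227; 180; -601; 234; -516; -30; -5023; -1673; 573; -181; -344; 352; -3355; -453; 633; -894;
      -569; 1246; 353; -315; 615; 430; -180; 182];
   [:: -11; -4; -374; 270; -556; 24; -212; -319; 251; -61; 34; -79; -1744; -17; 227; -538; -486;
      -10; 245; -690; 28; 260; -9; 262]].

(* Linear forms separating the pairs of faces in space; zero for faces sharing an edge. *)
Definition square_heights : seq (Z * Z * Z) :=
  [:: (0, 0, 0); (3, 1, -1); (1, 1, 0); (13, 6, -2); (0, 0, 0); (12, 6, -1); (3, 2, 1); (0, 0, 0);
   (1, 1, 1); (2, 1, 0); (10, 5, -1); (-6, -5, -2); (-10, -31, 33); (10, 5, -1); (2, 1, 0); (0,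
   0, 0); (1, 1, 0); (10, 7, 3); (10, 7, 3); (3, 1, 2); (2, 1, 1); (2, 1, 1); (1, 1, 1); (3, 2,
   1); (3, 2, 1); (0, 0, 0); (0, -1, 1); (3, 1, 2); (3, 1, 1); (0, 0, 0); (-3, -2, 1); (-3, -2,
   1); (-2, -1, 1); (-3, -1, 2); (-3, -1, 2); (0, 1, 1); (-10, -7, 3); (-10, -7, 3); (-1, -1,
   0); (-1, -1, 1); (-2, -1, 1); (0, 0, 0); (0, 0, 0); (-1, -2, -1); (-2, -1, 1); (-2, -1, 1);
   (-2, -1, 1); (0, 0, 0); (-15, -11, 5); (-15, -11, 5); (-1, -1, 0); (-1, -1, 1); (-3, -2, 2);
   (-6, -5, 2); (0, 0, 0); (0, -1, 9); (0, 1, 9); (0, 1, 9); (1, 1, 2); (10, 5, 1); (0, 0, 0);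
   (-15, -11, -5); (-1, -1, 2); (0, -1, 9); (10, 5, 1); (0, 0, 0); (0, 1, 2); (0, 1, 2); (0, 1,
   1); (2, 1, 0); (10, 5, -1); (-15, -11, -5); (-5, -15, 16); (10, 5, -1); (2, 1, 0); (0, 0,
   0); (-19, -9, 0); (5, 15, 16); (0, 1, -2); (0, 1, -9); (-2, -1, -1); (-5, -15, 16); (0, 0,
   0); (3, 2, -1); (0, 0, 0); (5, 15, 16); (0, 0, 0); (0, -1, -9); (-2, -1, -1); (-5, -15, 16);
   (19, 9, 0); (12, 6, 1); (0, 0, 0); (10, 5, 1); (0, -1, -9); (-3, -2, -2); (-10, -31, 33);
   (19, 9, 0); (10, 5, 1); (-5, -15, -16); (-1, -1, -2); (-1, -1, -1); (0, 0, 0); (-10, -31,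
   -33); (-10, -31, -33); (0, 0, 0); (-1, -2, 1); (0, -1, 1); (0, -1, 2); (0, 0, 0); (0, 0, 0);
   (-1, -1, 2); (0, -1, 9); (13, 6, 2); (0, 0, 0); (2, 1, 1); (1, 1, 0); (0, 0, 0); (1, 1, -1);
   (0, 0, 0)].

(** The same triangulation as for the square torus, with the same cyclic order of labels in every
    link; only the offsets differ. *)
Definition hexagonal_links : seq (seq corner) := [::
   [:: (1%N, (-1, -1)); (6%N, (0, -1)); (5%N, (0, -1)); (7%N, (-1, 0)); (2%N, (-1, 0)); (3%N, (-1,
      0))];
   [:: (0%N, (1, 1)); (3%N, (0, 1)); (4%N, (0, 1)); (2%N, (0, 0)); (6%N, (1, 0))];
   [:: (0%N, (1, 0)); (7%N, (0, 0)); (6%N, (1, 0)); (1%N, (0, 0)); (4%N, (0, 1)); (5%N, (0, 0));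
      (3%N, (0, 0))];
   [:: (0%N, (1, 0)); (2%N, (0, 0)); (5%N, (0, 0)); (6%N, (0, 0)); (7%N, (-1, 0)); (4%N, (0, 0));
      (1%N, (0, -1))];
   [:: (1%N, (0, -1)); (3%N, (0, 0)); (7%N, (-1, 0)); (5%N, (0, -1)); (2%N, (0, -1))];
   [:: (0%N, (0, 1)); (6%N, (0, 0)); (3%N, (0, 0)); (2%N, (0, 0)); (4%N, (0, 1)); (7%N, (-1, 1))];
   [:: (0%N, (0, 1)); (1%N, (-1, 0)); (2%N, (-1, 0)); (7%N, (-1, 0)); (3%N, (0, 0)); (5%N, (0, 0))];
   [:: (0%N, (1, 0)); (5%N, (1, -1)); (4%N, (1, 0)); (3%N, (1, 0)); (6%N, (1, 0)); (2%N, (0, 0))]].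

Definition hexagonal_centre : seq Z :=
  [:: -21810; -5838; -22707; 3547; 14541; 5043; 22096; 2721; 3714; 16529; -35016; -6892; -19493;
   510; -18386; -12889; -15622; -27837; -11378; -15809; -953; 6060; 11876; 4474; 4; 9; 67087;
   84598; 74690; 59767; 44875; 44661; 25830; 4993; 16399; 91641; 6076; 71403; 95383; 44903].

Definition hexagonal_unknowns : seq nat :=
  ([:: 0; 1; 3; 4; 6; 10; 12; 17; 18; 20; 22; 24; 25; 26; 27; 28; 29; 30; 31; 32; 34; 35; 36;
    39])%N.

Definition hexagonal_newton : seq (seq Z) := [::
   [:: -491; -425; -1364; -436; -155; -51; 63; -87; -463; 449; 464; -15; 293; -111; 29; -158; -57;
      221; -251; 38; -321; 356; 225; -487];
   [:: -742; 539; 282; -515; 34; 614; 95; -132; -700; 677; 432; -330; 421; 43; -613; 347; 359; 36;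
      -415; 201; -702; -470; 285; -239];
   [:: 243; -600; 673; 202; -398; 155; -485; 809; -621; 496; 713; 344; -208; 374; 287; -755; -142;
      795; -317; -76; 507; 449; -505; -1179];
   [:: -35; 71; -84; -117; 139; -50; 314; 517; 849; 589; 99; -435; -154; -46; -145; 69; 184; -84;
      -268; 167; -12; -27; 39; 76];
   [:: 35; -136; 136; -263; 214; -72; -4; 6; 33; -32; 574; 366; 221; 249; 110; -295; -87; 329;
      -277; 122; -375; 62; -15; -613];
   [:: -59; 123; -145; -176; 215; -78; 7; -10; -55; 53; -95; -335; 71; 136; -605; -79; 84; -395;
      -192; 311; -569; -57; 156; 532];
   [:: -8; 26; -27; 32; -23; 7; 1; -1; -7; 7; -195; 231; -375; 339; 41; -273; -10; 322; -322; -641;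
      -973; -63; 187; -424];
   [:: -218; 618; -667; 280; -71; 9; 28; -39; -206; 199; 221; -27; 243; -176; 63; -371; 262; 181;
      -291; 178; -496; -562; -417; -217];
   [:: -64; 168; -186; -3; 58; -25; 8; -11; -61; 59; 151; -262; 416; -333; -137; 411; -985; 510;
      -211; -490; 465; -102; 37; -748];
   [:: -599; 1639; -1786; 426; 123; -85; 76; -107; -565; 547; -644; 255; 508; -417; 54; -147; 20;
      101; -159; -684; 684; 706; -2; 51];
   [:: -32; 144; -139; 354; -302; 102; 4; -6; -30; 29; 1323; -396; 38; 133; -69; -71; 92; 107;
      -168; 328; -569; -64; 158; 669];
   [:: -73; 167; 1886; 844; -571; -395; 9; -13; -68; 66; 1672; -105; -219; 289; 376; -213; 82;
      -296; 375; -356; 755; -136; -552; 103];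
   [:: -531; -331; -1344; 164; 238; 363; 68; -94; -501; 484; -372; -192; 712; -464; -391; 229; -1;
      217; -388; -646; 463; 299; 133; -217];
   [:: 24; 5; 16; 403; -396; 139; -205; -800; -201; 766; 1698; -508; 368; -128; 6; 95; 204; -303;
      404; -548; 389; 33; -80; -1];
   [:: -122; 313; -347; -37; 140; -57; 636; -219; -1197; -388; -390; 103; 729; -260; -424; 490; 22;
      -154; -466; -288; -171; -274; 270; 263];
   [:: -9; 65; -58; 240; -215; 74; 1; -2; -9; 8; 1902; -10; -193; -339; -129; 375; 25; -356; 326;
      -319; 677; -57; -54; 5];
   [:: 89; -150; 191; 477; -520; 186; -11; 16; 84; -81; -370; 214; 566; -76; -155; -19; -89; 317;
      -332; -609; 548; 103; -190; -281];
   [:: 143; -285; 343; 524; -611; 221; -18; 25; 135; -131; 1736; -108; -220; 176; 557; -415; -118;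
      -541; 256; -126; 391; 282; -306; 362];
   [:: -181; 465; -516; -50; 203; -83; 23; -32; -171; 165; -389; -153; 650; -592; -123; 921; 212;
      -11; -436; -481; 258; -402; 322; 57];
   [:: -147; 440; -468; 329; -179; 51; 19; -26; -139; 134; 977; -394; 320; -135; -114; 425; 218;
      -618; 517; -1044; -705; -337; 417; 527];
   [:: -210; 656; -690; 629; -402; 124; 27; -37; -198; 192; 1584; -345; -202; 477; -157; 330; 302;
      -506; 351; -300; 643; -542; -308; 360];
   [:: -61; 140; -161; -108; 153; -57; 8; -11; -57; 55; -497; 26; 455; -514; 86; -209; 59; 113;
      -122; -805; 951; -134; 496; -119];
   [:: 221; -525; 595; 302; -472; 179; -28; 39; 208; -201; 2092; -664; -16; 181; -28; -255; 765;
      -299; 43; -131; 237; 78; -240; -86];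
   [:: 56; -148; 163; -10; -39; 18; -7; 10; 53; -51; 395; -254; 269; -233; -26; 69; -40; -21; 36;
      -768; 1045; 179; -298; 523]].

Definition hexagonal_heights : seq (Z * Z * Z) :=
  [:: (0, 0, 0); (-1, 0, 1); (-1, 0, 1); (-1, 0, 1); (0, 0, 0); (-25, -14, 33); (-2, -3, 4); (0,
   0, 0); (-2, 1, 0); (-3, -3, 5); (-2, 1, 1); (-2, 2, 1); (-2, 1, 0); (-9, -5, 12); (-4, -5,
   7); (0, 0, 0); (0, -1, 0); (-5, -6, 0); (-5, -6, 0); (-1, -1, 0); (0, -1, 0); (-1, 0, -1);
   (-1, 0, -1); (-2, -2, 1); (-2, 0, 1); (0, 0, 0); (-1, 0, -1); (-1, -1, 0); (-2, -2, 1); (0,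
   0, 0); (8, 17, -19); (4, 3, -6); (21, 12, -29); (-3, -5, 6); (0, 1, -5); (0, 1, -1); (-5,
   -8, 10); (-1, 1, 0); (0, 1, 0); (0, 1, -1); (35, 20, -49); (0, 0, 0); (0, 0, 0); (4, 3, -6);
   (21, 12, -29); (-6, -11, 13); (1, 4, -22); (0, 0, 0); (-5, -9, 11); (-1, 1, 1); (0, 1, 0);
   (1, 1, -2); (35, 20, -49); (-10, -20, 23); (0, 0, 0); (5, 2, -9); (1, -3, -1); (1, 0, -2);
   (1, 0, -2); (-5, -9, 11); (0, 0, 0); (3, 4, 0); (2, 1, -4); (5, 2, -9); (-7, -14, 16); (0,
   0, 0); (-2, -3, 4); (0, 1, -5); (0, 2, -9); (-3, -3, 5); (-2, -1, 2); (3, 4, 0); (-2, 9,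
   -39); (-43, -25, 58); (-4, -5, 7); (0, 0, 0); (0, 1, -5); (0, 2, -9); (-3, -2, 5); (-2, -1,
   2); (3, 4, 0); (-2, 9, -39); (0, 0, 0); (-5, -3, 7); (0, 0, 0); (6, 11, -13); (0, 0, 0);
   (-1, 2, 1); (0, 1, 0); (2, 3, -4); (4, 7, -8); (4, 7, -8); (0, 0, 0); (-1, 0, 2); (-1, 0,
   2); (0, 1, 1); (-1, -5, 28); (0, -1, 5); (0, -1, 5); (-1, 0, 2); (-1, 0, 2); (0, 1, 1); (0,
   0, 0); (0, -1, 5); (0, -1, 1); (0, 0, 0); (0, 1, 0); (1, 1, -2); (3, 2, -5); (0, 0, 0); (0,
   0, 0); (2, 1, -3); (2, 1, -3); (1, -1, 0); (0, 0, 0); (-3, -4, 0); (0, -1, 0); (0, 0, 0);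
   (0, -1, 1); (0, 0, 0)].

End Data.

Lemma square_valid : valid square_links Z0 100000 (nth Z0 square_centre) square_unknowns
  square_newton 100000000 square_heights.
Proof. by vm_compute. Qed.

Lemma hexagonal_valid : valid hexagonal_links (Zpos 1) 100000 (nth Z0 hexagonal_centre)
  hexagonal_unknowns hexagonal_newton 100000000 hexagonal_heights.
Proof. by vm_compute. Qed.

Theorem theorem1 (R : realType) :
  realized 8 (0 +i* 1 : R[i]) /\ realized 8 (rho R).
Proof.
split.
  by apply: (valid_realized square_valid); rewrite ?zr0 ?mulr0// expr1n expr0n add0r.
apply: (valid_realized hexagonal_valid); last exact: sin_pi_third_gt0.
  by rewrite cos_pi_third zr1 mulrC divfK.
exact: cos2Dsin2.
Qed.
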